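(* Let $G$ be a connected compact semisimple Lie group with a continuous conjugation-invariant length function $\ell$, and let $\omega$ be an element of an integral coadjoint orbit for $G$ (that is, $\omega$ is the highest weight functional of an irreducible unitary representation of $G$). Let $H$ be the stabilizer of $\omega$ under the coadjoint action, and let $L_A$ be the Lip-norm on $A=C(G/H)$ corresponding to $\ell$. For each integer $n\ge1$ let $(U^n,\mathcal H^n)$ be the irreducible unitary representation of $G$ with highest weight $n\omega$, and let $B^n=B(\mathcal H^n)$ with its action of $G$ by conjugation by $U^n$. Let $\sigma^n:B^n\to A$ be the Berezin covariant symbol map using the projection $P^n$ on the highest weight vector for $n\omega$, and let $\breve\sigma^n:A\to B^n$ be its adjoint. Then there is a sequence of numbers $\{\gamma_n\}$ converging to $0$ such that $$\|f-\sigma^n(\breve\sigma^n(f))\|_\infty\le\gamma_n L_A(f)$$ for all $f\in A$ and all $n$.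
   Context: Length function: $\ell:G\to[0,\infty)$ is continuous, $\ell(x)=0$ iff $x=e$, $\ell(x^{-1})=\ell(x)$, $\ell(xy)\le\ell(x)+\ell(y)$, and $\ell(xyx^{-1})=\ell(y)$. Highest weight functional: let $\mathfrak g_0$ be the Lie algebra of $G$. For an irreducible unitary representation $(U,\mathcal H)$ of $G$ (with $U$ also denoting the Lie algebra representation) with unit highest weight vector $\xi$ (relative to a maximal torus and a choice of positive roots), the associated functional is $\omega\in\mathfrak g_0^*$, $\omega(X)=-i\langle U_X\xi,\xi\rangle$. Its stabilizer $H$ under the coadjoint action equals the stabilizer $\{x: U_xPU_x^*=P\}$ of the projection $P$ onto $\mathbb C\xi$. The representation with highest weight $n\omega$ is the subrepresentation $(U^n,\mathcal H^n)$ of the $n$-th inner tensor power $(U^{\otimes n},\mathcal H^{\otimes n})$ generated by $\xi^n=\xi^{\otimes n}$, and $P^n$ is the projection onto $\mathbb C\xi^n$; its stabilizer is also $H$. Lip-norm: $L_A(f)=\sup\{\|\lambda_x(f)-f\|_\infty/\ell(x):x\ne e\}\in[0,+\infty]$, with $(\lambda_xf)(y)=f(x^{-1}y)$. Symbols: $\alpha_x(T)=U^n_xT(U^n_x)^*$ and $\tau$ is the un-normalized trace on $B^n$. The Berezin covariant symbol of $T\in B^n$ is $\sigma^n_T(x)=\tau(T\alpha_x(P^n))$, a continuous function on $G/H$. The adjoint $\breve\sigma^n$ is taken with respect to the $L^2(G/H)$ inner product on $A$ (invariant probability measure) and the Hilbert--Schmidt inner product on $B^n$ from the normalized trace $d_n^{-1}\tau$,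 $d_n=\dim\mathcal H^n$; explicitly $\breve\sigma^n(f)=d_n\int_{G/H}f(x)\alpha_x(P^n)\,dx$. *)

(* Defs.v *)
From HB Require Import structures.
From mathcomp Require Import all_boot all_order all_algebra.
From mathcomp Require Import all_classical all_reals all_analysis.
From mathcomp Require Import complex.

Set Implicit Arguments.
Unset Strict Implicit.
Unset Printing Implicit Defensive.

Import Order.TTheory GRing.Theory Num.Theory.
Import numFieldNormedType.Exports.

Local Open Scope classical_set_scope.
Local Open Scope ring_scope.
Local Open Scope complex_scope.
Local Open Scope sesquilinear_scope.

HB.mixin Record isTopologicalGroup G & Topological G & Group G := {
  mulg_continuous : continuous (fun p : G * G => (p.1 * p.2)%g);
  invg_continuous : continuous (fun x : G => (x^-1)%g)
}.

#[short(type="topologicalGroupType")]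
HB.structure Definition TopologicalGroup :=
  {G of Topological G & Group G & isTopologicalGroup G}.

Section smooth.
Context {R : realType}.

(** Meant for [D] open and [V] finite-dimensional, where continuity of all
    iterated directional derivatives is the usual C^k condition. *)
Fixpoint Ck_on (V W : normedModType R) (k : nat) (D : set V) (f : V -> W)
    : Prop :=
  (forall x, D x -> {for x, continuous f}) /\
  (if k is k'.+1 then
     forall v, (forall x, D x -> derivable f x v) /\
               Ck_on k' D (fun x => 'D_v f x)
   else True).

Definition smooth_on (V W : normedModType R) (D : set V) (f : V -> W) :=
  forall k, Ck_on k D f.

(** [cmap] is only meaningful on [cdom], and [cinv] on [cimg]. *)
Record chart (m : nat) (M : topologicalType) := Chart {
  cdom : set M;
  cmap : M -> 'rV[R]_m;
  cinv : 'rV[R]_m -> M;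
  cdom_open : open cdom;
  cimg_open : open (cmap @` cdom);
  cmapK : forall x, cdom x -> cinv (cmap x) = x;
  cmap_continuous : forall x, cdom x -> {for x, continuous cmap};
  cinv_continuous : forall v, (cmap @` cdom) v -> {for v, continuous cinv}
}.

Definition cimg (m : nat) (M : topologicalType) (c : chart m M) :=
  cmap c @` cdom c.

(** The base chart [lie_chart] at the identity carries no extra structure: it
    only fixes coordinates on the tangent space at the identity, which is thereby
    identified with ['rV[R]_m]. *)
Record lieGroup (m : nat) (G : topologicalGroupType) := LieGroup {
  lie_hausdorff : hausdorff_space G;
  lie_second_countable : @second_countable G;
  lie_atlas : set (chart m G);
  lie_cover : forall x, exists2 c, lie_atlas c & cdom c x;
  lie_compatible : forall c1 c2, lie_atlas c1 -> lie_atlas c2 ->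
    smooth_on (cmap c1 @` (cdom c1 `&` cdom c2)) (cmap c2 \o cinv c1);
  lie_mul_smooth : forall c1 c2 c3,
    lie_atlas c1 -> lie_atlas c2 -> lie_atlas c3 ->
    smooth_on
      [set p : 'rV[R]_m * 'rV[R]_m | [/\ cimg c1 p.1, cimg c2 p.2 &
                                         cdom c3 (cinv c1 p.1 * cinv c2 p.2)%g]]
      (fun p => cmap c3 (cinv c1 p.1 * cinv c2 p.2)%g);
  lie_inv_smooth : forall c1 c2, lie_atlas c1 -> lie_atlas c2 ->
    smooth_on [set v | cimg c1 v /\ cdom c2 ((cinv c1 v)^-1)%g]
      (fun v => cmap c2 ((cinv c1 v)^-1)%g);
  lie_chart : chart m G;
  lie_chart_atlas : lie_atlas lie_chart;
  lie_chart1 : cdom lie_chart 1%g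
}.

End smooth.

Section lie_algebra.
Context {R : realType} {m : nat} {G : topologicalGroupType}.
Variable S : @lieGroup R m G.

Local Notation c := (lie_chart S).
Local Notation e := (cmap c 1%g : 'rV[R]_m).

(** The differential at the identity of conjugation by [x]. *)
Definition Ad (x : G) (X : 'rV[R]_m) : 'rV[R]_m :=
  'D_X (fun v => cmap c (x * cinv c v * x^-1)%g) e.

(** The differential of [Ad] at the identity is the adjoint representation
    [ad X Y = [X, Y]]. *)
Definition lie_bracket (X Y : 'rV[R]_m) : 'rV[R]_m :=
  'D_X (fun v => Ad (cinv c v) Y) e.

(** Semisimple Lie algebra: the only abelian ideal is zero (Bourbaki). *)
Definition lie_semisimple : Prop :=
  forall I : {vspace 'rV[R]_m},
    (forall X Y, Y \in I -> lie_bracket X Y \in I) ->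
    (forall X Y, X \in I -> Y \in I -> lie_bracket X Y = 0) ->
    I = 0%VS.

Definition is_torus (T : set G) : Prop :=
  [/\ T 1%g, forall x y, T x -> T y -> T (x * y)%g,
      forall x, T x -> T (x^-1)%g,
      forall x y, T x -> T y -> (x * y = y * x)%g &
      compact T /\ connected T].

Definition maximal_torus (T : set G) : Prop :=
  is_torus T /\ forall T', is_torus T' -> T `<=` T' -> T' = T.

(** The vectors [X] whose one-parameter group [s |-> exp (s X)] lies in [T]. *)
Definition lie_of_subgroup (T : set G) : set 'rV[R]_m :=
  [set X | exists g : R -> G,
     [/\ continuous g, forall s t, g (s + t) = (g s * g t)%g,
         forall s, T (g s) & is_derive (0 : R) (1 : R) (cmap c \o g) X]].

(** With [Z = A + iB] in the complexified Lie algebra, this says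
    [[X, Z] = i * alpha X * Z] for all [X] in the Lie algebra of [T]. *)
Definition in_root_space (T : set G) (alpha : 'rV[R]_m -> R)
    (A B : 'rV[R]_m) : Prop :=
  forall X, lie_of_subgroup T X ->
    lie_bracket X A = - (alpha X *: B) /\ lie_bracket X B = alpha X *: A.

(** A root is a functional on the Lie algebra of [T]: the values of [alpha]
    elsewhere are irrelevant. *)
Definition is_root (T : set G) (alpha : 'rV[R]_m -> R) : Prop :=
  (exists2 X, lie_of_subgroup T X & alpha X != 0) /\
  (exists A B, in_root_space T alpha A B /\ (A, B) != (0, 0)).

(** A regular element of the Lie algebra of [T] selects a Weyl chamber, hence a
    choice of positive roots: those that are positive on it. *)
Definition regular_element (T : set G) (X0 : 'rV[R]_m) : Prop :=
  lie_of_subgroup T X0 /\ forall alpha, is_root T alpha -> alpha X0 != 0.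

Definition positive_root (T : set G) (X0 : 'rV[R]_m)
    (alpha : 'rV[R]_m -> R) : Prop :=
  is_root T alpha /\ 0 < alpha X0.

(** The coadjoint action is [(x . omega) X = omega (Ad x^-1 X)]. *)
Definition coadjoint_stabilizer (omega : 'rV[R]_m -> R) : set G :=
  [set x | forall X, omega (Ad (x^-1)%g X) = omega X].

Definition continuousC (X : topologicalType) (f : X -> R[i]) : Prop :=
  continuous (fun x => complex.Re (f x)) /\
  continuous (fun x => complex.Im (f x)).

(** Linear in the first variable. *)
Definition inner (d : nat) (u v : 'cV[R[i]]_d) : R[i] :=
  \sum_k u k 0 * (v k 0)^*.

Definition unitary_rep (d : nat) (U : G -> 'M[R[i]]_d) : Prop :=
  [/\ forall x y, U (x * y)%g = U x *m U y,
      forall x, U x \is unitarymx &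
      forall j k, continuousC (fun x => U x j k)].

Definition irreducible_rep (d : nat) (U : G -> 'M[R[i]]_d) : Prop :=
  (0 < d)%N /\
  forall W : {vspace 'cV[R[i]]_d},
    (forall x v, v \in W -> U x *m v \in W) -> W = 0%VS \/ W = fullv.

(** The Lie algebra representation, i.e. the differential of [U] at the
    identity. *)
Definition dU (d : nat) (U : G -> 'M[R[i]]_d) (X : 'rV[R]_m) : 'M[R[i]]_d :=
  \matrix_(j, k)
    ('D_X (fun v => complex.Re (U (cinv c v) j k)) e +i*
     'D_X (fun v => complex.Im (U (cinv c v) j k)) e).

(** Weight vectors satisfy [U_X xi = i * lambda X * xi] on the Lie algebra of
    [T], and [dU U A + 'i *: dU U B] is the action of [A + iB]. *)
Definition highest_weight_vector (T : set G) (X0 : 'rV[R]_m) (d : nat)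
    (U : G -> 'M[R[i]]_d) (xi : 'cV[R[i]]_d) : Prop :=
  [/\ xi != 0,
      exists lambda : 'rV[R]_m -> R, forall X, lie_of_subgroup T X ->
        dU U X *m xi = ('i * (lambda X)%:C) *: xi &
      forall alpha A B, positive_root T X0 alpha -> in_root_space T alpha A B ->
        (dU U A + 'i *: dU U B) *m xi = 0].

(** [U] is an irreducible unitary representation with unit highest weight vector
    [xi], relative to the maximal torus [T] and the positive roots selected by
    [X0], whose associated functional is [omega]. *)
Definition highest_weight_rep (T : set G) (X0 : 'rV[R]_m)
    (omega : 'rV[R]_m -> R) (d : nat) (U : G -> 'M[R[i]]_d)
    (xi : 'cV[R[i]]_d) : Prop :=
  [/\ unitary_rep U, irreducible_rep U, highest_weight_vector T X0 U xi,
      inner xi xi = 1 &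
      forall X, (omega X)%:C = - 'i * inner (dU U X *m xi) xi].

End lie_algebra.

Section coset_space.
Context {G : topologicalGroupType}.
Variable H : set G.

Definition lcoset_of (x : G) : set G := [set (x * h)%g | h in H].

Definition lcoset_rel (x y : G) : bool := `[< lcoset_of x = lcoset_of y >].

Fact lcoset_rel_refl : reflexive lcoset_rel.
Proof. by move=> x; apply/asboolP. Qed.

Fact lcoset_rel_sym : symmetric lcoset_rel.
Proof. by move=> x y; apply: asbool_equiv_eq; split=> ->. Qed.

Fact lcoset_rel_trans : transitive lcoset_rel.
Proof. by move=> y x z /asboolP xy /asboolP yz; apply/asboolP; rewrite xy. Qed.

Definition lcoset_equiv : equiv_rel G :=
  EquivRel lcoset_rel lcoset_rel_refl lcoset_rel_sym lcoset_rel_trans.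

Definition coset_space := {eq_quot lcoset_equiv}%qT.

HB.instance Definition _ :=
  Topological.copy coset_space (quotient_topology coset_space).
HB.instance Definition _ := Quotient.on coset_space.
HB.instance Definition _ :=
  isPointed.Build coset_space (\pi_coset_space 1%g)%qT.

Definition borel_coset_space := g_sigma_algebraType (@open coset_space).

Definition translate (x : G) (q : coset_space) : coset_space :=
  (\pi_coset_space (x * repr q)%g)%qT.

End coset_space.

Definition invariant_measure {R : realType} {G : topologicalGroupType}
    (H : set G) (mu : probability (borel_coset_space H) R) : Prop :=
  forall x (A : set (borel_coset_space H)), measurable A ->
    mu (translate x @^-1` A) = mu A.

Definition length_function {R : realType} {G : topologicalGroupType}
    (ell : G -> R) : Prop :=
  [/\ continuous ell, forall x, 0 <= ell x, forall x, ell x = 0 <-> x = 1%g,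
      forall x, ell (x^-1)%g = ell x &
      (forall x y, ell (x * y)%g <= ell x + ell y) /\
      (forall x y, ell (x * y * x^-1)%g = ell y)].

Section berezin.
Context {R : realType} {G : topologicalGroupType}.
Variable H : set G.

Definition sup_norm (f : coset_space H -> R[i]) : \bar R :=
  ereal_sup [set (Normc.normc (f q))%:E | q in [set: coset_space H]].

(** The value 0 is adjoined because the supremum is taken in [0, +oo], whereas
    [ereal_sup] of the empty set (trivial [G]) is -oo. *)
Definition lip_norm (ell : G -> R) (f : coset_space H -> R[i]) : \bar R :=
  ereal_sup ([set 0%E] `|`
    [set (sup_norm (fun q => (f (translate (x^-1)%g q) - f q)%R)
          * ((ell x)^-1)%:E)%E | x in [set x : G | x <> 1%g]]).

Definition integralC (mu : probability (borel_coset_space H) R)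
    (f : coset_space H -> R[i]) : R[i] :=
  (\int[mu]_(q in [set: borel_coset_space H]) complex.Re (f q)) +i*
  (\int[mu]_(q in [set: borel_coset_space H]) complex.Im (f q)).

(** The orthogonal projection onto the line spanned by the unit vector [xi]. *)
Definition line_proj (d : nat) (xi : 'cV[R[i]]_d) : 'M[R[i]]_d := xi *m xi^t*.

(** Intended for [H] stabilizing [line_proj xi] under conjugation by [U]; then
    the choice of representative is immaterial. *)
Definition berezin_symbol (d : nat) (U : G -> 'M[R[i]]_d) (xi : 'cV[R[i]]_d)
    (T : 'M[R[i]]_d) (q : coset_space H) : R[i] :=
  \tr (T *m (U (repr q) *m line_proj xi *m (U (repr q))^t*)).

Definition L2_inner (mu : probability (borel_coset_space H) R)
    (f g : coset_space H -> R[i]) : R[i] :=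
  integralC mu (fun q => f q * (g q)^*).

(** Hilbert-Schmidt inner product from the normalized trace. *)
Definition HS_inner (d : nat) (A B : 'M[R[i]]_d) : R[i] :=
  (d%:R)^-1 * \tr (A *m B^t*).

Definition adjoint_on_continuous (mu : probability (borel_coset_space H) R)
    (d : nat) (sigma : 'M[R[i]]_d -> coset_space H -> R[i])
    (sigma_adj : (coset_space H -> R[i]) -> 'M[R[i]]_d) : Prop :=
  forall (T : 'M[R[i]]_d) (f : coset_space H -> R[i]), continuousC f ->
    L2_inner mu (sigma T) f = HS_inner T (sigma_adj f).

End berezin.

(* Main.v *)
From HB Require Import structures.
Require Import Defs.
From mathcomp Require Import all_boot all_order all_algebra.
From mathcomp Require Import all_classical all_reals all_analysis.
From mathcomp Require Import complex measurable_realfun ring lra.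
From mathcomp Require finmap mxtens.

Set Implicit Arguments.
Unset Strict Implicit.
Unset Printing Implicit Defensive.

Import Order.TTheory GRing.Theory Num.Theory.
Import numFieldNormedType.Exports.

Local Open Scope classical_set_scope.
Local Open Scope ring_scope.

(** Let [k_n(x) = |<U^n_x xi_n, xi_n>|^2], which is the trace of the projection [P^n] times its
    conjugate by [U^n_x]. Testing the adjunction on conjugates of [P^n] shows that applying the
    adjoint and then the symbol map to [f] gives, at the coset of [y], [d_n] times the mean of
    [k_n(y^-1 x) f(x)] ([berezin_adj]). By Schur's lemma the adjoint sends 1 to 1 ([sigma_adj1]), so
    [d_n k_n] has mean one ([mean_kern]), and the error at [y] is a weighted average of the
    differences [f(y) - f(x)].

    Two facts about the kernels make these averages concentrate at the coset of [y]. First,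
    [k_n = k^n] with [k = k_1], because matrix coefficients of highest weight vectors multiply when
    highest weights are added ([highest_weight_mul]). Second, [k] is continuous, at most 1, and
    equal to 1 only on [H]: equality in the Cauchy-Schwarz inequality says that [x] preserves the
    line of [xi], and the stabilizer of that line is [H] ([stabilizer_line]). By compactness
    [k <= delta < 1] at distance at least [e] from [H] ([kern_concentration]), whereas the mean of
    [k^n] is at least [c * delta'^n] with [c > 0], for any [delta' < 1] ([kern_mean_lower]). With
    [delta < delta' < 1], and since [d_n] times the mean of [k^n] is 1, the product [d_n * delta^n]
    tends to 0. A function of Lip-norm [L] satisfies a Lipschitz bound in terms of [ell]
    ([lip_norm_lipschitz]), so its real and imaginary parts each contribute at most
    [L * (e + M * d_n * delta^n)], where [M] bounds [ell] ([mean_error]); here [e] is arbitrary.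

    The remaining work derives the required Lie theory from the charts. In coordinates
    multiplication is addition up to a cross term ([local_mul_exists]). This gives one regularity
    theorem ([almost_hom_differentiable]), which provides differentials both for conjugations and
    for continuous representations. One-parameter groups arise as ultralimits of powers
    ([limit_one_param]) and show that the Lie algebra of a maximal torus is its own centralizer
    ([maximal_torus_lie]). Orbits in a compact group are bounded, which makes the adjoint action of
    the torus diagonalizable with imaginary eigenvalues and yields the root decomposition
    ([root_decomposition]). Statements about highest weight vectors are then reduced to words in the
    Lie algebra, which determine matrix coefficients on a connected group ([rep_words_vanish]):
    positive root vectors are moved through the word until they kill the vector on the right, and
    negative ones are killed by the functional on the left ([highest_weight_words]). *)

Section directional.
Variables (R : realType).

(** * Directional derivatives and the sup norm of matrices *)

Lemma is_deriveP (V W : normedModType R) (f : V -> W) a v d :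
  is_derive a v f d <->
  (h^-1 *: (f (h *: v + a) - f a)) @[h --> 0^'] --> d.
Proof.
split=> [[df <-]|fd]; first exact: df.
by split; [apply/cvg_ex; exists d|exact: cvg_lim].
Qed.

Lemma is_derive_scale (V W : normedModType R) (f : V -> W) a v d (c : R) :
  is_derive a v f d -> is_derive a (c *: v) f (c *: d).
Proof.
have [->|c0] := eqVneq c 0.
  by rewrite !scale0r => _; exact: is_derive0.
move=> /is_deriveP fd; apply/is_deriveP.
have cvgc : (c * h) @[h --> (0 : R)^'] --> (0 : R)^'.
  move=> A /= [e /= e0 eA].
  exists (e / `|c|) => /=; first by rewrite divr_gt0 // normr_gt0.
  move=> h /= he h0; apply: eA => /=; last by rewrite mulf_neq0.
  move: he; rewrite !sub0r !normrN normrM => he.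
  by rewrite mulrC -ltr_pdivlMr ?normr_gt0.
apply: cvg_trans (cvgZ (cvg_cst c) (cvg_comp _ _ cvgc fd)).
apply: near_eq_cvg; near=> h => /=.
have h0 : h != 0 by near: h; exact: nbhs_dnbhs_neq.
by rewrite !scalerA invfM mulrA divff // mul1r (mulrC h).
Unshelve. all: by end_near. Qed.

Lemma is_derive_line (V W : normedModType R) (f : V -> W) a v d (t : R) :
  is_derive (t *: v + a) v f d -> is_derive t 1 (fun s => f (s *: v + a)) d.
Proof.
move=> /is_deriveP fd; apply/is_deriveP; move: fd.
under eq_fun do rewrite addrA -scalerDl.
by under [in X in _ -> X]eq_fun do rewrite [_%:A]mulr1.
Qed.

Lemma is_derive_coord (V : normedModType R) m n (f : V -> 'M[R]_(m, n)) a v d i j :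
  is_derive a v f d -> is_derive a v (fun x => f x i j) (d i j).
Proof.
move=> /is_deriveP fd; apply/is_deriveP.
apply: cvg_trans (cvg_comp _ _ fd (@coord_continuous R m n i j d)).
by apply: near_eq_cvg; apply: nearW => h /=; rewrite !mxE.
Qed.

Lemma mx_norm_le m n (A : 'M[R]_(m, n)) (b : R) :
  0 <= b -> (forall i j, `|A i j| <= b) -> `|A| <= b.
Proof.
move=> b0 Ab; rewrite -[`|A|]/(mx_norm A) mx_normrE; by apply/bigmax_leP.
Qed.

Lemma le_mx_norm m n (A : 'M[R]_(m, n)) i j : `|A i j| <= `|A|.
Proof.
rewrite -[`|A|]/(mx_norm A) mx_normrE; apply/bigmax_geP; right => /=.
by exists (i, j).
Qed.

End directional.

(** * Mixed second differences of twice differentiable maps *)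

Section mixed_difference.
Variables (R : realType) (m p : nat).
Local Notation V := 'rV[R]_m.
Variables (D : set (V * V)) (F : V * V -> 'rV[R]_p).

(** For each coordinate of the value, two applications of the mean value theorem, in [x] and then in
    [y], turn the alternating sum over the corners of a rectangle into [s * t] times a mixed
    derivative at some point of it. The parameters run over the unit interval, so [s] and [t] may
    have any sign. *)
Lemma mixed_rectangle (C : R) (a : V * V) (v w : V) (s t : R) :
  Ck_on 2 D F ->
  (forall x y : R, 0 <= x <= 1 -> 0 <= y <= 1 ->
     let q := (a.1 + (x * s) *: v, a.2 + (y * t) *: w) in
     D q /\ `|'D_(0, w) (fun z => 'D_(v, 0) F z) q| <= C) ->
  `|F (a.1 + s *: v, a.2 + t *: w) - F (a.1 + s *: v, a.2)
    - F (a.1, a.2 + t *: w) + F a| <= C * `|s| * `|t|.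
Proof.
move=> [_ /(_ (v, 0)) [dF [_ /(_ (0, w)) [ddF _]]]] box.
have C0 : 0 <= C.
  by apply: le_trans (proj2 (box 0 0 _ _)); rewrite ?normr_ge0 ?lexx ?ler01.
apply: mx_norm_le; first by rewrite !mulr_ge0.
move=> i j; rewrite ord1 {i} !mxE.
pose P x y : V * V := (a.1 + (x * s) *: v, a.2 + (y * t) *: w).
pose G x := F (P x 1) 0 j - F (P x 0) 0 j.
have d1 (x y : R) : 0 <= x <= 1 -> 0 <= y <= 1 ->
    is_derive x (1 : R) (fun z => F (P z y) 0 j) ((s *: 'D_(v, 0) F (P x y)) 0 j).
  move=> x01 y01; apply: (is_derive_coord (f := fun z => F (P z y))).
  have E z : P z y = z *: (s *: ((v, 0) : V * V)) + (a.1, a.2 + (y * t) *: w).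
    by congr (_, _) => /=; rewrite ?scaler0 ?add0r // scalerA addrC.
  under eq_fun do rewrite E.
  apply: is_derive_line; rewrite -E; apply: is_derive_scale.
  by apply: derivableP; apply: dF; case: (box x y x01 y01).
have d2 (x y : R) : 0 <= x <= 1 -> 0 <= y <= 1 ->
    is_derive y (1 : R) (fun z => (s *: 'D_(v, 0) F (P x z)) 0 j)
      ((s *: (t *: 'D_(0, w) (fun z => 'D_(v, 0) F z) (P x y))) 0 j).
  move=> x01 y01; apply: (is_derive_coord (f := fun z => s *: 'D_(v, 0) F (P x z))).
  have E z : P x z = z *: (t *: ((0, w) : V * V)) + (a.1 + (x * s) *: v, a.2).
    by congr (_, _) => /=; rewrite ?scaler0 ?add0r // scalerA addrC.
  apply: is_deriveZ.
  under eq_fun do rewrite E.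
  apply: (@is_derive_line _ _ _ ('D_(v, 0) F)); rewrite -E; apply: is_derive_scale.
  by apply: derivableP; apply: ddF; case: (box x y x01 y01).
have in01 (x : R) : x \in `[0, 1] -> 0 <= x <= 1 by rewrite in_itv.
have in01' (x : R) : x \in `]0, 1[ -> 0 <= x <= 1.
  by rewrite in_itv /= => /andP[x0 x1]; rewrite !ltW.
have zero01 : 0 <= (0 : R) <= 1 by rewrite lexx ler01.
have one01 : 0 <= (1 : R) <= 1 by rewrite lexx ler01.
have dG (x : R) : 0 <= x <= 1 -> is_derive x 1 G
    ((s *: 'D_(v, 0) F (P x 1)) 0 j - (s *: 'D_(v, 0) F (P x 0)) 0 j).
  by move=> x01; apply: is_deriveB; apply: d1.
have [|c /in01 c01] := @MVT_segment R G _ 0 1 ler01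
    (fun x x01 => dG x (in01' x x01)).
  by apply: derivable_within_continuous => x /in01 x01; case: (dG x x01).
have [|e /in01 e01 ->] := @MVT_segment R _ _ 0 1 ler01
    (fun y y01 => d2 c y c01 (in01' y y01)).
  apply: derivable_within_continuous => y /in01 y01; case: (d2 c y c01 y01) => + _; exact.
rewrite !subr0 !mulr1 !mxE => GE.
have -> : a = P 0 0 by rewrite /P !mul0r !scale0r !addr0; case: (a).
move: GE; rewrite /G /P /= !mul1r !mul0r !scale0r !addr0 => GE.
have -> (x y z u : R) : x - y - z + u = x - y - (z - u) by ring.
rewrite GE !normrM (mulrC C) -!mulrA ler_wpM2l // mulrC ler_wpM2r //.
by apply: le_trans (le_mx_norm _ _ _) _; case: (box c e c01 e01).
Qed.

(** Raising [k] by one moves along a single basis vector, so a displacement is split into steps to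
    which partial derivatives apply. *)
Definition trunc_row (u : V) (k : nat) : V := \row_l (if (l < k)%N then u 0 l else 0).

Lemma trunc_rowS (u : V) (k : 'I_m) :
  trunc_row u k.+1 = trunc_row u k + u 0 k *: delta_mx 0 k.
Proof.
apply/rowP => l; rewrite !mxE eqxx /= ltnS leq_eqVlt.
have [/val_inj->|/eqP lk] /= := eqVneq (l : nat) k.
  by rewrite eqxx ltnn mulr1 add0r.
by case: eqP => [lk'|_]; [rewrite lk' in lk|rewrite mulr0 addr0].
Qed.

Lemma trunc_row_norm (u : V) (k : 'I_m) (x : R) : 0 <= x <= 1 ->
  `|trunc_row u k + (x * u 0 k) *: delta_mx 0 k| <= `|u|.
Proof.
move=> /andP[x0 x1]; apply: mx_norm_le => // i l.
rewrite ord1 {i} !mxE eqxx /=; have := le_mx_norm u 0 l.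
have [->|lk] := eqVneq l k; first rewrite ltnn mulr1 add0r.
  by apply: le_trans; rewrite normrM ler_piMl // ger0_norm.
by rewrite mulr0 addr0; case: ifP => // _ _; rewrite normr0.
Qed.

Lemma telescope_sum2 (A : nat -> nat -> 'rV[R]_p) k n :
  \sum_(i < k) \sum_(j < n) (A i.+1 j.+1 - A i.+1 j - A i j.+1 + A i j) =
  A k n - A k 0%N - A 0%N n + A 0%N 0%N.
Proof.
elim: k => [|k IHk]; rewrite ?big_ord0 ?big_ord_recr /=.
  by apply/rowP => l; rewrite !mxE; ring.
have -> : \sum_(j < n) (A k.+1 j.+1 - A k.+1 j - A k j.+1 + A k j) =
    A k.+1 n - A k.+1 0%N - A k n + A k 0%N.
  elim: n {IHk} => [|n IH]; rewrite ?big_ord0 ?big_ord_recr /= ?IH;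
    by apply/rowP => l; rewrite !mxE; ring.
by rewrite IHk; apply/rowP => l; rewrite !mxE; ring.
Qed.

(** [Ck_on] controls each directional derivative separately. The bound is therefore assembled from
    coordinate rectangles: only the finitely many mixed partials [DD i j] must be bounded near [a],
    and the alternating sums telescope over the grid of truncated vectors. *)
Lemma mixed_difference_bound (a : V * V) : Ck_on 2 D F -> nbhs a D ->
  exists C r : R, [/\ 0 < C, 0 < r & forall u v : V, `|u| < r -> `|v| < r ->
    D (a.1 + u, a.2 + v) /\
    `|F (a.1 + u, a.2 + v) - F (a.1 + u, a.2) - F (a.1, a.2 + v) + F a|
      <= C * `|u| * `|v|].
Proof.
move=> F2 aD.
pose e (i : 'I_m) : V := delta_mx 0 i.
pose DD (i j : 'I_m) (q : V * V) := 'D_(0, e j) (fun z => 'D_(e i, 0) F z) q.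
pose C0 := \sum_i \sum_j (`|DD i j a| + 1).
have C0ge (i j : 'I_m) : `|DD i j a| + 1 <= C0.
  apply: (@le_trans _ _ (\sum_j (`|DD i j a| + 1))).
    by rewrite (bigD1 j) //= lerDl; apply: sumr_ge0 => l _; rewrite addr_ge0.
  rewrite /C0 [leRHS](bigD1 i) //= lerDl; apply: sumr_ge0 => k _.
  by apply: sumr_ge0 => l _; rewrite addr_ge0.
have nearD : \forall q \near a, D q /\ forall i j, `|DD i j q| <= C0.
  apply: filterI => //.
  suff H (i j : 'I_m) : \forall q \near a, `|DD i j q| <= C0.
    have Hij := filter_forall _ (fun i => filter_forall _ (H i)); exact: Hij.
  have cDD : {for a, continuous (DD i j)}.
    case: F2 => _ /(_ (e i, 0)) [_ [_ /(_ (0, e j))[_ [c _]]]].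
    by apply: c; exact: nbhs_singleton.
  apply: (cvgr_norm_le _ cDD); apply: lt_le_trans (C0ge i j).
  by rewrite ltrDl.
have /nbhs_ballP[r /= r0 rD] := nearD.
(* The added 1 keeps the constant positive when [m = 0]. *)
pose K := C0 *+ (m * m) + 1.
have C00 : 0 <= C0.
  by apply: sumr_ge0 => i _; apply: sumr_ge0 => j _; rewrite addr_ge0.
exists K, r; split => //; first by rewrite ltr_wpDl // mulrn_wge0.
move=> u v ur vr.
have inD (u' v' : V) : `|u'| < r -> `|v'| < r ->
    D (a.1 + u', a.2 + v') /\ forall i j, `|DD i j (a.1 + u', a.2 + v')| <= C0.
  move=> ur' vr'; apply: rD; split; rewrite -ball_normE /=.
    by rewrite opprD addrA subrr add0r normrN.
  by rewrite opprD addrA subrr add0r normrN.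
split; first by case: (inD u v ur vr).
pose A i j := F (a.1 + trunc_row u i, a.2 + trunc_row v j).
have tm (w : V) : trunc_row w m = w by apply/rowP => l; rewrite mxE ltn_ord.
have t0 (w : V) : trunc_row w 0 = 0 by apply/rowP => l; rewrite !mxE.
have -> : F (a.1 + u, a.2 + v) - F (a.1 + u, a.2) - F (a.1, a.2 + v) + F a =
    \sum_(i < m) \sum_(j < m) (A i.+1 j.+1 - A i.+1 j - A i j.+1 + A i j).
  rewrite telescope_sum2 /A !tm !t0 !addr0 (_ : F a = F (a.1, a.2)) //.
  by case: (a).
have sumC (n : nat) (f : 'I_n -> 'rV[R]_p) (b : R) :
    (forall i, `|f i| <= b) -> `|\sum_(i < n) f i| <= b *+ n.
  move=> fb; apply: le_trans (ler_norm_sum _ _ _) _.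
  by apply: le_trans (ler_sum _ (fun i _ => fb i)) _; rewrite sumr_const card_ord.
rewrite (@le_trans _ _ ((C0 * `|u| * `|v|) *+ m *+ m)) //; last first.
  by rewrite -mulrnA -!mulrnAl !ler_wpM2r // lerDl.
apply: (sumC) => i; apply: (sumC) => j.
have -> : A i.+1 j.+1 - A i.+1 j - A i j.+1 + A i j =
    let b := (a.1 + trunc_row u i, a.2 + trunc_row v j) in
    F (b.1 + u 0 i *: e i, b.2 + v 0 j *: e j) - F (b.1 + u 0 i *: e i, b.2)
    - F (b.1, b.2 + v 0 j *: e j) + F b.
  by rewrite /A /= !trunc_rowS !addrA.
apply: le_trans (mixed_rectangle (C := C0) F2 _) _; last first.
  rewrite -!mulrA ler_wpM2l // ler_pM //; exact: le_mx_norm.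
move=> x y x01 y01 /=.
rewrite -!addrA.
have [|| Dq Cq] := inD (trunc_row u i + (x * u 0 i) *: e i) (trunc_row v j + (y * v 0 j) *: e j).
- by apply: le_lt_trans ur; exact: trunc_row_norm.
- by apply: le_lt_trans vr; exact: trunc_row_norm.
by split; [exact: Dq|exact: Cq].
Qed.
End mixed_difference.

(** * The group law in coordinates at the identity *)

Section local_coordinates.
Context {R : realType} {m : nat} {G : topologicalGroupType}.
Variable S : @lieGroup R m G.
Local Notation V := 'rV[R]_m.
Local Notation c := (lie_chart S).

Definition lcoord (x : G) : V := cmap c x - cmap c 1%g.
Definition lpoint (v : V) : G := cinv c (v + cmap c 1%g).
Definition lball (r : R) : set G := [set x | cdom c x /\ `|lcoord x| < r].

Lemma lcoord1 : lcoord 1%g = 0. Proof. by rewrite /lcoord subrr. Qed.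

Lemma lball1 r : 0 < r -> lball r 1%g.
Proof. by move=> r0; split; [exact: lie_chart1|rewrite lcoord1 normr0]. Qed.

Lemma lcoordK r x : lball r x -> lpoint (lcoord x) = x.
Proof. by move=> [xc _]; rewrite /lpoint /lcoord subrK cmapK. Qed.

Lemma lpoint0 : lpoint 0 = 1%g.
Proof. by rewrite -lcoord1 (@lcoordK 1) //; exact: lball1. Qed.

Lemma lcoord_inj r x y : lball r x -> lball r y -> lcoord x = lcoord y -> x = y.
Proof. by move=> xr yr xy; rewrite -(lcoordK xr) xy (lcoordK yr). Qed.

Lemma lcoord_cvg x : cdom c x -> lcoord y @[y --> x] --> lcoord x.
Proof. by move=> xc; apply: cvgB; [exact: cmap_continuous|exact: cvg_cst]. Qed.

Lemma lball_open r : open (lball r).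
Proof.
rewrite openE => x [xc xr]; apply: filterI.
  by apply: open_nbhs_nbhs; split => //; exact: cdom_open.
exact: (cvgr_norm_lt _ (lcoord_cvg xc)).
Qed.

Lemma nbhs_lball r : 0 < r -> nbhs (1%g : G) (lball r).
Proof.
by move=> r0; apply: open_nbhs_nbhs; split; [exact: lball_open|exact: lball1].
Qed.

Lemma lpoint_cvg0 : lpoint v @[v --> (0 : V)] --> (1%g : G).
Proof.
rewrite -lpoint0; apply: (@cvg_comp _ _ _ (fun v => v + cmap c 1%g) (cinv c) _ (nbhs (cmap c 1%g))).
  have := @cvgD _ _ _ _ _ _ _ 0 _ (@cvg_id _ (nbhs (0 : V))) (@cvg_cst _ (cmap c 1%g) _ _ _).
  by rewrite add0r => H; exact: H.
rewrite /lpoint add0r.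
by apply: cinv_continuous; exists 1%g => //; exact: lie_chart1.
Qed.

Lemma lball_sub r r' : r <= r' -> lball r `<=` lball r'.
Proof. by move=> rr x [xc xr]; split => //; exact: lt_le_trans rr. Qed.

(** Taylor expansion of the group law at the identity: since products with 1 are exact, the error is
    bilinear in size. The bound [C * r0 <= 8^-1] makes it at most an eighth of the size of either
    factor. *)
Record local_mul (C r0 : R) : Prop := {
  lm_C : 0 < C;
  lm_r : 0 < r0;
  lm_Cr : C * r0 <= 8^-1;
  lm_point : forall v r, r <= r0 -> `|v| < r -> lball r (lpoint v);
  lm_pointK : forall v, `|v| < r0 -> lcoord (lpoint v) = v;
  lm_dom : forall x y, lball r0 x -> lball r0 y -> cdom c (x * y)%g;
  lm_mul : forall x y, lball r0 x -> lball r0 y ->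
    `|lcoord (x * y)%g - lcoord x - lcoord y| <= C * `|lcoord x| * `|lcoord y|
}.

(** The map [F] is the identity along both axes through [(e, e)], so its mixed difference there is
    exactly [lcoord (x * y) - lcoord x - lcoord y]. *)
Lemma local_mul_exists : exists C r0, local_mul C r0.
Proof.
pose e := cmap c 1%g.
pose D := [set p : V * V | [/\ cimg c p.1, cimg c p.2 &
                               cdom c (cinv c p.1 * cinv c p.2)%g]].
pose F := fun p : V * V => cmap c (cinv c p.1 * cinv c p.2)%g.
have F2 : Ck_on 2 D F.
  by have := lie_mul_smooth (lie_chart_atlas S) (lie_chart_atlas S) (lie_chart_atlas S); exact.
have ce : cimg c e by exists 1%g => //; exact: lie_chart1.
have cinve : cinv c e = 1%g by rewrite cmapK //; exact: lie_chart1.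
have cv1 : (cinv c p.1 * cinv c p.2)%g @[p --> ((e, e) : V * V)] --> (1%g : G).
  rewrite -[X in _ --> X](mulg1 1%g).
  apply: (@cvg_comp _ _ _ (fun p : V * V => (cinv c p.1, cinv c p.2)) (fun p : G * G => (p.1 * p.2)%g)); last first.
    exact: (@mulg_continuous G (1%g, 1%g)).
  apply: cvg_pair.
    apply: (@cvg_comp _ _ _ fst (cinv c) _ (nbhs e)); first exact: cvg_fst.
    by rewrite -cinve; exact: cinv_continuous.
  apply: (@cvg_comp _ _ _ snd (cinv c) _ (nbhs e)); first exact: cvg_snd.
  by rewrite -cinve; exact: cinv_continuous.
have De : nbhs ((e, e) : V * V) D.
  have e1 : nbhs e (cimg c) by apply: open_nbhs_nbhs; split=> //; exact: cimg_open.
  have [near1 near2] : (\forall p \near ((e, e) : V * V), cimg c p.1) /\ (\forall p \near ((e, e) : V * V), cimg c p.2).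
    by split; [exact: (cvg_fst e1)|exact: (cvg_snd e1)].
  have near3 : \forall p \near ((e, e) : V * V), cdom c (cinv c p.1 * cinv c p.2)%g.
    by apply: cv1; apply: open_nbhs_nbhs; split; [exact: cdom_open|exact: lie_chart1].
  by near=> p; split; near: p.
have [C [r [C0 r0 Fr]]] := mixed_difference_bound F2 De.
pose r1 := Num.min r (8^-1 / C).
have r10 : 0 < r1 by rewrite lt_min r0 divr_gt0.
have r1r : r1 <= r by rewrite ge_min lexx.
have imgK v : cimg c v -> cmap c (cinv c v) = v.
  by move=> [x xc <-]; rewrite cmapK.
have dom v : `|v| < r1 -> cdom c (lpoint v) /\ lcoord (lpoint v) = v.
  move=> vr; have n0 : `|0 : V| < r by rewrite normr0.
  have [[/= vc _ _] _] := Fr v 0 (lt_le_trans vr r1r) n0.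
  rewrite /lpoint /lcoord addrC; split; first by case: vc => x xc <-; rewrite cmapK.
  by rewrite imgK // addrAC subrr add0r.
exists C, r1; split => //.
- by rewrite mulrC -ler_pdivlMr // ge_min lexx orbT.
- move=> v r' r'r vr; have [vc vK] := dom v (lt_le_trans vr r'r).
  by split => //; rewrite vK.
- by move=> v vr; case: (dom v vr).
- move=> x y [xc xr] [yc yr].
  have [[/= _ _]] := Fr _ _ (lt_le_trans xr r1r) (lt_le_trans yr r1r).
  by rewrite /lcoord !(addrC (cmap c 1%g)) !subrK !cmapK.
- move=> x y [xc xr] [yc yr].
  have [_] := Fr _ _ (lt_le_trans xr r1r) (lt_le_trans yr r1r).
  rewrite /F /= /lcoord -/e !(addrC e) !subrK /e !cmapK ?mul1g ?mulg1 //;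
    try exact: lie_chart1.
  by congr (`| _ | <= _); apply/rowP => i; rewrite !mxE; ring.
Unshelve. all: by end_near. Qed.
End local_coordinates.

(** * Limits along an ultrafilter and stability of additive maps *)

Section ultralimits.

(** One fixed ultrafilter gives every sequence in a compact set a limit, and these limits are
    compatible with continuous operations; this replaces successive extractions of subsequences. *)
Lemma ultrafilter_nat : exists U : set_system nat, UltraFilter U /\ \oo `<=` U.
Proof. exact: (@ultraFilterLemma _ \oo). Qed.

Lemma ultra_compact_cvg (I : Type) (U : set_system I) (T : topologicalType)
    (a : I -> T) (A : set T) : UltraFilter U -> compact A ->
  (\forall n \near U, A (a n)) -> exists2 p, A p & a @ U --> p.
Proof.
move=> UU cA UA; have PU := @ultra_proper _ _ UU.
have [p [Ap clp]] := cA (a @ U) (fmap_proper_filter a PU) UA.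
exists p => // B pB.
have [//|nB] := in_ultra_setVsetC (a @^-1` B) UU.
by have [x []] := clp (~` B) B nB pB.
Qed.

Lemma ultra_bounded_cvg (R : realType) (p : nat) (I : Type) (U : set_system I)
    (a : I -> 'rV[R]_p) (K : R) : UltraFilter U ->
  (\forall n \near U, `|a n| <= K) -> exists2 l, `|l| <= K & a @ U --> l.
Proof.
move=> UU aK.
have cl : closed [set v : 'rV[R]_p | `|v| <= K].
  apply: (@closed_comp _ _ (fun v : 'rV[R]_p => `|v|) [set x | x <= K]).
    by move=> x _; exact: norm_continuous.
  exact: closed_le.
have [|l lK al] := ultra_compact_cvg UU (bounded_closed_compact _ cl) aK.
  exists K; split; first exact: num_real.
  by move=> M KM v /= vK; apply: le_trans vK (ltW KM).
by exists l.
Qed.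

End ultralimits.

Section hyers_ulam.
Variables (R : realType) (m p : nat).
Local Notation V := 'rV[R]_m.
Local Notation W := 'rV[R]_p.

(** Write [n * a = q + t] with [q] an integer and [0 <= t <= 1]. By additivity, [n] times the
    homogeneity defect of [d] at [(a, v)] is the defect at [(t, v)], which is at most [2 * K * |v|];
    a large [n] makes the first defect arbitrarily small. *)
Lemma additive_bounded_linear (d : V -> W) (K : R) :
  (forall u v, d (u + v) = d u + d v) -> (forall v, `|d v| <= K * `|v|) ->
  exists D : 'M[R]_(m, p), forall v, d v = v *m D.
Proof.
move=> dD dK.
have d0 : d 0 = 0 by apply: (addrI (d 0)); rewrite -dD !addr0.
have dN v : d (- v) = - d v by apply: (addrI (d v)); rewrite -dD !subrr.
have dn n v : d (n%:R *: v) = n%:R *: d v.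
  elim: n => [|n IH]; first by rewrite !scale0r.
  by rewrite -natr1 !scalerDl dD IH !scale1r.
have K0 (v : V) : 0 <= K * `|v| by exact: le_trans (normr_ge0 _) (dK v).
have dZpos a v : 0 <= a -> d (a *: v) = a *: d v.
  move=> a0; apply/eqP; rewrite -subr_eq0 -normr_eq0; apply/eqP.
  apply/eqP; rewrite eq_le normr_ge0 andbT; apply/ler_addgt0Pl => e e0.
  rewrite addr0.
  have [n nK] : exists n : nat, 2 * (K * `|v|) / e < n.+1%:R.
    by exists (Num.truncn (2 * (K * `|v|) / e)); exact: truncnS_gt.
  have n0 : (0 : R) < n.+1%:R by rewrite ltr0n.
  pose q := Num.truncn (n.+1%:R * a).
  pose t := n.+1%:R * a - q%:R.
  have [t0 t1] : 0 <= t /\ t <= 1.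
    have na0 : 0 <= n.+1%:R * a by rewrite mulr_ge0 // ltW.
    have /andP[qa aq] := truncn_itv na0.
    by rewrite /t subr_ge0; split => //; rewrite lerBlDr addrC natr1 ltW.
  have E : n.+1%:R *: (d (a *: v) - a *: d v) = d (t *: v) - t *: d v.
    rewrite scalerBr -dn !scalerA (_ : n.+1%:R * a = q%:R + t); last first.
      by rewrite /t addrC subrK.
    by rewrite !scalerDl dD dn opprD addrACA subrr add0r.
  rewrite -(ler_pM2l n0) -{1}(ger0_norm (ltW n0)) -normrZ E.
  apply: le_trans (ler_normB _ _) _.
  have tn : `|t| <= 1 by rewrite ger0_norm.
  apply: (@le_trans _ _ (2 * (K * `|v|))).
    rewrite mulr2n mulrDl mul1r lerD //.
      apply: le_trans (dK _) _; rewrite normrZ mulrCA.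
      by rewrite ler_piMl.
    by rewrite normrZ (le_trans _ (dK v)) // ler_piMl.
  by rewrite -ler_pdivrMr // ltW.
have dZ a v : d (a *: v) = a *: d v.
  have [a0|a0] := leP 0 a; first exact: dZpos.
  have := dZpos (- a) v; rewrite oppr_ge0 !scaleNr dN => /(_ (ltW a0)).
  exact: oppr_inj.
exists (\matrix_i d (delta_mx 0 i)) => v.
rewrite {1}(row_sum_delta v) (big_morph d dD d0) mulmx_sum_row.
by apply: eq_bigr => i _; rewrite dZ rowK.
Qed.

(** Hyers-Ulam argument. The ultralimit of [n * h (v / n)] is additive, because the additivity
    defect of [h] at scale [1 / n] is of order [1 / n^2]. It stays within [K2 * |v|^2] of [h v],
    because the defects met along [n] equal steps sum to at most that. *)
Lemma approx_additive_linear (h : V -> W) (K K2 rho : R) : 0 < rho -> 0 <= K2 ->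
  (forall v, `|v| < rho -> `|h v| <= K * `|v|) ->
  (forall u v, `|u| < rho -> `|v| < rho -> `|u + v| < rho ->
     `|h (u + v) - h u - h v| <= K2 * `|u| * `|v|) ->
  exists D : 'M[R]_(m, p), forall v, `|v| < rho ->
    `|h v - v *m D| <= K2 * `|v| ^+ 2.
Proof.
move=> rho0 K20 hK hD.
have nsmall (v : V) : \forall n \near \oo, `|n.+1%:R^-1 *: v| < rho.
  have vn : n.+1%:R^-1 *: v @[n --> \oo] --> (0 : V).
    by rewrite -[X in _ --> X](scale0r v); apply: cvgZ; [exact: cvg_harmonic|exact: cvg_cst].
  have := cvgr_norm_lt _ vn; rewrite normr0; exact.
have hpow n (w : V) : n.+1%:R * `|w| < rho ->
    `|h (n.+1%:R *: w) - n.+1%:R *: h w| <= K2 * (n.+1%:R * `|w|) ^+ 2.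
  elim: n => [|n IH] nw; first by rewrite !scale1r subrr normr0 mulr_ge0 // sqr_ge0.
  have nw' : n.+1%:R * `|w| < rho.
    by apply: le_lt_trans nw; rewrite ler_wpM2r // ler_nat.
  have w' : `|w| < rho.
    by apply: le_lt_trans nw; rewrite ler_peMl // ler1n.
  have E (x : W) : n.+2%:R *: x = n.+1%:R *: x + x.
    by rewrite -[in LHS]natr1 scalerDl scale1r.
  have E' : n.+2%:R *: w = n.+1%:R *: w + w.
    by rewrite -[in LHS]natr1 scalerDl scale1r.
  rewrite E E' (_ : _ - _ = (h (n.+1%:R *: w + w) - h (n.+1%:R *: w) - h w)
    + (h (n.+1%:R *: w) - n.+1%:R *: h w)); last first.
    by apply/rowP => k; rewrite !mxE; ring.
  apply: le_trans (ler_normD _ _) _.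
  apply: le_trans (lerD (hD _ _ _ _ _) (IH nw')) _ => //.
  - by rewrite normrZ normr_nat.
  - by rewrite -E' normrZ normr_nat.
  rewrite normrZ normr_nat -[n.+2%:R]natr1.
  have := normr_ge0 w; have : (0 : R) <= n.+1%:R by rewrite ler0n.
  move: (n.+1%:R) => x x0 y0; rewrite -subr_ge0.
  rewrite (_ : _ - _ = K2 * ((x + 1) * `|w| ^+ 2)); last by ring.
  by rewrite !mulr_ge0 // addr_ge0.
have [U [UU Uoo]] := ultrafilter_nat.
have PU := @ultra_proper _ _ UU.
pose a v n := n.+1%:R *: h (n.+1%:R^-1 *: v).
have aK v : \forall n \near U, `|a v n| <= K * `|v|.
  apply: Uoo; near=> n.
  rewrite normrZ normr_nat -ler_pdivlMl ?ltr0n // mulrCA.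
  apply: le_trans (hK _ _) _; first by near: n; exact: nsmall.
  by rewrite normrZ normfV normr_nat.
have lim v : exists l, `|l| <= K * `|v| /\ a v @ U --> l.
  by have [l lK al] := ultra_bounded_cvg UU (aK v); exists l.
pose d v := projT1 (cid (lim v)).
have dK v : `|d v| <= K * `|v| by rewrite /d; case: cid => l [].
have ad v : a v @ U --> d v by rewrite /d; case: cid => l [].
have dD u v : d (u + v) = d u + d v.
  apply/eqP; rewrite -subr_eq0 -normr_le0; apply/ler_addgt0Pl => e e0; rewrite addr0.
  have cv : `|a (u + v) n - (a u n + a v n)| @[n --> U] --> `|d (u + v) - (d u + d v)|.
    by apply: cvg_norm; apply: cvgB => //; apply: cvgD.
  apply: le_trans (_ : _ <= 0) _; last exact: ltW.
  have c0 : (K2 * `|u| * `|v|) * n.+1%:R^-1 @[n --> U] --> (0 : R).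
    rewrite -[X in _ --> X](mulr0 (K2 * `|u| * `|v|)).
    by apply: cvgM; [exact: cvg_cst|apply: cvg_trans (cvg_app _ Uoo) cvg_harmonic].
  apply: (ler_cvg_to cv c0); apply: Uoo; near=> n.
  rewrite /a scalerDr opprD addrA -!scalerBr normrZ normr_nat.
  have n0 : (0 : R) < n.+1%:R by rewrite ltr0n.
  rewrite -ler_pdivlMl //; apply: le_trans (hD _ _ _ _ _) _.
  - by near: n; exact: nsmall.
  - by near: n; exact: nsmall.
  - by rewrite -scalerDr; near: n; exact: nsmall.
  rewrite !normrZ normfV normr_nat le_eqVlt; apply/orP; left; apply/eqP.
  by field; rewrite lt0r_neq0.
have [D DE] := additive_bounded_linear dD dK.
exists D => v vrho; rewrite -DE.
have cv : `|h v - a v n| @[n --> U] --> `|h v - d v|.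
  by apply: cvg_norm; apply: cvgB => //; apply: cvg_cst.
have c1 : (fun _ => K2 * `|v| ^+ 2) @ U --> K2 * `|v| ^+ 2 by exact: cvg_cst.
apply: (ler_cvg_to cv c1); apply: nearW => n.
have n0 : (n.+1%:R : R) != 0 by rewrite pnatr_eq0.
have := hpow n (n.+1%:R^-1 *: v).
by rewrite scalerA normrZ mulrA normfV normr_nat mulfV // scale1r mul1r; apply.
Unshelve. all: by end_near. Qed.

End hyers_ulam.

(** * Almost homomorphisms are differentiable at the identity *)

Section topological_group.
Context {G : topologicalGroupType}.

Lemma mulg_cvg (T : Type) (F : set_system T) {FF : Filter F} (f g : T -> G) x y :
  f @ F --> x -> g @ F --> y -> (f t * g t)%g @[t --> F] --> (x * y)%g.
Proof.
move=> fx gy.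
apply: (@cvg_comp _ _ _ (fun t => (f t, g t)) (fun p : G * G => (p.1 * p.2)%g)).
  exact: cvg_pair fx gy.
exact: (@mulg_continuous G (x, y)).
Qed.

Lemma invg_cvg (T : Type) (F : set_system T) (f : T -> G) x :
  f @ F --> x -> ((f t)^-1)%g @[t --> F] --> (x^-1)%g.
Proof. by move=> fx; apply: (cvg_comp _ _ fx); exact: invg_continuous. Qed.

Lemma expg_cvg (T : Type) (F : set_system T) {FF : Filter F} (f : T -> G) x n :
  f @ F --> x -> (f t ^+ n)%g @[t --> F] --> (x ^+ n)%g.
Proof.
move=> fx; elim: n => [|n IH]; first by under eq_fun do rewrite expg0; exact: cvg_cst.
rewrite expgS; under eq_fun do rewrite expgS.
exact: mulg_cvg.
Qed.

Lemma nbhs1_mul (O : set G) : nbhs (1%g : G) O ->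
  exists2 O', nbhs (1%g : G) O' & forall x y, O' x -> O' y -> O (x * y)%g.
Proof.
move=> N1.
have : nbhs ((1%g, 1%g) : G * G) [set p | O (p.1 * p.2)%g].
  by apply: (@mulg_continuous G (1%g, 1%g)); rewrite mulg1.
move=> [[A B] /= [A1 B1] AB]; exists (A `&` B); first exact: filterI.
by move=> x y [Ax _] [_ By]; exact: (AB (x, y)).
Qed.

Lemma nbhs1_inv (O : set G) : nbhs (1%g : G) O ->
  nbhs (1%g : G) [set x | O (x^-1)%g].
Proof. by move=> N1; apply: (@invg_continuous G 1%g); rewrite invg1. Qed.

Lemma nbhs1_mul4 (O : set G) : nbhs (1%g : G) O ->
  exists O', [/\ nbhs (1%g : G) O', O' 1%g, forall x, O' x -> O' (x^-1)%g &
    forall a b c d, O' a -> O' b -> O' c -> O' d -> O (a * b * c * d)%g].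
Proof.
move=> /nbhs1_mul [N1 N1n N1m]; have [N2 N2n N2m] := nbhs1_mul N1n.
have O'n : nbhs (1%g : G) (N2 `&` [set x | N2 (x^-1)%g]).
  by apply: filterI; [exact: N2n|exact: (nbhs1_inv N2n)].
exists (N2 `&` [set x | N2 (x^-1)%g]); split => //.
- exact: nbhs_singleton O'n.
- by move=> x [xO xO']; split => //=; rewrite invgK.
move=> a b c d [aO _] [bO _] [cO _] [dO _] /=.
by rewrite -mulgA; apply: N1m; apply: N2m.
Qed.

End topological_group.

Section local_group.
Context {R : realType} {m : nat} {G : topologicalGroupType}.
Variable S : @lieGroup R m G.
Local Notation V := 'rV[R]_m.
Local Notation kappa := (lcoord S).
Local Notation B := (lball S).
Variables (C r0 : R).
Hypothesis lm : local_mul S C r0.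

Let C0 : 0 < C := lm_C lm.
Let r00 : 0 < r0 := lm_r lm.

Lemma lball_sub_nbhs (O : set G) : nbhs (1%g : G) O ->
  exists r, [/\ 0 < r, r <= r0 & B r `<=` O].
Proof.
move=> /(lpoint_cvg0 S)/nbhs_ballP[e /= e0 eO].
exists (Num.min e r0); split; [by rewrite lt_min e0|by rewrite ge_min lexx orbT|].
move=> x xe; rewrite -(lcoordK xe); apply: eO; rewrite -ball_normE /= sub0r normrN.
by case: xe => _; rewrite lt_min => /andP[].
Qed.

Lemma lcoord_small x : B r0 x -> C * `|kappa x| <= 8^-1.
Proof.
move=> [_ /ltW xr]; apply: le_trans (lm_Cr lm); by rewrite ler_pM2l.
Qed.

Lemma lcoord_mul_near x y : B r0 x -> B r0 y ->
  `|kappa (x * y)%g - kappa x - kappa y| <= 8^-1 * `|kappa y| /\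
  `|kappa (x * y)%g - kappa x - kappa y| <= 8^-1 * `|kappa x|.
Proof.
move=> xr yr; have := lm_mul lm xr yr.
have := lcoord_small xr; have := lcoord_small yr => sy sx M.
split; apply: le_trans M _; first by rewrite ler_wpM2r.
by rewrite -mulrA mulrCA mulrC ler_wpM2r.
Qed.

Lemma lcoord_mulr_le x y : B r0 x -> B r0 y ->
  `|kappa (x * y)%g - kappa x| <= 2 * `|kappa y| /\
  `|kappa y| <= 2 * `|kappa (x * y)%g - kappa x|.
Proof.
move=> xr yr; have [M _] := lcoord_mul_near xr yr.
have y0 := normr_ge0 (kappa y).
move: (kappa (x * y)%g - kappa x) M => a M.
have h1 : `|a| <= `|a - kappa y| + `|kappa y|.
  by rewrite -{1}(subrK (kappa y) a) ler_normD.
have h2 : `|kappa y| <= `|a| + `|a - kappa y|.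
  by rewrite -{1}(subKr a (kappa y)) ler_normB.
by split; lra.
Qed.

Lemma lcoord_mull_le x y : B r0 x -> B r0 y ->
  `|kappa (x * y)%g - kappa y| <= 2 * `|kappa x| /\
  `|kappa x| <= 2 * `|kappa (x * y)%g - kappa y|.
Proof.
move=> xr yr; have [_] := lcoord_mul_near xr yr.
rewrite addrAC => M; have y0 := normr_ge0 (kappa x).
move: (kappa (x * y)%g - kappa y) M => a M.
have h1 : `|a| <= `|a - kappa x| + `|kappa x|.
  by rewrite -{1}(subrK (kappa x) a) ler_normD.
have h2 : `|kappa x| <= `|a| + `|a - kappa x|.
  by rewrite -{1}(subKr a (kappa x)) ler_normB.
by split; lra.
Qed.

(** The defects of the successive products are of order at most [n * |kappa x|^2] and add up to a
    quadratic error in [n * |kappa x|]; the bound [r0 / 4] keeps all these powers in the chart. *)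
Lemma lcoord_pow x n : cdom (lie_chart S) x -> n%:R * `|kappa x| < r0 / 4 ->
  B r0 (x ^+ n)%g /\ `|kappa (x ^+ n)%g - n%:R *: kappa x| <= C * (n%:R * `|kappa x|) ^+ 2.
Proof.
move=> xc; elim: n => [|n IH] nr.
  rewrite expg0 scale0r lcoord1 subr0 normr0 mul0r expr0n /= mulr0.
  by split => //; exact: lball1.
have x0 := normr_ge0 (kappa x); have n0 : (0 : R) <= n%:R by rewrite ler0n.
have C1 := C0.
move: nr; rewrite -natr1 => nr.
have [|xnr Mn] := IH; first by nra.
have xr : B r0 x by split => //; nra.
have /= M := lm_mul lm xnr xr.
have CN : C * (n%:R * `|kappa x|) <= 32^-1.
  apply: le_trans (_ : C * (r0 / 4) <= _); first by rewrite ler_pM2l //; nra.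
  by have := lm_Cr lm; lra.
have t0 : 0 <= n%:R * `|kappa x| by rewrite mulr_ge0.
have Ct2 : C * (n%:R * `|kappa x|) ^+ 2 <= n%:R * `|kappa x| / 32.
  by have := ler_wpM2l t0 CN; lra.
have h : `|kappa (x ^+ n)%g| <= 2 * (n%:R * `|kappa x|).
  rewrite -{1}(subrK (n%:R *: kappa x) (kappa (x ^+ n)%g)).
  apply: le_trans (ler_normD _ _) _.
  by rewrite normrZ normr_nat; lra.
have h' : C * `|kappa (x ^+ n)%g| * `|kappa x| <= C * (2 * (n%:R * `|kappa x|)) * `|kappa x|.
  by rewrite ler_wpM2r // ler_pM2l.
have main : `|kappa (x ^+ n * x)%g - (n%:R + 1) *: kappa x| <=
    C * ((n%:R + 1) * `|kappa x|) ^+ 2.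
  rewrite (_ : _ - _ = (kappa (x ^+ n * x)%g - kappa (x ^+ n)%g - kappa x) +
    (kappa (x ^+ n)%g - n%:R *: kappa x)); last first.
    by apply/rowP => k; rewrite !mxE; ring.
  apply: le_trans (ler_normD _ _) _; apply: le_trans (lerD M Mn) _.
  apply: le_trans (lerD h' (lexx _)) _.
  rewrite -subr_ge0 (_ : _ - _ = C * `|kappa x| ^+ 2); last by ring.
  by rewrite mulr_ge0 ?sqr_ge0 // ltW.
rewrite expgSr; split => //; split; first exact: (lm_dom lm).
rewrite -(subrK ((n%:R + 1) *: kappa x) (kappa _)).
apply: le_lt_trans (ler_normD _ _) _.
apply: le_lt_trans (lerD main (lexx _)) _.
rewrite normrZ (_ : `|n%:R + 1| = n%:R + 1); last by rewrite ger0_norm // addr_ge0.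
have t10 : 0 <= (n%:R + 1) * `|kappa x| by rewrite mulr_ge0 // addr_ge0.
move: nr t10; set t := (_ + 1) * _ => nr t10.
have Ct : C * t <= 32^-1.
  apply: le_trans (_ : C * (r0 / 4) <= _); first by rewrite ler_pM2l // ltW.
  by have := lm_Cr lm; lra.
by have := ler_wpM2l t10 Ct; lra.
Qed.

Lemma lcoord_pow_le x n : cdom (lie_chart S) x -> n%:R * `|kappa x| < r0 / 4 ->
  `|kappa (x ^+ n)%g| <= 2 * (n%:R * `|kappa x|).
Proof.
move=> xc xn; have [_ Mn] := lcoord_pow xc xn.
rewrite -(subrK (n%:R *: kappa x) (kappa (x ^+ n)%g)).
apply: le_trans (ler_normD _ _) _.
rewrite normrZ normr_nat; apply: le_trans (lerD Mn (lexx _)) _.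
have t0 : 0 <= n%:R * `|kappa x| by rewrite mulr_ge0.
have CN : C * (n%:R * `|kappa x|) <= 32^-1.
  apply: le_trans (_ : C * (r0 / 4) <= _); first by rewrite ler_pM2l // ltW.
  by have := lm_Cr lm; lra.
by have := ler_wpM2l t0 CN; lra.
Qed.

(* Near 1, an approximately additive map is Lipschitz because its values at the
   powers of x stay bounded for about 1 / |x| steps. *)
Lemma almost_hom_lipschitz p (f : G -> 'rV[R]_p) (O : set G) (C' : R) :
  nbhs (1%g : G) O -> 0 < C' ->
  (forall x, O x -> C' * `|f x| <= 2^-1) ->
  (forall x y, O x -> O y -> `|f (x * y)%g - f x - f y| <= C' * `|f x| * `|f y|) ->
  exists K r, [/\ 0 < K, 0 < r, r <= r0 & forall x, B r x -> `|f x| <= K * `|kappa x|].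
Proof.
move=> /lball_sub_nbhs[r1 [r10 r1r rO]] C'0 fO fM.
exists (16 / (C' * r1)), (r1 / 8); split.
- by rewrite divr_gt0 // mulr_gt0.
- by rewrite divr_gt0.
- by lra.
have O1 : O 1%g by apply: rO; exact: lball1.
have f1 : f 1%g = 0.
  have := fM _ _ O1 O1; rewrite mulg1 addrAC subrr sub0r normrN => h.
  have := fO _ O1; have := normr_ge0 (f 1%g) => h0 h1.
  by apply/eqP; rewrite -normr_le0; nra.
move=> x xr.
have xr0 : B r0 x by apply: lball_sub xr; lra.
have [k0|k0] := eqVneq (kappa x) 0.
  have -> : x = 1%g by apply: lcoord_inj xr (lball1 _ _) _; rewrite ?lcoord1 //; lra.
  by rewrite f1 lcoord1 !normr0 mulr0.
have k1 : 0 < `|kappa x| by rewrite normr_gt0.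
pose q := r1 / 8 / `|kappa x|.
have q1 : 1 < q by rewrite /q ltr_pdivlMr // mul1r; case: xr.
pose n := Num.truncn q.
have /andP[nq qn] : n%:R <= q < n.+1%:R by apply: truncn_itv; lra.
have n1 : (1 : R) <= n%:R.
  by rewrite ler1n lt0n; apply/eqP => n0; rewrite n0 in qn; lra.
have nk : n%:R * `|kappa x| <= r1 / 8 by rewrite -ler_pdivlMr.
have xi i : (i <= n)%N -> O (x ^+ i)%g.
  move=> ile; have ik : i%:R * `|kappa x| <= r1 / 8.
    by apply: le_trans nk; rewrite ler_wpM2r // ler_nat.
  have ik' : i%:R * `|kappa x| < r0 / 4 by lra.
  have [[xic _] _] := lcoord_pow xr0.1 ik'.
  by apply: rO; split => //; have := lcoord_pow_le xr0.1 ik'; lra.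
have fi i : (i <= n)%N -> `|f (x ^+ i)%g - i%:R *: f x| <= i%:R * `|f x| / 2.
  elim: i => [|i IH] ile; first by rewrite expg0 f1 scale0r subrr normr0 !mul0r.
  rewrite expgSr -natr1.
  have M := fM _ _ (xi _ (ltnW ile)) (xi 1%N (leq_trans _ ile)).
  rewrite (_ : _ - _ = (f (x ^+ i * x)%g - f (x ^+ i)%g - f x) +
    (f (x ^+ i)%g - i%:R *: f x)); last by apply/rowP => k; rewrite !mxE; ring.
  apply: le_trans (ler_normD _ _) _.
  rewrite expg1 in M; apply: le_trans (lerD (M _) (IH (ltnW ile))) _ => //.
  have := ler_wpM2r (normr_ge0 (f x)) (fO _ (xi _ (ltnW ile))).
  by lra.
have fn := fi n (leqnn n); have fb := fO _ (xi n (leqnn n)).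
have h : n%:R * `|f x| <= `|f (x ^+ n)%g| + n%:R * `|f x| / 2.
  rewrite -{1}(ger0_norm (ler0n R n)) -normrZ -{1}(subKr (f (x ^+ n)%g) (n%:R *: f x)).
  by apply: le_trans (ler_normB _ _) _; rewrite lerD2l.
rewrite mulrAC ler_pdivlMr ?mulr_gt0 //.
have F0 := normr_ge0 (f x).
have n2 : q <= 2 * n%:R by move: qn; rewrite -natr1; lra.
have qk : q * `|kappa x| = r1 / 8 by rewrite /q divfK // gt_eqF.
have h2 : C' * (n%:R * `|f x|) <= 1.
  by have := ler_wpM2l (ltW C'0) h; lra.
have h3 : r1 / 8 <= 2 * n%:R * `|kappa x| by rewrite -qk ler_wpM2r // ltW.
have h4 := ler_wpM2l (mulr_ge0 (ltW C'0) F0) h3.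
have h5 := ler_wpM2r (ltW k1) h2.
by nra.
Qed.

(** From [z = x * (x^-1 * z)] and the near-additivity of products, a quotient is controlled by the
    difference of coordinates. This compares translation in the group with translation in the
    chart. *)
Lemma lcoord_div_near : exists r, [/\ 0 < r, r <= r0 &
  forall x z, B r x -> B r z -> [/\ B r0 (x^-1 * z)%g, B r0 (z * x^-1)%g,
    `|kappa (x^-1 * z)%g| <= 2 * `|kappa z - kappa x| &
    `|kappa (z * x^-1)%g| <= 2 * `|kappa z - kappa x|]].
Proof.
have [N [Nn N1 NV NM]] := nbhs1_mul4 (nbhs_lball S r00).
have [r [rpos rr0 rO]] := lball_sub_nbhs Nn.
exists r; split => // x z xr zr.
have xz : B r0 (x^-1 * z)%g.
  by have := NM _ _ _ _ (NV _ (rO _ xr)) (rO _ zr) N1 N1; rewrite !mulg1.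
have zx : B r0 (z * x^-1)%g.
  by have := NM _ _ _ _ (rO _ zr) (NV _ (rO _ xr)) N1 N1; rewrite !mulg1.
have xr0 := lball_sub rr0 xr.
split => //.
  by have [_] := lcoord_mulr_le xr0 xz; rewrite mulVKg.
by have [_] := lcoord_mull_le zx xr0; rewrite mulgVK.
Qed.

(** In the chart [f] becomes a map [h] of vectors. The point with coordinates [u + v] differs from
    the product of the points with coordinates [u] and [v] by a factor [y] of size [O(|u| |v|)], and
    [f] is Lipschitz near 1; so [h] is additive up to a bilinear error and the Hyers-Ulam argument
    applies. Conjugations and continuous matrix representations both obtain their differentials from
    this theorem. *)
Theorem almost_hom_differentiable p (f : G -> 'rV[R]_p) (O : set G) (C' : R) :
  nbhs (1%g : G) O -> 0 < C' ->
  (forall x, O x -> C' * `|f x| <= 2^-1) ->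
  (forall x y, O x -> O y -> `|f (x * y)%g - f x - f y| <= C' * `|f x| * `|f y|) ->
  exists (D : 'M[R]_(m, p)) K r, [/\ 0 < K, 0 < r, r <= r0 &
    forall x, B r x -> `|f x - kappa x *m D| <= K * `|kappa x| ^+ 2].
Proof.
move=> O1 C'0 fO fM.
have [K [r1 [K0 r10 r1r0 fK]]] := almost_hom_lipschitz O1 C'0 fO fM.
have [N2 [N2n N21 N2V N2M]] := nbhs1_mul4 (filterI O1 (nbhs_lball S r10)).
have [rd [rd0 rdr0 divr]] := lcoord_div_near.
have [r2 [r20 r2r0 r2N]] := lball_sub_nbhs (filterI N2n (nbhs_lball S rd0)).
have r2O x : B r2 x -> O x /\ B r1 x.
  by move=> /r2N [xN _]; have := N2M _ _ _ _ xN N21 N21 N21; rewrite !mulg1.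
pose h v := f (lpoint S v).
have hK v : `|v| < r2 -> `|h v| <= K * `|v|.
  move=> vr; have [_ kr] := r2O _ (lm_point lm r2r0 vr).
  by rewrite /h -{2}(lm_pointK lm (lt_le_trans vr r2r0)); exact: fK.
(* The first summand accounts for the correcting factor [y], the second for the additivity defect of
   [f] itself. *)
have K20 : 0 <= 4 * K * C + C' * K ^+ 2.
  by rewrite addr_ge0 // ?mulr_ge0 ?sqr_ge0 // ltW.
have [|v vr|u v ur vr uvr|D hD] := @approx_additive_linear R m p h K
    (4 * K * C + C' * K ^+ 2) (r2 / 4) _ K20.
- by rewrite divr_gt0.
- by apply: hK; lra.
- have {}ur : `|u| < r2 / 4 by []. have {}vr : `|v| < r2 / 4 by [].
  have ur2 : `|u| < r2 by lra. have vr2 : `|v| < r2 by lra.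
  have uvr2 : `|u + v| < r2 by lra.
  have ku := lm_point lm r2r0 ur2; have kv := lm_point lm r2r0 vr2.
  have kuv := lm_point lm r2r0 uvr2.
  have kuE := lm_pointK lm (lt_le_trans ur2 r2r0).
  have kvE := lm_pointK lm (lt_le_trans vr2 r2r0).
  have kuvE := lm_pointK lm (lt_le_trans uvr2 r2r0).
  have M := lm_mul lm (lball_sub r2r0 ku) (lball_sub r2r0 kv).
  have [M2 _] := lcoord_mulr_le (lball_sub r2r0 ku) (lball_sub r2r0 kv).
  rewrite kuE kvE in M M2.
  pose x := (lpoint S u * lpoint S v)%g.
  have xr : B r2 x.
    split; first exact: (lm_dom lm (lball_sub r2r0 ku) (lball_sub r2r0 kv)).
    rewrite -(subrK u (kappa x)); apply: le_lt_trans (ler_normD _ _) _.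
    by rewrite /x; lra.
  have [_ _ Mdiv _] := divr x (lpoint S (u + v)) (r2N _ xr).2 (r2N _ kuv).2.
  set y := (x^-1 * _)%g in Mdiv.
  have [yO yr] : O y /\ B r1 y.
    by have := N2M _ _ _ _ (N2V _ (r2N _ xr).1) (r2N _ kuv).1 N21 N21; rewrite !mulg1.
  have xy : lpoint S (u + v) = (x * y)%g by rewrite /y mulVKg.
  have Mxy := fM _ _ (r2O _ xr).1 yO.
  have Muv := fM _ _ (r2O _ ku).1 (r2O _ kv).1.
  have fx := fO _ (r2O _ xr).1.
  have fy := fK _ yr.
  rewrite -xy in Mxy; rewrite -/x -/(h u) -/(h v) in Muv.
  rewrite kuvE in Mdiv.
  have kx : `|u + v - kappa x| <= C * `|u| * `|v| by rewrite distrC opprD addrA.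
  have fyC : C' * `|f x| * `|f y| <= 2^-1 * `|f y| by rewrite ler_wpM2r.
  have huhv : C' * `|h u| * `|h v| <= C' * (K * `|u|) * (K * `|v|).
    by rewrite ler_pM ?mulr_ge0 ?ler_pM2l ?hK // ltW.
  have e1 : `|h (u + v) - f x| <= 2 * `|f y|.
    rewrite -(subrK (f y) (h (u + v) - f x)); apply: le_trans (ler_normD _ _) _.
    by have := normr_ge0 (f y); rewrite /h; lra.
  have e2 : `|f y| <= K * (2 * (C * `|u| * `|v|)).
    by apply: le_trans fy _; rewrite ler_pM2l //; lra.
  rewrite (_ : _ - _ = (h (u + v) - f x) + (f x - h u - h v)); last first.
    by apply/rowP => k; rewrite !mxE; ring.
  apply: le_trans (ler_normD _ _) _.
  apply: le_trans (lerD e1 (le_trans Muv huhv)) _.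
  by rewrite !mulrDl; apply: lerD; [lra|rewrite le_eqVlt; apply/orP; left; apply/eqP; ring].
exists D, (4 * K * C + C' * K ^+ 2), (r2 / 4); split.
- by rewrite addr_gt0 // ?mulr_gt0 ?exprn_gt0.
- by rewrite divr_gt0.
- by lra.
- move=> x xr; have [_ xr'] := xr.
  by have := hD _ xr'; rewrite /h (lcoordK xr).
Qed.

End local_group.

(** * First-order calculus with quadratic remainders *)

Section quadratic_estimates.
Variable R : realType.

Lemma le_of_quadratic (a b K r : R) : 0 < r ->
  (forall s, 0 < s < r -> s * a <= s * b + K * s ^+ 2) -> a <= b.
Proof.
move=> r0 h; apply/ler_addgt0Pl => e e0.
pose s := Num.min (r / 2) (e / (`|K| + 1)).
have K1 : 0 < `|K| + 1 by rewrite ltr_wpDl.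
have s0 : 0 < s by rewrite lt_min !divr_gt0.
have sr : s < r by rewrite gt_min; apply/orP; left; lra.
have /h : 0 < s < r by rewrite s0.
rewrite expr2 mulrCA -mulrDr ler_pM2l // => hs.
have : `|K| * s <= e.
  have : s <= e / (`|K| + 1) by rewrite ge_min lexx orbT.
  rewrite ler_pdivlMr // => se; have := normr_ge0 K; nra.
have := ler_norm K; nra.
Qed.

Lemma is_derive_quadratic (V W : normedModType R) (g : V -> W) (e X : V)
    (L : V -> W) (K r : R) : 0 < r ->
  (forall h, L (h *: X) = h *: L X) ->
  (forall v, `|v| < r -> `|g (v + e) - g e - L v| <= K * `|v| ^+ 2) ->
  is_derive e X g (L X).
Proof.
move=> r0 LZ gL; apply/is_deriveP.
have X1 : 0 < `|X| + 1 by rewrite ltr_wpDl.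
pose K' := `|K| * `|X| ^+ 2 + 1.
have K'0 : 0 < K' by rewrite ltr_wpDl // mulr_ge0 // sqr_ge0.
apply/cvgrPdist_le => eps eps0; near=> h.
have h0 : h != 0 by near: h; exact: nbhs_dnbhs_neq.
have [hr he] : `|h| * (`|X| + 1) < r /\ `|h| * K' <= eps.
  have hs : `|h| < Num.min (r / (`|X| + 1)) (eps / K').
    by near: h; apply: dnbhs0_lt; rewrite lt_min !divr_gt0.
  move: hs; rewrite lt_min !ltr_pdivlMr // => /andP[-> /ltW ->].
  by [].
have hX : `|h *: X| < r.
  rewrite normrZ; apply: le_lt_trans hr.
  by rewrite ler_wpM2l // lerDl.
have := gL _ hX; rewrite LZ distrC => G.
rewrite -[L X]scale1r -(mulVf h0) -scalerA -scalerBr normrZ normfV.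
rewrite ler_pdivrMl ?normr_gt0 // mulrC.
rewrite distrC; apply: le_trans (le_trans _ G) _ => //; first by rewrite distrC.
rewrite normrZ exprMn.
apply: le_trans (_ : `|K| * (`|h| ^+ 2 * `|X| ^+ 2) <= _).
  by rewrite ler_wpM2r ?mulr_ge0 ?sqr_ge0 // ler_norm.
have := normr_ge0 h => h00.
apply: le_trans (_ : `|h| * K' * `|h| <= _); last by rewrite ler_wpM2r.
rewrite /K' -subr_ge0 (_ : _ - _ = `|h| ^+ 2); last by ring.
exact: sqr_ge0.
Unshelve. all: by end_near. Qed.

Lemma mulmx_norm_le m n p (A : 'M[R]_(m, n)) (B : 'M[R]_(n, p)) :
  `|A *m B| <= n%:R * `|A| * `|B|.
Proof.
apply: mx_norm_le => [|i j]; first by rewrite !mulr_ge0.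
rewrite mxE; apply: le_trans (ler_norm_sum _ _ _) _.
apply: (@le_trans _ _ (\sum_(k < n) `|A| * `|B|)).
  apply: ler_sum => k _; rewrite normrM.
  by apply: ler_pM => //; exact: le_mx_norm.
by rewrite sumr_const card_ord -mulrA mulr_natl.
Qed.

Lemma norm_mxvec m n (A : 'M[R]_(m, n)) : `|mxvec A| = `|A|.
Proof.
apply/eqP; rewrite eq_le; apply/andP; split.
  apply: mx_norm_le => // i k; rewrite ord1.
  by case/mxvec_indexP: k => a b; rewrite mxvecE le_mx_norm.
by apply: mx_norm_le => // i j; rewrite -(mxvecE A) le_mx_norm.
Qed.

Definition linear_map (V W : lmodType R) (L : V -> W) :=
  forall a u v, L (a *: u + v) = a *: L u + L v.

Section linear_map.
Variables (V W : lmodType R) (L : V -> W).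
Hypothesis L_lin : linear_map L.

Lemma linear_mapD u v : L (u + v) = L u + L v.
Proof. by rewrite -{1}[u]scale1r L_lin scale1r. Qed.

Lemma linear_map0 : L 0 = 0.
Proof. by apply: (addrI (L 0)); rewrite -linear_mapD !addr0. Qed.

Lemma linear_mapZ a u : L (a *: u) = a *: L u.
Proof. by rewrite -{1}[a *: u]addr0 L_lin linear_map0 addr0. Qed.

Lemma linear_mapN u : L (- u) = - L u.
Proof. by rewrite -scaleN1r linear_mapZ scaleN1r. Qed.

Lemma linear_mapB u v : L (u - v) = L u - L v.
Proof. by rewrite linear_mapD linear_mapN. Qed.

Lemma linear_map_sum I (r : seq I) (F : I -> V) :
  L (\sum_(i <- r) F i) = \sum_(i <- r) L (F i).
Proof. exact: (big_morph L linear_mapD linear_map0). Qed.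

End linear_map.

Lemma linear_map_bounded m (W : normedModType R) (L : 'rV[R]_m -> W) :
  linear_map L -> exists2 M, 0 < M & forall v, `|L v| <= M * `|v|.
Proof.
move=> Llin; exists (\sum_i `|L (delta_mx 0 i)| + 1).
  by rewrite ltr_wpDl // sumr_ge0.
move=> v; rewrite {1}(row_sum_delta v) linear_map_sum //.
apply: le_trans (ler_norm_sum _ _ _) _.
apply: (@le_trans _ _ (\sum_i `|L (delta_mx 0 i)| * `|v|)).
  apply: ler_sum => i _; rewrite linear_mapZ // normrZ mulrC.
  by rewrite ler_wpM2l // le_mx_norm.
by rewrite -mulr_suml ler_wpM2r // lerDl.
Qed.

End quadratic_estimates.

Section linear_approximation.
Context {R : realType} {m : nat} {G : topologicalGroupType}.
Variable S : @lieGroup R m G.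
Local Notation V := 'rV[R]_m.
Local Notation kappa := (lcoord S).
Local Notation B := (lball S).

(** Differentiability at the identity with a quadratic remainder, measured in the base chart. This
    form is stable under products and composition, and it determines the directional derivatives
    that occur in [Ad], [lie_bracket] and [dU]. *)
Definition lin_approx (W : normedModType R) (f : G -> W) (L : V -> W) :=
  linear_map L /\ exists K r, 0 < r /\
    forall x, B r x -> `|f x - f 1%g - L (kappa x)| <= K * `|kappa x| ^+ 2.

Lemma lin_approx_nneg (W : normedModType R) (f : G -> W) (L : V -> W) :
  lin_approx f L -> exists K r, [/\ 0 <= K, 0 < r &
    forall x, B r x -> `|f x - f 1%g - L (kappa x)| <= K * `|kappa x| ^+ 2].
Proof.
move=> [_ [K [r [r0 h]]]]; exists `|K|, r; split => // x /h.
by move/le_trans; apply; rewrite ler_wpM2r ?sqr_ge0 // ler_norm.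
Qed.

Lemma lin_approx_lipschitz (W : normedModType R) (f : G -> W) (L : V -> W) :
  lin_approx f L -> exists K r, [/\ 0 < K, 0 < r &
    forall x, B r x -> `|f x - f 1%g| <= K * `|kappa x|].
Proof.
move=> fL; have [K [r [K0 r0 h]]] := lin_approx_nneg fL.
have [M M0 LM] := linear_map_bounded fL.1.
exists (K + M), (Num.min r 1); split; [exact: ltr_wpDl|by rewrite lt_min r0 ltr01|].
move=> x xr; have xr' : B r x by apply: lball_sub xr; rewrite ge_min lexx.
have x1 : `|kappa x| < 1 by case: xr => _; rewrite lt_min => /andP[].
rewrite -(subrK (L (kappa x)) (f x - f 1%g)).
apply: le_trans (ler_normD _ _) _; rewrite mulrDl lerD //.
apply: le_trans (h _ xr') _; rewrite expr2 mulrA ler_piMr ?mulr_ge0 //.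
exact: ltW.
Qed.

Lemma lin_approx_lcoord : lin_approx kappa id.
Proof.
split=> //; exists 0, 1; split => // x _.
by rewrite lcoord1 subr0 subrr normr0 mul0r.
Qed.

Lemma lin_approx_cst (W : normedModType R) (w : W) : lin_approx (fun=> w) (fun=> 0).
Proof.
split; first by move=> a u v; rewrite scaler0 addr0.
by exists 0, 1; split => // x _; rewrite subrr subr0 normr0 mul0r.
Qed.

Lemma lin_approxB (W : normedModType R) (f g : G -> W) (L M : V -> W) :
  lin_approx f L -> lin_approx g M ->
  lin_approx (fun x => f x - g x) (fun v => L v - M v).
Proof.
move=> fL gM; split.
  by move=> a u v; rewrite fL.1 gM.1 scalerBr opprD addrACA.
have [K [r [K0 r0 h]]] := lin_approx_nneg fL.
have [K' [r' [K'0 r'0 h']]] := lin_approx_nneg gM.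
exists (K + K'), (Num.min r r'); rewrite lt_min r0 r'0; split => // x xr.
have xr1 : B r x by apply: lball_sub xr; rewrite ge_min lexx.
have xr2 : B r' x by apply: lball_sub xr; rewrite ge_min lexx orbT.
have E (x1 y1 z1 w1 : W) : x1 - y1 - (z1 - w1) = x1 - z1 - (y1 - w1).
  by rewrite !opprD !opprK addrACA.
rewrite mulrDl (E (f x)) E; apply: le_trans (ler_normB _ _) _.
exact: lerD (h _ xr1) (h' _ xr2).
Qed.

Lemma lin_approx_linear (W W' : normedModType R) (T : W -> W') (M : R)
    (f : G -> W) (L : V -> W) : linear_map T -> (forall w, `|T w| <= M * `|w|) ->
  lin_approx f L -> lin_approx (fun x => T (f x)) (fun v => T (L v)).
Proof.
move=> Tlin TM fL; split; first by move=> a u v; rewrite fL.1 Tlin.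
have [K [r [K0 r0 h]]] := lin_approx_nneg fL.
exists (`|M| * K), r; split => // x xr.
rewrite -!linear_mapB //; apply: le_trans (TM _) _.
apply: (@le_trans _ _ (`|M| * `|f x - f 1%g - L (kappa x)|)).
  by rewrite ler_wpM2r // ler_norm.
by rewrite -mulrA ler_wpM2l // h.
Qed.

Lemma lin_approx_mulmx a b c (f : G -> 'M[R]_(a, b)) (g : G -> 'M[R]_(b, c)) L M :
  lin_approx f L -> lin_approx g M ->
  lin_approx (fun x => f x *m g x) (fun v => L v *m g 1%g + f 1%g *m M v).
Proof.
move=> fL gM; split.
  move=> s u v; rewrite fL.1 gM.1 mulmxDl mulmxDr -scalemxAl -scalemxAr scalerDr.
  by rewrite addrACA.
have [K [r [K0 r0 h]]] := lin_approx_nneg fL.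
have [K' [r' [K'0 r'0 h']]] := lin_approx_nneg gM.
have [P [s [P0 s0 hP]]] := lin_approx_lipschitz fL.
have [Q [s' [Q0 s'0 hQ]]] := lin_approx_lipschitz gM.
exists (b%:R * K * `|g 1%g| + b%:R * `|f 1%g| * K' + b%:R * P * Q).
exists (Num.min (Num.min r r') (Num.min s s')).
rewrite !lt_min r0 r'0 s0 s'0; split => // x xr.
have xr1 : B r x by apply: lball_sub xr; rewrite !ge_min lexx.
have xr2 : B r' x by apply: lball_sub xr; rewrite !ge_min lexx !orbT.
have xr3 : B s x by apply: lball_sub xr; rewrite !ge_min lexx !orbT.
have xr4 : B s' x by apply: lball_sub xr; rewrite !ge_min lexx !orbT.
rewrite (_ : _ - _ = (f x - f 1%g - L (kappa x)) *m g 1%g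
   + f 1%g *m (g x - g 1%g - M (kappa x)) + (f x - f 1%g) *m (g x - g 1%g)); last first.
  rewrite !(mulmxBl, mulmxBr); move: (f x *m g x) (f x *m g 1%g) (f 1%g *m g x)
    (f 1%g *m g 1%g) (L _ *m _) (_ *m M _) => A1 A2 A3 A4 A5 A6.
  by apply/matrixP => i j; rewrite !mxE; ring.
rewrite !mulrDl; apply: le_trans (ler_normD _ _) _; apply: lerD.
  apply: le_trans (ler_normD _ _) _; apply: lerD.
    apply: le_trans (mulmx_norm_le _ _) _.
    rewrite [leRHS](_ : _ = b%:R * (K * `|kappa x| ^+ 2) * `|g 1%g|); last by ring.
    by rewrite ler_wpM2r // ler_wpM2l // h.
  apply: le_trans (mulmx_norm_le _ _) _.
  by rewrite -!mulrA !ler_wpM2l // h'.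
apply: le_trans (mulmx_norm_le _ _) _.
rewrite -!mulrA ler_wpM2l //.
rewrite [leRHS](_ : _ = (P * `|kappa x|) * (Q * `|kappa x|)); last by ring.
by apply: ler_pM => //; [exact: hP|exact: hQ].
Qed.

Lemma lin_approx_comp (W : normedModType R) (f : G -> W) (L : V -> W) (phi : G -> G)
    (A : V -> V) : phi 1%g = 1%g -> phi x @[x --> (1%g : G)] --> (1%g : G) ->
  lin_approx (fun x => kappa (phi x)) A -> lin_approx f L ->
  lin_approx (fun x => f (phi x)) (fun v => L (A v)).
Proof.
move=> phi1 cphi pA fL; split; first by move=> a u v; rewrite pA.1 fL.1.
have [K [r [K0 r0 h]]] := lin_approx_nneg fL.
have [K' [r' [K'0 r'0 h']]] := lin_approx_nneg pA.
have [P [s [P0 s0 hP]]] := lin_approx_lipschitz pA.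
have [M M0 LM] := linear_map_bounded fL.1.
have /(lpoint_cvg0 S)/nbhs_ballP[e /= e0 eO] := cphi _ (nbhs_lball S r0).
exists (K * P ^+ 2 + M * K'), (Num.min e (Num.min r' s)).
rewrite !lt_min e0 r'0 s0; split => // x xr.
have xr2 : B r' x by apply: lball_sub xr; rewrite !ge_min lexx !orbT.
have xr3 : B s x by apply: lball_sub xr; rewrite !ge_min lexx !orbT.
have xe : B r (phi x).
  have := eO (kappa x); rewrite /= (lcoordK xr); apply.
  rewrite -ball_normE /= sub0r normrN; case: xr => _.
  by rewrite lt_min => /andP[].
have Px := hP _ xr3; rewrite phi1 lcoord1 subr0 in Px.
have Ax := h' _ xr2; rewrite phi1 lcoord1 subr0 in Ax.
rewrite phi1 -(subrK (L (kappa (phi x))) (f (phi x) - f 1%g)) -addrA -linear_mapB; last exact: fL.1.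
apply: le_trans (ler_normD _ _) _; rewrite mulrDl lerD //.
  apply: le_trans (h _ xe) _; rewrite -mulrA ler_wpM2l // -exprMn.
  by rewrite lerXn2r ?nnegrE // mulr_ge0 // ltW.
by apply: le_trans (LM _) _; rewrite -mulrA ler_pM2l.
Qed.

Lemma is_derive_lin_approx (W : normedModType R) (f : G -> W) (L : V -> W) X :
  lin_approx f L ->
  is_derive (cmap (lie_chart S) 1%g) X (fun v => f (cinv (lie_chart S) v)) (L X).
Proof.
move=> fL; have [C [r0 lm]] := local_mul_exists S.
have [K [r [K0 rpos h]]] := lin_approx_nneg fL.
have r00 := lm_r lm.
apply: (@is_derive_quadratic _ _ _ _ _ _ L K (Num.min r r0)).
- by rewrite lt_min rpos.
- by move=> a; apply: linear_mapZ; exact: fL.1.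
move=> v vr; rewrite cmapK; last exact: lie_chart1.
have vr0 : `|v| < r0 by move: vr; rewrite lt_min => /andP[].
have kr : B r (lpoint S v).
  apply: lball_sub (lm_point lm _ vr); first by rewrite ge_min lexx.
  by rewrite ge_min lexx orbT.
by have := h _ kr; rewrite (lm_pointK lm vr0).
Qed.

Lemma lin_approx_test_point (r : R) (X : V) : 0 < r ->
  exists2 rho, 0 < rho & forall s, 0 < s < rho ->
    B r (lpoint S (s *: X)) /\ kappa (lpoint S (s *: X)) = s *: X.
Proof.
move=> r0; have [C [r1 lm]] := local_mul_exists S; have r10 := lm_r lm.
exists (Num.min r r1 / (`|X| + 1)).
  by rewrite divr_gt0 ?lt_min ?r0 // ltr_wpDl.
move=> s /andP[s0]; rewrite ltr_pdivlMr ?ltr_wpDl // => sX.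
have sX' : `|s *: X| < Num.min r r1.
  rewrite normrZ (ger0_norm (ltW s0)); apply: le_lt_trans sX.
  by rewrite ler_pM2l // lerDl.
split; last by apply: (lm_pointK lm); apply: lt_le_trans sX' _; rewrite ge_min lexx orbT.
apply: lball_sub (lm_point lm _ sX'); first by rewrite ge_min lexx.
by rewrite ge_min lexx orbT.
Qed.

Lemma lin_approx_unique (W : normedModType R) (f : G -> W) (L L' : V -> W) :
  lin_approx f L -> lin_approx f L' -> L =1 L'.
Proof.
move=> fL fL' X.
by have [_ <-] := is_derive_lin_approx X fL; have [_ <-] := is_derive_lin_approx X fL'.
Qed.

End linear_approximation.

(** * The adjoint action and differentials of real representations *)

Section adjoint.
Context {R : realType} {m : nat} {G : topologicalGroupType}.
Variable S : @lieGroup R m G.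
Local Notation V := 'rV[R]_m.
Local Notation kappa := (lcoord S).
Local Notation B := (lball S).
Local Notation c := (lie_chart S).

Lemma lin_approx_ext (W : normedModType R) (f g : G -> W) (L M : V -> W) :
  (forall x, f x - f 1%g = g x - g 1%g) -> (forall v, L v = M v) ->
  lin_approx S f L -> lin_approx S g M.
Proof.
move=> fg /funext <- [Llin [K [r [r0 h]]]]; split => //.
by exists K, r; split => // x; rewrite -fg; exact: h.
Qed.

Lemma lin_approx_almost_hom p (f : G -> 'rV[R]_p) (O : set G) (C' : R) :
  nbhs (1%g : G) O -> 0 < C' ->
  (forall x, O x -> C' * `|f x| <= 2^-1) ->
  (forall x y, O x -> O y -> `|f (x * y)%g - f x - f y| <= C' * `|f x| * `|f y|) ->
  exists L, lin_approx S f L.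
Proof.
move=> nO C'0 fO fM; have [C [r0 lm]] := local_mul_exists S.
have [D [K [r [K0 rpos _ h]]]] := almost_hom_differentiable lm nO C'0 fO fM.
have f1 : f 1%g = 0.
  have := h _ (lball1 S rpos); rewrite lcoord1 mul0mx subr0 normr0 expr0n mulr0.
  by move=> h1; apply/eqP; rewrite -normr_le0.
exists (fun v => v *m D); split.
  by move=> a u v; rewrite mulmxDl scalemxAl.
by exists K, r; split => // x xr; rewrite f1 subr0; exact: h.
Qed.

Lemma conj_cvg1 (x : G) : (x * y * x^-1)%g @[y --> (1%g : G)] --> (1%g : G).
Proof.
have : (x * y * x^-1)%g @[y --> (1%g : G)] --> (x * 1 * x^-1)%g.
  by apply: mulg_cvg; [apply: mulg_cvg; [exact: cvg_cst|exact: cvg_id]|exact: cvg_cst].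
by rewrite mulg1 mulgV.
Qed.

(** Conjugation by [x] is multiplicative, so in coordinates it is an almost homomorphism near 1,
    even when [x] lies far outside the base chart. Hence the directional derivatives defining
    [Ad S x] form a linear map. *)
Lemma conj_lin_approx x : lin_approx S (fun y => kappa (x * y * x^-1)%g) (Ad S x).
Proof.
have [C [r0 lm]] := local_mul_exists S.
have [L fL] : exists L, lin_approx S (fun y => kappa (x * y * x^-1)%g) L.
  have Nx : nbhs (1%g : G) [set y | B r0 (x * y * x^-1)%g].
    by apply: conj_cvg1; apply: nbhs_lball; exact: lm_r lm.
  apply: (lin_approx_almost_hom Nx (lm_C lm)).
    by move=> y /(lcoord_small lm) /le_trans; apply; lra.
  move=> y z yx zx.
  have -> : (x * (y * z) * x^-1)%g = (x * y * x^-1 * (x * z * x^-1))%g.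
    by rewrite !mulgA mulgVK.
  exact: (lm_mul lm).
suff -> : Ad S x = L by [].
apply/funext => X.
have fL' : lin_approx S (fun y => cmap c (x * y * x^-1)%g) L.
  apply: lin_approx_ext fL => // y; rewrite /lcoord opprB addrA subrK.
  by rewrite mulg1.
by have [_] := is_derive_lin_approx X fL'.
Qed.

Lemma Ad_linear x : linear_map (Ad S x).
Proof. exact: (conj_lin_approx x).1. Qed.

Lemma AdM x y X : Ad S (x * y)%g X = Ad S x (Ad S y X).
Proof.
have h : lin_approx S (fun z => kappa (x * (y * z * y^-1) * x^-1)%g)
    (fun v => Ad S x (Ad S y v)).
  apply: (@lin_approx_comp _ _ _ _ _ (fun z => kappa (x * z * x^-1)%g) _
    (fun z => y * z * y^-1)%g (Ad S y)).
  - by rewrite mulg1 mulgV.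
  - exact: conj_cvg1.
  - exact: conj_lin_approx.
  - exact: conj_lin_approx.
apply: (lin_approx_unique (conj_lin_approx (x * y)%g) (L' := fun v => Ad S x (Ad S y v))).
apply: lin_approx_ext h => // z.
by rewrite invgM !mulgA.
Qed.

Lemma Ad1 X : Ad S 1%g X = X.
Proof.
apply: (lin_approx_unique (conj_lin_approx 1%g) (L' := id)).
apply: lin_approx_ext (lin_approx_lcoord S) => // z.
by rewrite !mul1g invg1 !mulg1.
Qed.

Lemma AdK x X : Ad S (x^-1)%g (Ad S x X) = X.
Proof. by rewrite -AdM mulVg Ad1. Qed.

(** With [z = x * y * x^-1], the products [z * x] and [x * y] coincide, so their two expansions
    differ only by cross terms and [kappa z - kappa y] is [O(|kappa x| |kappa y|)]. Placing [y] on
    the ray through [X] and shrinking it gives the estimate, which yields continuity of the adjoint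
    representation at 1. *)
Lemma Ad_near1 : exists C r, 0 < r /\
  forall x, B r x -> forall X, `|Ad S x X - X| <= C * `|kappa x| * `|X|.
Proof.
have [C [r0 lm]] := local_mul_exists S; have C0 := lm_C lm.
have [N [Nn N1 NV NM]] := nbhs1_mul4 (nbhs_lball S (lm_r lm)).
have [r [rpos rr0 rN]] := lball_sub_nbhs lm Nn.
exists (3 * C), r; split => // x xr X.
have [_ [K [r' [r'0 h]]]] := conj_lin_approx x.
have rr' : 0 < Num.min r r' by rewrite lt_min rpos.
have [rho rho0 test] := @lin_approx_test_point _ _ _ S _ X rr'.
apply: (@le_of_quadratic _ _ _ (K * `|X| ^+ 2) rho) => // s srho.
have [yr ys] := test s srho; have /andP[s0 _] := srho.
set y := lpoint S _ in yr ys.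
have yr1 : B r y by apply: lball_sub yr; rewrite ge_min lexx.
have yr2 : B r' y by apply: lball_sub yr; rewrite ge_min lexx orbT.
have zr : B r0 (x * y * x^-1)%g.
  by have := NM _ _ _ _ (rN _ xr) (rN _ yr1) (NV _ (rN _ xr)) N1; rewrite mulg1.
set z := (x * y * x^-1)%g in zr.
have xr0 := lball_sub rr0 xr; have yr0 := lball_sub rr0 yr1.
have M1 := lm_mul lm xr0 yr0.
have M2 := lm_mul lm zr xr0.
have zx : (z * x)%g = (x * y)%g by rewrite /z mulgVK.
rewrite zx in M2.
have zy : `|kappa z - kappa y| <= C * `|kappa x| * (`|kappa y| + `|kappa z|).
  rewrite (_ : kappa z - kappa y = (kappa (x * y)%g - kappa x - kappa y)
    - (kappa (x * y)%g - kappa z - kappa x)); last first.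
    by apply/rowP => i; rewrite !mxE; ring.
  by apply: le_trans (ler_normB _ _) _; lra.
have zle : `|kappa z| <= 2 * `|kappa y|.
  have := lcoord_small lm xr0 => sx.
  have : `|kappa z| <= `|kappa z - kappa y| + `|kappa y|.
    by rewrite -{1}(subrK (kappa y) (kappa z)) ler_normD.
  have := ler_wpM2r (addr_ge0 (normr_ge0 (kappa y)) (normr_ge0 (kappa z))) sx.
  have := normr_ge0 (kappa y); lra.
have hy := h _ yr2.
rewrite mulg1 mulgV lcoord1 subr0 -/z ys linear_mapZ in hy; last exact: Ad_linear.
have main : `|s *: (Ad S x X - X)| <= 3 * C * `|kappa x| * `|kappa y| + K * `|kappa y| ^+ 2.
  rewrite scalerBr -ys (_ : _ - _ = (kappa z - kappa y) - (kappa z - s *: Ad S x X)); last first.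
    by apply/rowP => i; rewrite !mxE; ring.
  apply: le_trans (ler_normB _ _) _; apply: lerD; last by rewrite ys; exact: hy.
  apply: le_trans zy _.
  have := ler_wpM2l (mulr_ge0 (ltW C0) (normr_ge0 (kappa x))) zle; lra.
rewrite normrZ ys normrZ (gtr0_norm s0) in main.
apply: le_trans main _; rewrite le_eqVlt; apply/orP; left; apply/eqP; ring.
Qed.

Definition Admx x : 'M[R]_m := (\matrix_i Ad S x (delta_mx 0 i))^T.

Lemma AdmxE x X : Ad S x X = (Admx x *m X^T)^T.
Proof.
rewrite trmx_mul !trmxK {1}(row_sum_delta X) linear_map_sum; last exact: Ad_linear.
rewrite mulmx_sum_row; apply: eq_bigr => i _.
by rewrite linear_mapZ ?rowK //; exact: Ad_linear.
Qed.

Lemma mx_ext_rV n p (A A' : 'M[R]_(n, p)) :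
  (forall X : 'rV[R]_p, (A *m X^T)^T = (A' *m X^T)^T) -> A = A'.
Proof.
move=> h; apply: trmx_inj; apply/row_matrixP => i; rewrite !rowE.
have := h (delta_mx 0 i); rewrite !trmx_mul !trmxK.
exact.
Qed.

Lemma AdmxM x y : Admx (x * y)%g = Admx x *m Admx y.
Proof.
apply: mx_ext_rV => X; rewrite -AdmxE AdM !AdmxE trmxK mulmxA //.
Qed.

Lemma Admx1 : Admx 1%g = 1%:M.
Proof. by apply: mx_ext_rV => X; rewrite -AdmxE Ad1 mul1mx trmxK. Qed.

Lemma lcoord_cvg0 : kappa x @[x --> (1%g : G)] --> (0 : V).
Proof. by rewrite -(lcoord1 S); apply: lcoord_cvg; exact: lie_chart1. Qed.

Lemma Admx_cvg1 : Admx x @[x --> (1%g : G)] --> (1%:M : 'M[R]_m).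
Proof.
have [C [r [r0 h]]] := Ad_near1.
apply/cvgrPdist_le => e e0; near=> x.
have xr : B r x by near: x; exact: nbhs_lball.
have xe : `|C| * `|kappa x| <= e.
  have : `|kappa x| < e / (`|C| + 1).
    near: x; have := cvgr_norm_lt _ lcoord_cvg0; rewrite normr0; apply.
    by rewrite divr_gt0 // ltr_wpDl.
  rewrite ltr_pdivlMr ?ltr_wpDl // => k.
  have := normr_ge0 (kappa x); lra.
rewrite distrC; apply: mx_norm_le; first exact: ltW.
move=> i j; apply: le_trans xe.
have n1 : `|delta_mx 0 j : V| <= 1.
  by apply: mx_norm_le => // a b; rewrite mxE; case: (_ && _); rewrite ?normr0 ?normr1.
have := h _ xr (delta_mx 0 j) => hx.
have E : (Admx x - 1%:M) i j = (Ad S x (delta_mx 0 j) - delta_mx 0 j) 0 i.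
  by rewrite /Admx !mxE eqxx.
rewrite E; apply: le_trans (le_mx_norm _ _ _) _; apply: le_trans hx _.
apply: (@le_trans _ _ (`|C| * `|kappa x| * `|delta_mx 0 j : V|)).
  by rewrite ler_wpM2r // ler_wpM2r // ler_norm.
by rewrite ler_piMr // mulr_ge0.
Unshelve. all: by end_near. Qed.

Definition real_rep p (Phi : G -> 'M[R]_p) :=
  [/\ forall x y, Phi (x * y)%g = Phi x *m Phi y, Phi 1%g = 1%:M &
      Phi x @[x --> (1%g : G)] --> (1%:M : 'M[R]_p)].

Lemma Admx_rep : real_rep Admx.
Proof. split; [exact: AdmxM|exact: Admx1|exact: Admx_cvg1]. Qed.

Section real_rep.
Variables (p : nat) (Phi : G -> 'M[R]_p).
Hypothesis Phi_rep : real_rep Phi.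

Definition drep (X : V) : 'M[R]_p := 'D_X (fun v => Phi (cinv c v)) (cmap c 1%g).

(** Since [Phi (x * y) - Phi x - Phi y + 1 = (Phi x - 1) * (Phi y - 1)], the map [Phi - 1] is an
    almost homomorphism; so continuity at 1 already yields a differential. *)
Lemma drep_lin_approx : lin_approx S Phi drep.
Proof.
have [PhiM Phi1 Phic] := Phi_rep.
pose f x := mxvec (Phi x - 1%:M).
have p1 : 0 < p%:R + 1 :> R by rewrite ltr_wpDl.
have Nx : nbhs (1%g : G) [set x | (p%:R + 1) * `|f x| <= 2^-1].
  move/cvgrPdist_le: (Phic) => /(_ (2^-1 / (p%:R + 1))); rewrite divr_gt0 // => /(_ isT).
  by apply: filterS => x /=; rewrite ler_pdivlMr // mulrC norm_mxvec distrC.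
have [|x y xs ys|L fL] := lin_approx_almost_hom (f := f) Nx p1; first by [].
  rewrite /f -!linearB !norm_mxvec PhiM.
  rewrite (_ : _ - _ = (Phi x - 1%:M) *m (Phi y - 1%:M)); last first.
    rewrite mulmxBl !mulmxBr !mul1mx !mulmx1; move: (_ *m _) => A.
    by apply/matrixP => i j; rewrite !mxE; ring.
  apply: le_trans (mulmx_norm_le _ _) _.
  by rewrite ler_wpM2r // ler_wpM2r // lerDl.
have PL : lin_approx S Phi (fun v => vec_mx (L v)).
  have Tlin : linear_map (vec_mx : 'rV[R]_(p * p) -> 'M[R]_p).
    by move=> a u v; rewrite linearP.
  have := lin_approx_linear (M := 1) Tlin _ fL.
  have Tn : forall w : 'rV[R]_(p * p), `|(vec_mx w : 'M[R]_p)| <= 1 * `|w|.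
    by move=> w; rewrite mul1r -norm_mxvec vec_mxK.
  move=> /(_ Tn); apply: lin_approx_ext => // x.
  rewrite /f !mxvecK; move: (Phi x) (Phi 1%g) => A A'.
  by apply/matrixP => i j; rewrite !mxE; ring.
suff -> : drep = fun v => vec_mx (L v) by [].
by apply/funext => X; have [_] := is_derive_lin_approx X PL.
Qed.

#[global] Opaque drep.

Lemma drep_linear : linear_map drep. Proof. exact: drep_lin_approx.1. Qed.

Lemma drep_Ad x X : drep (Ad S x X) = Phi x *m drep X *m Phi (x^-1)%g.
Proof.
have [PhiM Phi1 Phic] := Phi_rep.
have h : lin_approx S (fun y => Phi (x * y * x^-1)%g) (fun v => drep (Ad S x v)).
  apply: (@lin_approx_comp _ _ _ _ _ Phi _ (fun z => x * z * x^-1)%g (Ad S x)).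
  - by rewrite mulg1 mulgV.
  - exact: conj_cvg1.
  - exact: conj_lin_approx.
  - exact: drep_lin_approx.
apply: (lin_approx_unique h (L' := fun v => Phi x *m drep v *m Phi (x^-1)%g)).
have Tlin : linear_map (fun A : 'M[R]_p => Phi x *m A *m Phi (x^-1)%g).
  by move=> a u v; rewrite mulmxDr mulmxDl -scalemxAr -scalemxAl.
have Tn (A : 'M[R]_p) : `|Phi x *m A *m Phi (x^-1)%g| <=
    p%:R * (p%:R * `|Phi x|) * `|Phi (x^-1)%g| * `|A|.
  apply: le_trans (mulmx_norm_le _ _) _.
  rewrite [leRHS](_ : _ = p%:R * (p%:R * `|Phi x| * `|A|) * `|Phi (x^-1)%g|); last by ring.
  by rewrite ler_wpM2r // ler_wpM2l // mulmx_norm_le.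
apply: lin_approx_ext (lin_approx_linear Tlin Tn drep_lin_approx) => // y.
by rewrite !PhiM.
Qed.

End real_rep.

Lemma lin_approx_Ad_drep Y :
  lin_approx S (fun x => Ad S x Y) (fun X => (drep Admx X *m Y^T)^T).
Proof.
have Tlin : linear_map (fun A : 'M[R]_m => (A *m Y^T)^T).
  by move=> a u v; rewrite mulmxDl linearD /= -scalemxAl linearZ.
have Tn (A : 'M[R]_m) : `|(A *m Y^T)^T| <= m%:R * `|Y^T| * `|A|.
  apply: (@le_trans _ _ `|A *m Y^T|).
    by apply: mx_norm_le => // i j; rewrite mxE le_mx_norm.
  by apply: le_trans (mulmx_norm_le _ _) _; rewrite mulrAC.
have := lin_approx_linear Tlin Tn (drep_lin_approx Admx_rep).
by under eq_fun do rewrite -AdmxE.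
Qed.

Lemma lie_bracketE X Y : lie_bracket S X Y = (drep Admx X *m Y^T)^T.
Proof. by have [_] := is_derive_lin_approx X (lin_approx_Ad_drep Y). Qed.

Lemma lin_approx_Ad Y : lin_approx S (fun x => Ad S x Y) (fun X => lie_bracket S X Y).
Proof.
have -> : (fun X => lie_bracket S X Y) = fun X => (drep Admx X *m Y^T)^T.
  by apply/funext => X; exact: lie_bracketE.
exact: lin_approx_Ad_drep.
Qed.

#[global] Opaque Ad lie_bracket drep.

(** Differentiate [Phi x *m drep Phi Y = drep Phi (Ad S x Y) *m Phi x] at [x = 1] in the direction
    [X]. *)
Lemma drep_bracket p (Phi : G -> 'M[R]_p) X Y : real_rep Phi ->
  drep Phi (lie_bracket S X Y) = drep Phi X *m drep Phi Y - drep Phi Y *m drep Phi X.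
Proof.
move=> PhiR; have [PhiM Phi1 Phic] := PhiR.
have h1 := lin_approx_mulmx (drep_lin_approx PhiR) (lin_approx_cst S (drep Phi Y)).
have [M M0 LM] := linear_map_bounded (drep_linear PhiR).
have h2 := lin_approx_mulmx
  (lin_approx_linear (drep_linear PhiR) LM (lin_approx_Ad Y)) (drep_lin_approx PhiR).
have E : (fun x => Phi x *m drep Phi Y) = fun x => drep Phi (Ad S x Y) *m Phi x.
  apply/funext => x; rewrite drep_Ad // -[RHS]mulmxA -PhiM mulVg Phi1 mulmx1 //.
rewrite E in h1.
have E1 : drep Phi X *m drep Phi Y + Phi 1%g *m 0 =
    drep Phi (lie_bracket S X Y) *m Phi 1%g + drep Phi (Ad S 1%g Y) *m drep Phi X.
  exact: (lin_approx_unique h1 h2 X).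
rewrite (Ad1 Y) mulmx0 addr0 Phi1 in E1.
move: E1; move: (drep Phi X) (drep Phi Y) (drep Phi _) => A A' A''.
by rewrite mulmx1 => ->; rewrite addrK.
Qed.

End adjoint.

(** * From words in the Lie algebra to the connected group *)

Lemma connected_open_submonoid (G : topologicalGroupType) (P : set G) :
  connected [set: G] -> P 1%g -> (forall x y, P x -> P y -> P (x * y)%g) ->
  nbhs (1%g : G) P -> forall x, P x.
Proof.
move=> Gc P1 PM nP.
suff -> : P = [set: G] by [].
have Po : open P.
  rewrite openE => x Px.
  have : (x^-1 * y)%g @[y --> x] --> (1%g : G).
    by rewrite -[X in _ --> X](mulVg x); apply: mulg_cvg; [exact: cvg_cst|exact: cvg_id].
  move=> /(_ _ nP) h; have {}h : \forall y \near x, P (x^-1 * y)%g by [].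
  by apply: filterS h => y /= Py; rewrite -(mulVKg x y); exact: PM.
(* For [y] near [x] the element [y^-1 * x] lies in [P], so [y] in [P] would force [x] in [P]; hence
   the complement of [P] is open. *)
have Pc : closed P.
  rewrite -[P]setCK; apply: open_closedC.
  rewrite openE => x nPx.
  have : (y^-1 * x)%g @[y --> x] --> (1%g : G).
    rewrite -[X in _ --> X](mulVg x); apply: mulg_cvg; last exact: cvg_cst.
    by apply: invg_cvg; exact: cvg_id.
  move=> /(_ _ nP) h; have {}h : \forall y \near x, P (y^-1 * x)%g by [].
  apply: filterS h => y /= Py Py'; apply: nPx.
  by rewrite -(mulVKg y x); exact: PM.
by apply: Gc; [exists 1%g|exists P; rewrite ?setTI|exists P; rewrite ?setTI].
Qed.

(** This is the accumulated error of the Euler polygon method with [N] steps: unrolling the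
    recursion leaves [N] contributions, each amplified by at most [(1 + c / N) ^ N <= exp c]. *)
Lemma discrete_gronwall (R : realType) (e : nat -> R) (c : R) (N : nat) :
  (0 < N)%N -> 0 <= c -> e 0%N = 0 ->
  (forall j, (j < N)%N -> e j.+1 <= e j * (1 + c / N%:R) + c / N%:R ^+ 2) ->
  e N <= c * expR c / N%:R.
Proof.
move=> N0 c0 e0 eS; have N0' : (0 : R) < N%:R by rewrite ltr0n.
have cN : 0 <= c / N%:R by rewrite divr_ge0 // ltW.
have cN2 : 0 <= c / N%:R ^+ 2 by rewrite divr_ge0 // sqr_ge0.
have le j : (j <= N)%N -> e j <= j%:R * (c / N%:R ^+ 2) * (1 + c / N%:R) ^+ j.
  elim: j => [|j IH] jN; first by rewrite e0 !mul0r.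
  apply: le_trans (eS j jN) _.
  apply: le_trans (lerD (ler_wpM2r _ (IH (ltnW jN))) (lexx _)) _.
    by rewrite addr_ge0.
  have h1 : 1 <= (1 + c / N%:R) ^+ j.+1 by rewrite exprn_ege1 // lerDl.
  have := ler_wpM2l cN2 h1; rewrite -natr1 ![(1 + _) ^+ j.+1]exprSr.
  by move: ((1 + c / N%:R) ^+ j) (c / N%:R ^+ 2) => q1 q2; lra.
apply: le_trans (le N (leqnn N)) _.
have -> : N%:R * (c / N%:R ^+ 2) * (1 + c / N%:R) ^+ N = c / N%:R * (1 + c / N%:R) ^+ N.
  by field; rewrite gt_eqF.
have : (1 + c / N%:R) ^+ N <= expR c.
  rewrite [X in expR X](_ : c = N%:R * (c / N%:R)); last by rewrite mulrC divfK // gt_eqF.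
  rewrite expRM_natl lerXn2r ?nnegrE ?expR_ge0 ?addr_ge0 //.
  exact: expR_ge1Dx.
by move=> h; rewrite [leRHS]mulrAC ler_wpM2l.
Qed.

Lemma le0_of_harmonic (R : realType) (a E : R) :
  (forall N, (0 < N)%N -> a <= E / N%:R) -> a <= 0.
Proof.
move=> h; rewrite leNgt; apply/negP => a0.
pose N := (Num.truncn (E / a)).+1.
have N0 : (0 : R) < N%:R by rewrite ltr0n.
have := h N isT; rewrite ler_pdivlMr // leNgt => /negP; apply.
by rewrite mulrC -ltr_pdivrMr // truncnS_gt.
Qed.

Section words.
Context {R : realType} {m : nat} {G : topologicalGroupType}.
Variable S : @lieGroup R m G.
Local Notation V := 'rV[R]_m.
Local Notation kappa := (lcoord S).
Local Notation B := (lball S).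

Definition word_mx (K : pzSemiRingType) (I : Type) p (rho : I -> 'M[K]_p) (s : seq I) : 'M[K]_p :=
  foldr (fun X M => rho X *m M) 1%:M s.

Lemma word_mx_cat (K : pzSemiRingType) (I : Type) p (rho : I -> 'M[K]_p) s t :
  word_mx rho (s ++ t) = word_mx rho s *m word_mx rho t.
Proof. by elim: s => [|X s IH] /=; rewrite ?mul1mx // IH mulmxA. Qed.

Variables (p : nat) (Phi : G -> 'M[R]_p).
Hypothesis Phi_rep : real_rep Phi.

(** Let [Z] consist of the matrices annihilated by [A] after every word. The [x] for which [Phi x]
    preserves [Z] form a submonoid, so by connectedness only [y] near 1 matters. There [Phi y] is
    approximated by Euler products of factors [1 + drep S Phi X]; these preserve [Z], and the error
    is [O(1 / N)]. *)
Lemma rep_words_vanish a b (A : 'M[R]_(a, p)) (B0 : 'M[R]_(p, b)) :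
  connected [set: G] ->
  (forall s, A *m word_mx (drep S Phi) s *m B0 = 0) ->
  forall x, A *m Phi x *m B0 = 0.
Proof.
move=> Gc AB x; have [PhiM Phi1 Phic] := Phi_rep.
pose Z (Y : 'M[R]_(p, b)) := forall s, A *m word_mx (drep S Phi) s *m Y = 0.
pose P := [set x | forall Y, Z Y -> Z (Phi x *m Y)].
suff Px : forall x, P x.
  by have := Px x _ AB [::]; rewrite /= mulmx1 mulmxA.
apply: connected_open_submonoid => //.
- by move=> Y ZY; rewrite Phi1 mul1mx.
- by move=> y z Py Pz Y ZY; rewrite PhiM -mulmxA; apply: Py; exact: Pz.
have ZS X Y : Z Y -> Z ((1%:M + drep S Phi X) *m Y).
  move=> ZY s; rewrite mulmxDl mul1mx mulmxDr ZY add0r.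
  have := ZY (s ++ [:: X]); rewrite word_mx_cat /= mulmx1 !mulmxA; exact.
have [C [r0 lm]] := local_mul_exists S.
have [K [r [K0 rpos hK]]] := lin_approx_nneg (drep_lin_approx S Phi_rep).
have [K' [r' [K'0 r'pos hK']]] := lin_approx_lipschitz (drep_lin_approx S Phi_rep).
have [M M0 LM] := linear_map_bounded (drep_linear S Phi_rep).
have [rd [rd0 rdr0 divr]] := lcoord_div_near lm.
pose q := Num.min (Num.min r r') rd / 4.
have q0 : 0 < q by rewrite divr_gt0 // !lt_min rpos r'pos.
have [qr qr' qrd] : [/\ 4 * q <= r, 4 * q <= r' & 4 * q <= rd].
  by rewrite /q mulrC divfK // !ge_min !lexx !orbT.
apply: filterS (nbhs_lball S q0) => y yq Y ZY s.
pose v := kappa y.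
have vq : `|v| < q by case: yq.
pose W := A *m word_mx (drep S Phi) s.
have M0' := ltW M0; have q0' := ltW q0; have K'0' := ltW K'0.
pose c := p%:R * (M * (2 * q)) + p%:R * (1 + K' * q) * (K * (2 * q) ^+ 2).
have c0 : 0 <= c.
  apply: addr_ge0; repeat (done || apply: mulr_ge0 || apply: sqr_ge0 || apply: addr_ge0).
suff key N : (0 < N)%N -> `|W *m (Phi y *m Y)| <=
    (p%:R * (p%:R * `|W|) * `|Y| * (c * expR c)) / N%:R.
  by apply: normr0_eq0; apply/eqP; rewrite eq_le normr_ge0 andbT; exact: (le0_of_harmonic key).
move=> N0; have N0' : (0 : R) < N%:R by rewrite ltr0n.
(* The segment from 1 to [y] in the chart is cut into [N] pieces: [w j] is the group increment on a
   piece, and [Q j] is the product of the linearized increments. *)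
pose k j := lpoint S ((j%:R / N%:R) *: v).
pose w j := ((k j)^-1 * k j.+1)%g.
pose Q := fix Q j := if j is j'.+1 then Q j' *m (1%:M + drep S Phi (kappa (w j'))) else (1%:M : 'M[R]_p).
have ZQ j Y' : Z Y' -> Z (Q j *m Y').
  elim: j Y' => [|j IH] Y' ZY' /=; first by rewrite mul1mx.
  by rewrite -mulmxA; apply: IH; exact: ZS.
have kq j : (j <= N)%N -> `|(j%:R / N%:R) *: v| < q.
  move=> jN; rewrite normrZ ger0_norm ?divr_ge0 //.
  by apply: le_lt_trans vq; rewrite ler_piMl // ler_pdivrMr // mul1r ler_nat.
have qrd' : q <= rd by lra.
have qr0 : q <= r0 by lra.
have kB i : (i <= N)%N -> B q (k i) /\ kappa (k i) = (i%:R / N%:R) *: v.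
  move=> jN; split; first exact: (lm_point lm qr0 (kq _ jN)).
  exact: (lm_pointK lm (lt_le_trans (kq _ jN) qr0)).
have e_step j : (j < N)%N ->
    `|Phi (k j.+1) - Q j.+1| <= `|Phi (k j) - Q j| * (1 + c / N%:R) + c / N%:R ^+ 2.
  move=> jN; have [k1 k1E] := kB _ (ltnW jN); have [k2 k2E] := kB _ jN.
  have [wr _ + _] := divr _ _ (lball_sub qrd' k1) (lball_sub qrd' k2).
  rewrite -/(w j) k1E k2E -scalerBl => wN.
  have N1 : (j.+1%:R / N%:R - j%:R / N%:R : R) = N%:R^-1.
    by rewrite -natr1 mulrDl addrAC subrr add0r mul1r.
  have {}wN : `|kappa (w j)| <= 2 * q / N%:R.
    apply: le_trans wN _; rewrite N1 normrZ normfV normr_nat.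
    by rewrite mulrCA mulrC ler_pM2r ?invr_gt0 // ler_pM2l // ltW.
  have wN' : `|kappa (w j)| <= 2 * q.
    by apply: le_trans wN _; rewrite ler_pdivrMr // ler_peMr ?ler1n // mulr_ge0 // ltW.
  have wBr : B r (w j) by split; [case: wr|lra].
  have kw : k j.+1 = (k j * w j)%g by rewrite /w mulVKg.
  have hw := hK _ wBr; rewrite Phi1 in hw.
  have Pk : `|Phi (k j)| <= 1 + K' * q.
    rewrite -(subrK 1%:M (Phi (k j))) addrC; apply: le_trans (ler_normD _ _) _.
    apply: lerD; first by apply: mx_norm_le => // i i'; rewrite mxE; case: eqP; rewrite ?normr1 ?normr0.
    have qr'' : q <= r' by lra.
    have := hK' _ (lball_sub qr'' k1); rewrite Phi1 => /le_trans; apply.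
    by rewrite ler_wpM2l // ltW //; case: k1.
  rewrite [Q j.+1]/= kw PhiM.
  rewrite (_ : _ - _ = (Phi (k j) - Q j) + (Phi (k j) - Q j) *m drep S Phi (kappa (w j))
     + Phi (k j) *m (Phi (w j) - 1%:M - drep S Phi (kappa (w j)))); last first.
    rewrite !(mulmxBr, mulmxBl, mulmxDr) !mulmx1.
    move: (Q j) (Phi (k j)) (Q j *m _) (Phi (k j) *m drep _ _ _) (Phi (k j) *m Phi _) => A1 A2 A3 A4 A5.
    by apply/matrixP => i i'; rewrite !mxE; ring.
  apply: le_trans (ler_normD _ _) _.
  apply: le_trans (lerD (ler_normD _ _) (lexx _)) _.
  set e := `|Phi (k j) - Q j|; have e0 : 0 <= e by exact: normr_ge0.
  have t1 : `|(Phi (k j) - Q j) *m drep S Phi (kappa (w j))| <= e * (p%:R * (M * (2 * q)) / N%:R).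
    apply: le_trans (mulmx_norm_le _ _) _; rewrite -/e.
    rewrite [leRHS](_ : _ = p%:R * e * (M * (2 * q / N%:R))); last by rewrite !mulrA; ring.
    apply: ler_wpM2l; first by rewrite mulr_ge0.
    by apply: le_trans (LM _) _; rewrite ler_pM2l.
  have t2 : `|Phi (k j) *m (Phi (w j) - 1%:M - drep S Phi (kappa (w j)))| <=
      p%:R * (1 + K' * q) * (K * (2 * q) ^+ 2) / N%:R ^+ 2.
    apply: le_trans (mulmx_norm_le _ _) _.
    rewrite -[leRHS]mulrA; apply: ler_pM => //.
      by rewrite ler_wpM2l.
    apply: le_trans hw _; rewrite -mulrA ler_wpM2l // -expr_div_n.
    by rewrite lerXn2r ?nnegrE //; exact: le_trans (normr_ge0 _) wN.
  apply: le_trans (lerD (lerD (lexx _) t1) t2) _.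
  apply: lerD.
    rewrite (mulrDr e) mulr1 lerD2l ler_wpM2l // ler_wpM2r ?invr_ge0 // /c lerDl.
    by repeat (done || apply: mulr_ge0 || apply: sqr_ge0 || apply: addr_ge0).
  rewrite ler_wpM2r ?invr_ge0 ?sqr_ge0 // /c lerDr.
  by repeat (done || apply: mulr_ge0).
have e0 : `|Phi (k 0%N) - Q 0%N| = 0.
  by rewrite /k mul0r scale0r lpoint0 Phi1 subrr normr0.
have := discrete_gronwall (e := fun j => `|Phi (k j) - Q j|) N0 c0 e0 e_step.
have -> : k N = y by rewrite /k divff ?gt_eqF // scale1r /v (lcoordK yq).
move=> eN.
have -> : W *m (Phi y *m Y) = W *m (Phi y - Q N) *m Y.
  have ZQN : W *m (Q N *m Y) = 0 by exact: ZQ.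
  by rewrite mulmxBr mulmxBl -[W *m Q N *m Y]mulmxA ZQN subr0 -[RHS]mulmxA.
apply: le_trans (mulmx_norm_le _ _) _.
rewrite [leRHS](_ : _ = p%:R * (p%:R * `|W| * (c * expR c / N%:R)) * `|Y|); last by rewrite !mulrA; ring.
rewrite ler_wpM2r // ler_wpM2l //.
by apply: le_trans (mulmx_norm_le _ _) _; rewrite ler_wpM2l.
Qed.

End words.

(** * One-parameter subgroups *)

Section one_parameter.
Context {R : realType} {m : nat} {G : topologicalGroupType}.
Variable S : @lieGroup R m G.
Local Notation V := 'rV[R]_m.
Local Notation kappa := (lcoord S).
Local Notation B := (lball S).
Local Notation c := (lie_chart S).

Definition one_param (g : R -> G) (X : V) :=
  [/\ continuous g, forall s t, g (s + t) = (g s * g t)%g &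
      is_derive (0 : R) (1 : R) (cmap c \o g) X].

Lemma hom0 (g : R -> G) : (forall s t, g (s + t) = (g s * g t)%g) -> g 0 = 1%g.
Proof.
move=> gD; have := gD 0 0; rewrite addr0 => h.
by rewrite -(mulVg (g 0)) {3}h mulgA mulVg mul1g.
Qed.

Lemma homN (g : R -> G) s : (forall s t, g (s + t) = (g s * g t)%g) ->
  g (- s) = ((g s)^-1)%g.
Proof.
by move=> gD; apply: esym; apply: mulg1_eq; rewrite -gD subrr hom0.
Qed.

Lemma hom_natmul (g : R -> G) s n : (forall s t, g (s + t) = (g s * g t)%g) ->
  g (n%:R * s) = (g s ^+ n)%g.
Proof.
move=> gD; elim: n => [|n IH]; first by rewrite mul0r expg0 hom0.
by rewrite expgSr -IH -gD -natr1 mulrDl mul1r.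
Qed.

Lemma hom_continuous (g : R -> G) : (forall s t, g (s + t) = (g s * g t)%g) ->
  g s @[s --> (0 : R)] --> (1%g : G) -> continuous g.
Proof.
move=> gD g0 t.
have -> : g = fun s => (g t * g (s - t))%g.
  by apply/funext => s; rewrite -gD addrC subrK.
rewrite /continuous_at subrr hom0 // [X in _ --> X]mulg1 -[X in _ --> X](mulg1 (g t)).
apply: mulg_cvg; first exact: cvg_cst.
apply: (@cvg_comp _ _ _ (fun s => s - t) g _ (nbhs (0 : R))) => //.
have H : (s - t) @[s --> t] --> t - t by apply: cvgB; [exact: cvg_id|exact: cvg_cst].
by rewrite subrr in H.
Qed.

Section estimates.
Variables (C r0 : R).
Hypothesis lm : local_mul S C r0.

Lemma lpoint_cvg v : `|v| < r0 -> lpoint S w @[w --> v] --> lpoint S v.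
Proof.
move=> vr; apply: (@cvg_comp _ _ _ (fun w => w + cmap c 1%g) (cinv c) _ (nbhs (v + cmap c 1%g))).
  have := @cvgD _ _ _ _ _ _ _ v _ (@cvg_id _ (nbhs v)) (@cvg_cst _ (cmap c 1%g) _ _ _).
  by move=> H; exact: H.
apply: cinv_continuous; exists (lpoint S v).
  by have [] := lm_point lm (lexx _) vr.
by rewrite -[X in X + _](lm_pointK lm vr) /lcoord subrK.
Qed.

Lemma lcoord_inv_near : exists r, [/\ 0 < r, r <= r0 & forall x, B r x ->
  [/\ B r0 (x^-1)%g, `|kappa (x^-1)%g| <= 2 * `|kappa x| &
      `|kappa (x^-1)%g + kappa x| <= 2 * C * `|kappa x| ^+ 2]].
Proof.
have [r [rpos rr0 divr]] := lcoord_div_near lm.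
exists r; split => // x xr; have [h1 _ h2 _] := divr _ _ xr (lball1 S rpos).
rewrite mulg1 lcoord1 sub0r normrN in h1 h2; split => //.
have := lm_mul lm h1 (lball_sub rr0 xr).
rewrite mulVg lcoord1 sub0r -opprD normrN => h; apply: le_trans h _.
have := ler_wpM2l (mulr_ge0 (ltW (lm_C lm)) (normr_ge0 (kappa x))) h2; lra.
Qed.

End estimates.

Section limit_subgroup.
Variables (T : set G) (U : set_system nat) (x : nat -> G) (dl : nat -> R) (X : V).
Hypotheses (UU : UltraFilter U) (Tc : compact T) (T1 : T 1%g)
  (TM : forall a b, T a -> T b -> T (a * b)%g) (TV : forall a, T a -> T (a^-1)%g)
  (Tx : \forall n \near U, T (x n)) (dl0 : \forall n \near U, 0 < dl n)
  (dlc : dl @ U --> (0 : R)) (xc : x @ U --> (1%g : G))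
  (xX : (dl n)^-1 *: kappa (x n) @[n --> U] --> X).

Let PU : ProperFilter U := @ultra_proper _ _ UU.
Let Hd : hausdorff_space G := lie_hausdorff S.
Let N (s : R) n := Num.truncn (s / dl n).

Let TX a n : T a -> T (a ^+ n)%g.
Proof. by move=> Ta; elim: n => [|n IH]; rewrite ?expg0 // expgS; apply: TM. Qed.

Let lim_ex s : exists l, T l /\ (x n ^+ N s n)%g @[n --> U] --> l.
Proof.
have [|l Tl h] := ultra_compact_cvg (a := fun n => (x n ^+ N s n)%g) UU Tc; last by exists l.
by apply: filterS Tx => n Txn; exact: TX.
Qed.

(** Iterating the small element [x n] about [s / dl n] times follows the direction [X] for time [s];
    compactness of [T] provides the limit and keeps it in [T]. *)
Let p s := projT1 (cid (lim_ex s)).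

Let Tp s : T (p s). Proof. by rewrite /p; case: cid => l []. Qed.

Let pcvg s : (x n ^+ N s n)%g @[n --> U] --> p s.
Proof. by rewrite /p; case: cid => l []. Qed.

(** The integer part of a sum exceeds the sum of the integer parts by at most one, so the two sides
    are limits of powers that differ by at most one factor [x n], and [x n] tends to 1. *)
Let pD s t : 0 <= s -> 0 <= t -> p (s + t) = (p s * p t)%g.
Proof.
move=> s0 t0.
have h1 : (x n ^+ N s n * x n ^+ N t n * x n ^+ (N (s + t) n - (N s n + N t n)))%g @[n --> U]
    --> (p s * p t * 1)%g.
  apply: mulg_cvg; first exact: mulg_cvg.
  move=> A A1; have A1' := nbhs_singleton A1.
  suff: \forall n \near U, A (x n ^+ (N (s + t) n - (N s n + N t n)))%g by [].
  near=> n; have d0 : 0 < dl n by near: n.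
  have Axn : A (x n) by near: n; exact: xc.
  have le1 : (N (s + t) n - (N s n + N t n) <= 1)%N.
    have sd : 0 <= s / dl n by rewrite divr_ge0 // ltW.
    have td : 0 <= t / dl n by rewrite divr_ge0 // ltW.
    have std : 0 <= (s + t) / dl n by rewrite divr_ge0 ?addr_ge0 // ltW.
    have /andP[a1 a2] := truncn_itv sd; have /andP[b1 b2] := truncn_itv td.
    have /andP[c1 c2] := truncn_itv std.
    rewrite leq_subLR -ltnS -(ltr_nat R); apply: le_lt_trans c1 _.
    rewrite mulrDl; apply: lt_le_trans (ltrD a2 b2) _.
    by rewrite -natrD ler_nat /N addn1 addSn addnS.
  by rewrite /=; case: (_ - _)%N le1 => [|[|//]] _; rewrite ?expg0 ?expg1.
rewrite mulg1 in h1.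
suff h2 : (x n ^+ N (s + t) n)%g @[n --> U] --> (p s * p t)%g.
  exact: (cvg_unique Hd (@pcvg (s + t)) h2).
apply: cvg_trans h1; apply: near_eq_cvg; near=> n.
have d0 : 0 < dl n by near: n.
rewrite -expgnDr -expgnDr subnKC //.
have sd : 0 <= s / dl n by rewrite divr_ge0 // ltW.
have td : 0 <= t / dl n by rewrite divr_ge0 // ltW.
have /andP[a1 a2] := truncn_itv sd; have /andP[b1 b2] := truncn_itv td.
rewrite /N truncn_ge_nat ?natrD ?mulrDl; first exact: lerD.
exact: addr_ge0.
Unshelve. all: by end_near. Qed.

(** The power estimate passes to the limit: the coordinates of [x n ^+ N s n] are [N s n] times
    those of [x n] up to [O(s^2)], and [N s n * dl n] tends to [s]. *)
Let p_small : exists K r, [/\ 0 < K, 0 < r & forall s, 0 <= s < r ->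
  `|kappa (p s) - s *: X| <= K * s ^+ 2 /\ p s = lpoint S (kappa (p s))].
Proof.
have [C [r0 lm]] := local_mul_exists S; have C0 := lm_C lm; have r00 := lm_r lm.
pose M := `|X| + 1; have M0 : 0 < M by rewrite ltr_wpDl.
exists (C * M ^+ 2), (r0 / (8 * M)); split.
- by rewrite mulr_gt0 // exprn_gt0.
- by rewrite divr_gt0 // mulr_gt0.
move=> s /andP[s0]; rewrite ltr_pdivlMr ?mulr_gt0 // => sr.
have sM0 : 0 <= s * M by rewrite mulr_ge0 // ltW.
have facts : \forall n \near U, [/\ 0 < dl n, (N s n)%:R * dl n <= s,
    (N s n)%:R * `|kappa (x n)| <= s * M & cdom c (x n)].
  have kM : \forall n \near U, `|(dl n)^-1 *: kappa (x n)| < M.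
    by apply: (cvgr_norm_lt _ xX); rewrite ltrDl.
  have xd : \forall n \near U, cdom c (x n).
    by apply: xc; apply: open_nbhs_nbhs; split; [exact: cdom_open|exact: lie_chart1].
  near=> n.
  have d0 : 0 < dl n by near: n.
  have Nd : (N s n)%:R * dl n <= s.
    by rewrite -ler_pdivlMr // truncn_le divr_ge0 // ltW.
  split => //; last by near: n.
  have : `|(dl n)^-1 *: kappa (x n)| < M by near: n.
  rewrite normrZ normfV (gtr0_norm d0) ltr_pdivrMl // => km.
  apply: le_trans (_ : (N s n)%:R * (dl n * M) <= _).
    by rewrite ler_wpM2l // ltW.
  by rewrite mulrA ler_pM2r.
have est : \forall n \near U, [/\ B r0 (x n ^+ N s n)%g,
    `|kappa (x n ^+ N s n)%g| <= 2 * (s * M) &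
    `|kappa (x n ^+ N s n)%g - (N s n)%:R *: kappa (x n)| <= C * M ^+ 2 * s ^+ 2].
  apply: filterS facts => n [d0 Nd Nk xd].
  have Nk4 : (N s n)%:R * `|kappa (x n)| < r0 / 4 by lra.
  have [xB xE] := lcoord_pow lm xd Nk4.
  split => //.
    by apply: le_trans (lcoord_pow_le lm xd Nk4) _; rewrite ler_pM2l.
  apply: le_trans xE _; rewrite -mulrA ler_pM2l // -exprMn [M * s]mulrC.
  by rewrite lerXn2r ?nnegrE // mulr_ge0.
have [|v vle vlim] := @ultra_bounded_cvg _ _ _ U (fun n => kappa (x n ^+ N s n)%g) (2 * (s * M)) UU.
  by apply: filterS est => n [].
have vr : `|v| < r0 by lra.
have pv : p s = lpoint S v.
  suff h2 : (x n ^+ N s n)%g @[n --> U] --> lpoint S v.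
    exact: (cvg_unique Hd (@pcvg s) h2).
  apply: cvg_trans (cvg_comp _ _ vlim (lpoint_cvg lm vr)).
  apply: near_eq_cvg; apply: filterS est => n [xB _ _] /=.
  by rewrite (lcoordK xB).
have kp : kappa (p s) = v by rewrite pv (lm_pointK lm vr).
split; last by rewrite kp.
rewrite kp.
have Nd : ((N s n)%:R * dl n) @[n --> U] --> s.
  apply/cvgrPdist_le => e e0.
  have de : \forall n \near U, `|dl n| < e.
    by apply: (cvgr_norm_lt _ dlc); rewrite normr0.
  near=> n; have d0 : 0 < dl n by near: n.
  have dn : `|dl n| < e by near: n.
  rewrite gtr0_norm // in dn; apply: le_trans (ltW dn).
  have sd : 0 <= s / dl n by rewrite divr_ge0 // ltW.
  have /andP[a1 a2] := truncn_itv sd.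
  rewrite ler_pdivlMr // in a1; rewrite ltr_pdivrMr // in a2.
  by rewrite ger0_norm ?subr_ge0 // lerBlDr -[X in _ <= X + _]mul1r -mulrDl addrC natr1 ltW.
have Nk : (N s n)%:R *: kappa (x n) @[n --> U] --> s *: X.
  apply: cvg_trans (cvgZ Nd xX); apply: near_eq_cvg; near=> n => /=.
  have d0 : 0 < dl n by near: n.
  by rewrite scalerA mulfK // gt_eqF.
have lim : `|kappa (x n ^+ N s n)%g - (N s n)%:R *: kappa (x n)| @[n --> U] --> `|v - s *: X|.
  by apply: cvg_norm; apply: cvgB.
apply: (ler_cvg_to lim (cvg_cst (C * M ^+ 2 * s ^+ 2))).
by apply: filterS est => n [].
Unshelve. all: by end_near. Qed.

(** The extension to negative times uses the positive and negative parts of [s]. By [gE] any other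
    way of writing [s] as a difference of nonnegative reals gives the same element, which makes
    additivity a computation with commuting factors. *)
Let g (s : R) := (p (Num.max s 0) * (p (Num.max (- s) 0))^-1)%g.

Let p0 : p 0 = 1%g.
Proof.
have := pD (lexx 0) (lexx 0); rewrite addr0 => h.
by rewrite -(mulVg (p 0)) {3}h mulgA mulVg mul1g.
Qed.

Let pC s t : 0 <= s -> 0 <= t -> (p s * p t)%g = (p t * p s)%g.
Proof. by move=> s0 t0; rewrite -!pD // addrC. Qed.

Let gE a b : 0 <= a -> 0 <= b -> g (a - b) = (p a * (p b)^-1)%g.
Proof.
move=> a0 b0; rewrite /g opprB.
have [ab|ab] := leP b a.
  rewrite max_l ?subr_ge0 // max_r ?subr_le0 // p0 invg1 mulg1.
  have E : p a = (p (a - b) * p b)%g by rewrite -pD ?subr_ge0 // subrK.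
  by rewrite E mulgK.
rewrite max_r ?subr_le0 ?(ltW ab) // max_l ?subr_ge0 ?(ltW ab) // p0 mul1g.
have E : p b = (p (b - a) * p a)%g by rewrite -pD ?subr_ge0 ?(ltW ab) // subrK.
by rewrite E invgM mulVKg.
Qed.

Let gD s t : g (s + t) = (g s * g t)%g.
Proof.
have decomp (u : R) : exists a b, [/\ 0 <= a, 0 <= b & u = a - b].
  exists (Num.max u 0), (Num.max (- u) 0); split; rewrite ?le_max ?lexx ?orbT //.
  have [u0|u0] := leP 0 u; first by rewrite max_r ?oppr_le0 // subr0.
  by rewrite max_l ?oppr_ge0 ?ltW // sub0r opprK.
have [a [b [a0 b0 ->]]] := decomp s; have [a' [b' [a'0 b'0 ->]]] := decomp t.
have -> : a - b + (a' - b') = a + a' - (b + b') by ring.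
rewrite !gE ?addr_ge0 // !pD // invgM.
rewrite -!mulgA; congr (_ * _)%g.
have c1 : commute (p b) (p a') := pC b0 a'0.
have c2 : commute (p b) (p b') := pC b0 b'0.
have c3 := commuteV (commute_sym (commuteM c1 (commuteV c2))).
by rewrite mulgA; exact: c3.
Qed.

(** The velocity at 0 is read off from the quadratic estimate for [p]; for negative times the
    inverse costs one more quadratic error. *)
Lemma limit_one_param : exists g, (forall s, T (g s)) /\ one_param g X.
Proof.
have [C [r0 lm]] := local_mul_exists S; have C0 := lm_C lm.
have [K [r [K0 rpos psm]]] := p_small.
have [ri [ri0 rir0 inv]] := lcoord_inv_near lm.
have Tg s : T (g s) by apply: TM => //; exact: TV.
exists g; split => //.
pose M := K * r + `|X|.
have M0 : 0 <= M by rewrite addr_ge0 // mulr_ge0 // ltW.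
have pM s : 0 <= s < r -> `|kappa (p s)| <= M * s.
  move=> sr; have [h _] := psm s sr; case/andP: sr => s0 sr.
  rewrite -(subrK (s *: X) (kappa (p s))); apply: le_trans (ler_normD _ _) _.
  rewrite normrZ ger0_norm // /M mulrDl [`|X| * s]mulrC lerD2r.
  apply: le_trans h _; rewrite expr2 -mulrA ler_pM2l //.
  by rewrite ler_wpM2r // ltW.
have gneg (s : R) : s <= 0 -> g s = ((p (- s))^-1)%g.
  by move=> s0; rewrite -{1}(opprK s) -[- - s]sub0r gE ?oppr_ge0 // p0 mul1g.
have gpos s : 0 <= s -> g s = p s.
  by move=> s0; rewrite -{1}(subr0 s) gE // p0 invg1 mulg1.
split; last 1 first.
- pose r1 := Num.min r (ri / (M + 1)).
  have M1 : 0 < M + 1 by rewrite ltr_wpDl.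
  have r10 : 0 < r1 by rewrite lt_min rpos divr_gt0.
  have r1r : r1 <= r by rewrite ge_min lexx.
  rewrite -[X]scale1r.
  apply: (@is_derive_quadratic _ _ _ _ _ _ (fun s : R => s *: X)
    (K + 2 * C * M ^+ 2) r1) => //.
    by move=> h; rewrite scalerA.
  move=> v vr; rewrite addr0 /= [g 0](gpos 0) // p0.
  rewrite -[_ - cmap c 1%g]/(kappa (g v)).
  have K2 : 0 <= 2 * C * M ^+ 2 by rewrite !mulr_ge0 // ?sqr_ge0 // ltW.
  have [v0|v0] := leP 0 v.
    rewrite gpos //; have v0r : 0 <= v < r.
      by rewrite v0; apply: lt_le_trans r1r; apply: le_lt_trans vr; exact: ler_norm.
    have [h _] := psm v v0r; rewrite ger0_norm //; apply: le_trans h _.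
    by rewrite ler_wpM2r ?sqr_ge0 // lerDl.
  rewrite (gneg v (ltW v0)); have nv0 : 0 <= - v by rewrite oppr_ge0 ltW.
  rewrite ltr0_norm // in vr *.
  have v0r : 0 <= - v < r by rewrite nv0; apply: lt_le_trans vr r1r.
  have [h hp] := psm _ v0r; have hM := pM _ v0r.
  have yri : `|kappa (p (- v))| < ri.
    apply: le_lt_trans hM _; move: vr; rewrite lt_min => /andP[_].
    by rewrite ltr_pdivlMr // => vri; apply: le_lt_trans vri; rewrite mulrC ler_wpM2l // lerDl.
  have yB : B ri (p (- v)) by rewrite hp; exact: (lm_point lm rir0 yri).
  have [_ _ h3] := inv _ yB.
  rewrite (_ : _ - _ = (kappa ((p (- v))^-1)%g + kappa (p (- v)))
    - (kappa (p (- v)) - (- v) *: X)); last first.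
    by apply/rowP => k; rewrite !mxE; ring.
  apply: le_trans (ler_normB _ _) _; rewrite mulrDl [leRHS]addrC.
  apply: lerD; last exact: h.
  have C2 : 0 <= 2 * C by rewrite mulr_ge0 // ltW.
  have q2 : `|kappa (p (- v))| ^+ 2 <= M ^+ 2 * (- v) ^+ 2.
    by rewrite -exprMn lerXn2r ?nnegrE // mulr_ge0.
  by apply: le_trans h3 _; apply: le_trans (ler_wpM2l C2 q2) _; rewrite mulrA.
- apply: hom_continuous => // A A1.
  have A1' : nbhs (1%g : G) (A `&` [set y | A (y^-1)%g]).
    by apply: filterI; [exact: A1|exact: (nbhs1_inv A1)].
  have /nbhs_ballP[e /= e0 eA] := lpoint_cvg0 S A1'.
  suff: \forall s \near (0 : R), A (g s) by [].
  have pos : 0 < Num.min r (e / (M + 1)).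
    by rewrite lt_min rpos divr_gt0 // ltr_wpDl.
  have small : \forall s \near (0 : R^o), `|s| < Num.min r (e / (M + 1)) := nbhs0_lt pos.
  apply: filterS small => s sr.
  move: sr; rewrite lt_min => /andP[sr]; rewrite ltr_pdivlMr ?ltr_wpDl // => se.
  have pA t : 0 <= t -> t = `|s| -> A (p t) /\ A ((p t)^-1)%g.
    move=> t0 ts; have tr : 0 <= t < r by rewrite t0 ts.
    have [_ hp] := psm _ tr; have hM := pM _ tr.
    rewrite hp; apply: eA; rewrite -ball_normE /= sub0r normrN.
    apply: le_lt_trans hM _; rewrite ts; apply: le_lt_trans se.
    by rewrite mulrC ler_wpM2l // lerDl.
  have [s0|s0] := leP 0 s.
    by rewrite gpos //; have [] := pA s s0 (esym (ger0_norm s0)).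
  rewrite (gneg s (ltW s0)); have [] // := pA (- s) _ (esym (ltr0_norm s0)).
  by rewrite oppr_ge0 ltW.
Unshelve. all: by end_near. Qed.

End limit_subgroup.
End one_parameter.

Section one_parameter_groups.
Context {R : realType} {m : nat} {G : topologicalGroupType}.
Variable S : @lieGroup R m G.
Local Notation V := 'rV[R]_m.
Local Notation kappa := (lcoord S).
Local Notation B := (lball S).
Local Notation c := (lie_chart S).

(** This is the limit construction for the whole compact group and the points with coordinates
    [X / n.+1]. *)
Lemma exp_exists (X : V) : compact [set: G] -> exists g, one_param S g X.
Proof.
move=> Gc; have [C [r0 lm]] := local_mul_exists S.
have [U [UU Uoo]] := ultrafilter_nat.
pose dl n : R := n.+1%:R^-1.
have d0 : dl n @[n --> U] --> (0 : R) by apply: cvg_trans (cvg_app _ Uoo) cvg_harmonic.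
have dX : (dl n *: X) @[n --> U] --> (0 : V).
  by rewrite -[X in _ --> X](scale0r X); apply: cvgZ => //; exact: cvg_cst.
have PU := @ultra_proper _ _ UU.
suff [g [_ gX]] : exists g, (forall s, [set: G] (g s)) /\ one_param S g X by exists g.
apply: (@limit_one_param _ _ _ S setT U (fun n => lpoint S (dl n *: X)) dl X UU Gc) => //.
- exact: nearW.
- by apply: nearW => n; rewrite invr_gt0.
- exact: (cvg_comp _ _ dX (@lpoint_cvg0 _ _ _ S)).
- have cX : (fun _ : nat => X) @ U --> X by exact: cvg_cst.
  apply: cvg_trans cX; apply: near_eq_cvg.
  have small : \forall n \near U, `|dl n *: X| < r0.
    by apply: (cvgr_norm_lt _ dX); rewrite normr0; exact: lm_r lm.
  apply: filterS small => n nr /=.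
  by rewrite (lm_pointK lm nr) scalerA mulVf ?scale1r // invr_eq0 pnatr_eq0.
Qed.

Lemma one_param_small (g : R -> G) X : one_param S g X -> forall e, 0 < e ->
  exists2 d, 0 < d & forall s, `|s| < d -> `|kappa (g s) - s *: X| <= e * `|s|.
Proof.
move=> [gc gD /is_deriveP gX] e e0.
move/cvgrPdist_le: gX => /(_ e e0) [d /= d0 hd].
exists d => // s sd.
have [->|s0] := eqVneq s 0.
  by rewrite hom0 // lcoord1 scale0r subrr !normr0 mulr0.
have := hd s; rewrite /= sub0r normrN => /(_ sd s0).
rewrite addr0 [s *: 1]mulr1 (hom0 gD) -[cmap c (g s) - _]/(kappa (g s)) => h.
rewrite -(scale1r (kappa (g s))) -(divff s0) -scalerA -scalerBr normrZ mulrC.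
by rewrite ler_wpM2r // distrC.
Qed.

Lemma is_derive_one_param (W : normedModType R) (f : G -> W) (L : V -> W) g X :
  one_param S g X -> lin_approx S f L -> is_derive (0 : R) 1 (f \o g) (L X).
Proof.
move=> gX fL; have [gc gD _] := gX; apply/is_deriveP.
have [K [r [K0 rpos hK]]] := lin_approx_nneg fL.
have [M M0 LM] := linear_map_bounded fL.1.
apply/cvgrPdist_le => e e0.
have [d1 d10 h1] := one_param_small gX ltr01.
have e1 : 0 < e / (2 * M) by rewrite divr_gt0 // mulr_gt0.
have [d2 d20 h2] := one_param_small gX e1.
have X1 : 0 < `|X| + 1 by rewrite ltr_wpDl.
have K1 : 0 < K * (`|X| + 1) ^+ 2 + 1.
  by rewrite ltr_wpDl // mulr_ge0 // sqr_ge0.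
have gB : \forall s \near (0 : R), B r (g s).
  by apply: (gc 0); rewrite (hom0 gD); exact: nbhs_lball.
near=> h.
have h0 : h != 0 by near: h; exact: nbhs_dnbhs_neq.
have gh : B r (g h) by near: h; exact: nbhs_dnbhs.
have hs : `|h| < Num.min (Num.min d1 d2) (e / (2 * (K * (`|X| + 1) ^+ 2 + 1))).
  by near: h; apply: dnbhs0_lt; rewrite !lt_min d10 d20 divr_gt0 // mulr_gt0.
move: hs; rewrite !lt_min => /andP[/andP[hd1 hd2] he].
rewrite /= addr0 [h *: 1]mulr1 (hom0 gD).
rewrite -[L X]scale1r -(mulVf h0) -scalerA -scalerBr normrZ normfV.
rewrite ler_pdivrMl ?normr_gt0 // -linear_mapZ; last exact: fL.1.
rewrite distrC -(subrK (L (kappa (g h))) (f (g h) - f 1%g)) -addrA -linear_mapB; last exact: fL.1.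
apply: le_trans (ler_normD _ _) _.
have b1 : `|kappa (g h)| <= (`|X| + 1) * `|h|.
  rewrite -(subrK (h *: X) (kappa (g h))); apply: le_trans (ler_normD _ _) _.
  by have := h1 h hd1; rewrite normrZ; lra.
have b2 : `|f (g h) - f 1%g - L (kappa (g h))| <= K * ((`|X| + 1) * `|h|) ^+ 2.
  apply: le_trans (hK _ gh) _; apply: ler_wpM2l => //.
  by apply: lerXn2r => //; rewrite nnegrE; [exact: normr_ge0|exact: le_trans (normr_ge0 _) b1].
have b3 : `|L (kappa (g h) - h *: X)| <= M * (e / (2 * M) * `|h|).
  by apply: le_trans (LM _) _; rewrite ler_pM2l // h2.
apply: le_trans (lerD b2 b3) _.
have -> : M * (e / (2 * M) * `|h|) = e / 2 * `|h| by field; rewrite gt_eqF.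
rewrite ltr_pdivlMr ?mulr_gt0 // in he.
have := normr_ge0 h => hh.
have : K * (`|X| + 1) ^+ 2 * `|h| <= e / 2 by lra.
by move=> /(ler_wpM2l hh); rewrite exprMn; lra.
Unshelve. all: by end_near. Qed.

Lemma one_param_conj g X x : one_param S g X ->
  one_param S (fun s => x * g s * x^-1)%g (Ad S x X).
Proof.
move=> gX; have [gc gD _] := gX; split.
- move=> s; apply: mulg_cvg; last exact: cvg_cst.
  by apply: mulg_cvg; [exact: cvg_cst|exact: gc].
- by move=> s t; rewrite gD !mulgA mulgVK.
have h : lin_approx S (fun y => cmap c (x * y * x^-1)%g) (Ad S x).
  apply: lin_approx_ext (conj_lin_approx S x) => // y.
  by rewrite /lcoord opprB addrA subrK mulg1.
exact: is_derive_one_param gX h.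
Qed.

Lemma rep_one_param_derive p (Phi : G -> 'M[R]_p) g X s : real_rep Phi ->
  one_param S g X ->
  is_derive s (1 : R) (fun t => Phi (g t)) (Phi (g s) *m drep S Phi X).
Proof.
move=> PhiR gX; have [PhiM Phi1 _] := PhiR; have [gc gD _] := gX.
have Tlin : linear_map (fun A : 'M[R]_p => Phi (g s) *m A).
  by move=> a u v; rewrite mulmxDr -scalemxAr.
have h := lin_approx_linear Tlin (mulmx_norm_le (Phi (g s))) (drep_lin_approx S PhiR).
have /is_deriveP h' := is_derive_one_param gX h.
apply/is_deriveP; move: h'.
apply: cvg_trans; apply: near_eq_cvg; apply: nearW => t /=.
have -> : g (t *: 1 + s) = (g s * g t)%g by rewrite [_ *: 1]mulr1 addrC gD.
by rewrite addr0 (hom0 gD) Phi1 mulmx1 PhiM [_ *: 1]mulr1.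
Qed.

(** Let [q t = (h t)^-1 * g t]. Passing from time [j * t] to [(j + 1) * t] multiplies [q] by a
    conjugate of [q t], which has size [o(t)] because both groups have velocity [X]. Over [s / t]
    steps these changes sum to [o(1)]. *)
Lemma one_param_unique g h X : one_param S g X -> one_param S h X -> g =1 h.
Proof.
move=> gX hX; have [gc gD _] := gX; have [hc hD _] := hX.
have [C [r0 lm]] := local_mul_exists S.
have [rd [rd0 rdr0 divr]] := lcoord_div_near lm.
have [N [Nn N1 NV NM]] := nbhs1_mul4 (nbhs_lball S (lm_r lm)).
have [r [rpos rr0 rN]] := lball_sub_nbhs lm (filterI Nn (nbhs_lball S rd0)).
have gB : \forall s \near (0 : R), B r (g s).
  by apply: (gc 0); rewrite (hom0 gD); exact: nbhs_lball.
have hB : \forall s \near (0 : R), B r (h s).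
  by apply: (hc 0); rewrite (hom0 hD); exact: nbhs_lball.
have gh : \forall s \near (0 : R), B r (g s) /\ B r (h s) by exact: filterI.
have /nbhs_ballP[s0 /= s00 ghB] := gh.
have {}ghB s : `|s| < s0 -> B r (g s) /\ B r (h s).
  by move=> ss; apply: ghB; rewrite -ball_normE /= sub0r normrN.
have small s : 0 < s < s0 -> g s = h s.
  move=> /andP[spos ss0].
  pose q t := ((h t)^-1 * g t)%g.
  have qB t : `|t| < s0 -> B r0 (q t).
    move=> ts; have [gt ht] := ghB t ts.
    by have := NM _ _ _ _ (NV _ (rN _ ht).1) (rN _ gt).1 N1 N1; rewrite !mulg1.
  suff q1 : kappa (q s) = 0.
    have ss : `|s| < s0 by rewrite gtr0_norm.
    have : q s = 1%g.
      by apply: (lcoord_inj (qB s ss) (lball1 S (lm_r lm))); rewrite lcoord1.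
    by rewrite /q => E; rewrite -[LHS](mulVKg (h s)) E mulg1.
  apply: normr0_eq0; apply/eqP; rewrite eq_le normr_ge0 andbT.
  apply/ler_addgt0Pl => e e0; rewrite addr0.
  (* Here 32 is 2 * 2 * 8: the quotient estimate doubles, both one-parameter groups contribute, and
     each step costs at most [8 * |kappa y|]. *)
  have e1 : 0 < e / (32 * s) by rewrite divr_gt0 // mulr_gt0.
  have [d1 d10 h1] := one_param_small gX e1.
  have [d2 d20 h2] := one_param_small hX e1.
  have [n nK] : exists n : nat, s / Num.min d1 d2 < n.+1%:R.
    by exists (Num.truncn (s / Num.min d1 d2)); exact: truncnS_gt.
  have n0 : (0 : R) < n.+1%:R by rewrite ltr0n.
  pose t := s / n.+1%:R; have t0 : 0 < t by rewrite divr_gt0.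
  have td : `|t| < Num.min d1 d2.
    by rewrite gtr0_norm // ltr_pdivrMr // mulrC -ltr_pdivrMr // lt_min d10.
  move: td; rewrite lt_min => /andP[td1 td2].
  have js j : (j <= n.+1)%N -> `|j%:R * t| < s0.
    move=> jn; rewrite ger0_norm ?mulr_ge0 //; last exact: ltW.
    apply: le_lt_trans ss0; rewrite /t mulrA ler_pdivrMr // mulrC ler_pM2l //.
    by rewrite ler_nat.
  pose y := ((h t)^-1 * g t)%g.
  have ts : `|t| < s0 by have := js 1%N isT; rewrite mul1r.
  have [gt ht] := ghB t ts.
  have yk : `|kappa y| <= e / (8 * s) * t.
    have [_ _ hd _] := divr _ _ (rN _ ht).2 (rN _ gt).2.
    apply: le_trans hd _.
    have := h1 t td1; have := h2 t td2; rewrite gtr0_norm // => a1 a2.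
    have : `|kappa (g t) - kappa (h t)| <= `|kappa (g t) - t *: X| + `|kappa (h t) - t *: X|.
      by rewrite [X in _ <= _ + X]distrC; exact: ler_distD.
    have -> : e / (8 * s) * t = 2 * (e / (32 * s) * t + e / (32 * s) * t).
      by field; rewrite gt_eqF.
    by lra.
  have step j : (j < n.+1)%N -> `|kappa (q (j.+1%:R * t)) - kappa (q (j%:R * t))| <= 2 * (4 * `|kappa y|).
    move=> jn; have jt := js j (ltnW jn).
    have [gj hj] := ghB _ jt.
    pose z := ((g (j%:R * t)%R)^-1 * y * g (j%:R * t)%R)%g.
    have zB : B r0 z.
      have := NM _ _ _ _ (NV _ (rN _ gj).1) (NV _ (rN _ ht).1) (rN _ gt).1 (rN _ gj).1.
      by rewrite /z /y !mulgA.
    have yB : B r0 y by exact: qB.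
    have gj0 := lball_sub rr0 gj.
    have E : q (j.+1%:R * t) = (q (j%:R * t)%R * z)%g.
      rewrite /q /z /y -natr1 mulrDl mul1r (addrC _ t) hD gD invgM.
      by rewrite -!mulgA mulVKg.
    rewrite E; apply: le_trans (lcoord_mulr_le lm (qB _ jt) zB).1 _.
    rewrite ler_pM2l //; apply: le_trans (lcoord_mulr_le lm gj0 zB).2 _.
    have -> : (g (j%:R * t)%R * z)%g = (y * g (j%:R * t)%R)%g by rewrite /z -!mulgA mulVKg.
    by have := (lcoord_mull_le lm yB gj0).1; lra.
  have main j : (j <= n.+1)%N -> `|kappa (q (j%:R * t))| <= j%:R * (8 * `|kappa y|).
    elim: j => [|j IH] jn; first by rewrite mul0r /q (hom0 gD) (hom0 hD) invg1 mulg1 lcoord1 normr0 mul0r.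
    rewrite -(subrK (kappa (q (j%:R * t))) (kappa (q (j.+1%:R * t)))).
    apply: le_trans (ler_normD _ _) _.
    by have := step j jn; have := IH (ltnW jn); rewrite -natr1; lra.
  have nt : n.+1%:R * t = s by rewrite /t mulrC divfK // gt_eqF.
  have := main n.+1 (leqnn _); rewrite nt => /le_trans; apply.
  apply: le_trans (_ : n.+1%:R * (8 * (e / (8 * s) * t)) <= _).
    by rewrite ler_pM2l // ler_pM2l.
  have -> : n.+1%:R * (8 * (e / (8 * s) * t)) = e / s * (n.+1%:R * t).
    by field; rewrite gt_eqF.
  rewrite nt divfK ?gt_eqF //.
have pos s : 0 < s -> g s = h s.
  move=> spos; have [n nK] : exists n : nat, s / s0 < n.+1%:R.
    by exists (Num.truncn (s / s0)); exact: truncnS_gt.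
  have n0 : (0 : R) < n.+1%:R by rewrite ltr0n.
  have E : s = n.+1%:R * (s / n.+1%:R) by rewrite mulrC divfK // gt_eqF.
  rewrite E (hom_natmul _ _ gD) (hom_natmul _ _ hD) small // divr_gt0 //=.
  by rewrite ltr_pdivrMr // mulrC -ltr_pdivrMr.
move=> s; have [s_lt|s_gt|->] := ltgtP s 0.
- by rewrite -(opprK s) (homN _ gD) (homN _ hD) pos // oppr_gt0.
- exact: pos.
- by rewrite (hom0 gD) (hom0 hD).
Qed.

End one_parameter_groups.

(** * Tori and their Lie algebras *)

Section torus.
Context {R : realType} {m : nat} {G : topologicalGroupType}.
Variable S : @lieGroup R m G.
Local Notation V := 'rV[R]_m.
Local Notation kappa := (lcoord S).
Local Notation B := (lball S).
Local Notation c := (lie_chart S).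

Lemma linear_map_continuous (W W' : normedModType R) (T : W -> W') (M : R) :
  linear_map T -> (forall w, `|T w| <= M * `|w|) -> continuous T.
Proof.
move=> Tl TM w; apply/cvgrPdist_le => e e0; near=> w'.
have h : `|w - w'| <= e / (`|M| + 1).
  by near: w'; apply: cvgr_dist_le; [exact: cvg_id|rewrite divr_gt0 // ltr_wpDl].
rewrite -linear_mapB //; apply: le_trans (TM _) _.
rewrite ler_pdivlMr ?ltr_wpDl // in h.
have := ler_norm M; have := normr_ge0 (w - w') => h0 hM.
have := ler_wpM2r h0 hM; lra.
Unshelve. all: by end_near. Qed.

Lemma is_derive_linear_map (U W W' : normedModType R) (T : W -> W') (M : R) (f : U -> W) x v d :
  linear_map T -> (forall w, `|T w| <= M * `|w|) ->
  is_derive x v f d -> is_derive x v (fun y => T (f y)) (T d).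
Proof.
move=> Tl TM /is_deriveP fd; apply/is_deriveP.
apply: cvg_trans (cvg_comp _ _ fd (@linear_map_continuous _ _ _ _ Tl TM d)).
by apply: near_eq_cvg; apply: nearW => h /=; rewrite linear_mapZ // linear_mapB.
Qed.

Lemma rep_vec_derive p q (Phi : G -> 'M[R]_p) g X (w : 'M[R]_(p, q)) s : real_rep Phi ->
  one_param S g X ->
  is_derive s (1 : R) (fun t => Phi (g t) *m w) (Phi (g s) *m (drep S Phi X *m w)).
Proof.
move=> PhiR gX; rewrite mulmxA.
have Tl : linear_map (fun A : 'M[R]_p => A *m w).
  by move=> a u v; rewrite mulmxDl scalemxAl.
apply: (@is_derive_linear_map _ _ _ (fun A : 'M[R]_p => A *m w) (p%:R * `|w|)) => //.
  by move=> A; apply: le_trans (mulmx_norm_le _ _) _; rewrite mulrAC.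
exact: rep_one_param_derive.
Qed.

Lemma real_rep_continuous p (Phi : G -> 'M[R]_p) : real_rep Phi -> continuous Phi.
Proof.
move=> [PhiM Phi1 Phic] x.
have Tl : linear_map (fun A : 'M[R]_p => Phi x *m A).
  by move=> a u v; rewrite mulmxDr -scalemxAr.
have h : (x^-1 * y)%g @[y --> x] --> (1%g : G).
  by rewrite -[X in _ --> X](mulVg x); apply: mulg_cvg; [exact: cvg_cst|exact: cvg_id].
have h1 := cvg_comp _ _ h Phic.
have h2 := cvg_comp _ _ h1 (@linear_map_continuous _ _ _ _ Tl (mulmx_norm_le (Phi x)) 1%:M).
rewrite mulmx1 in h2; apply: cvg_trans h2; apply: near_eq_cvg; apply: nearW => y /=.
by rewrite -PhiM mulVKg.
Qed.

Lemma Ad_continuous A : continuous (fun x => Ad S x A).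
Proof.
move=> x; have Tl : linear_map (fun M : 'M[R]_m => (M *m A^T)^T).
  by move=> a u v; rewrite mulmxDl linearD /= -scalemxAl linearZ.
have Tn (M : 'M[R]_m) : `|(M *m A^T)^T| <= m%:R * `|A^T| * `|M|.
  apply: (@le_trans _ _ `|M *m A^T|).
    by apply: mx_norm_le => // i j; rewrite mxE le_mx_norm.
  by apply: le_trans (mulmx_norm_le _ _) _; rewrite mulrAC.
have := cvg_comp _ _ (@real_rep_continuous _ _ (Admx_rep S) x)
  (@linear_map_continuous _ _ _ _ Tl Tn (Admx S x)).
rewrite -AdmxE; apply: cvg_trans; apply: near_eq_cvg; apply: nearW => y /=.
by rewrite -AdmxE.
Qed.

Lemma Ad_one_param_fix g X A : one_param S g X -> lie_bracket S X A = 0 ->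
  forall s, Ad S (g s) A = A.
Proof.
move=> gX XA s.
have A0 : drep S (Admx S) X *m A^T = 0.
  by apply: trmx_inj; rewrite -lie_bracketE XA trmx0.
have [gc gD _] := gX.
suff E : Admx S (g s) *m A^T = Admx S (g 0) *m A^T.
  by rewrite AdmxE E (hom0 gD) Admx1 mul1mx trmxK.
apply/matrixP => i j.
apply: (@is_derive_0_is_cst _ (fun t => (Admx S (g t) *m A^T) i j)) => t.
have h : is_derive t 1 (fun t => Admx S (g t) *m A^T) 0.
  by rewrite -(mulmx0 _ (Admx S (g t))) -A0; exact: (rep_vec_derive _ _ (Admx_rep S) gX).
by have := is_derive_coord i j h; rewrite mxE.
Qed.

Variable T : set G.
Hypothesis T_torus : is_torus T.

Lemma lie_of_subgroupP X : lie_of_subgroup S T X <->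
  exists2 g, one_param S g X & forall s, T (g s).
Proof.
by split=> [[g [gc gD gT gX]]|[g [gc gD gX] gT]]; exists g => //; split.
Qed.

Lemma torus_closed : closed T.
Proof. by case: T_torus => _ _ _ _ [Tc _]; exact: compact_closed (lie_hausdorff S) Tc. Qed.

Lemma torus_fix_closed A : closed [set x | T x /\ Ad S x A = A].
Proof.
have -> : [set x | T x /\ Ad S x A = A] = T `&` ((fun x => Ad S x A) @^-1` [set A]) by [].
apply: closedI; first exact: torus_closed.
apply: closed_comp; first by move=> x _; exact: Ad_continuous.
by apply: compact_closed; [exact: norm_hausdorff|exact: compact_set1].
Qed.

(** The coordinates of the points of the coset [t K] in a closed ball form a compact set, so a
    shortest representative exists. *)
Lemma coset_minimizer (K : set G) t C r0 r : local_mul S C r0 -> r < r0 ->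
  closed K -> K 1%g -> (forall x y, K x -> K y -> K (x * y)%g) -> B r t ->
  exists t', [/\ K (t^-1 * t')%g, B r0 t', `|kappa t'| <= `|kappa t| &
    forall k, K k -> B r (t' * k)%g -> `|kappa t'| <= `|kappa (t' * k)%g|].
Proof.
move=> lm rr0 Kc K1 KM tr.
pose D := [set v : V | `|v| <= r /\ K (t^-1 * lpoint S v)%g].
have Dn : D !=set0.
  exists (kappa t); split; first by case: tr => _ /ltW.
  by rewrite (lcoordK tr) mulVg.
have Dcl : closed D.
  move=> v clv.
  have vr : `|v| <= r.
    have : closed [set v : V | `|v| <= r].
      apply: (@closed_comp _ _ (fun v : V => `|v|) [set x | x <= r]).
        by move=> x _; exact: norm_continuous.
      exact: closed_le.
    by apply => O vO; have [w [[wr _] Ow]] := clv _ vO; exists w.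
  split => //; apply: Kc => O KO.
  have h : (t^-1 * lpoint S w)%g @[w --> v] --> (t^-1 * lpoint S v)%g.
    apply: (@mulg_cvg _ _ (nbhs v) _ (fun=> (t^-1)%g) (lpoint S)).
      exact: (@cvg_cst _ _ _ (nbhs v) _).
    exact: (lpoint_cvg lm (le_lt_trans vr rr0)).
  have [w [[wr Kw] Ow]] := clv _ (h _ KO).
  by exists (t^-1 * lpoint S w)%g; split.
have Dc : compact D.
  apply: bounded_closed_compact => //; exists r; split; first exact: num_real.
  by move=> M rM v /= [vr _]; exact: le_trans vr (ltW rM).
have [|v0 v0D vmin] := @EVT_min_rV _ _ (fun v : V => `|v|) D Dn Dc.
  by apply: continuous_subspaceT => v; exact: norm_continuous.
move: v0D; rewrite inE => -[v0r Kv0].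
have v0r0 : `|v0| < r0 by exact: le_lt_trans v0r rr0.
have v0K := lm_pointK lm v0r0.
exists (lpoint S v0); split.
- by [].
- exact: (lm_point lm (lexx _) v0r0).
- rewrite v0K; apply: vmin; rewrite inE; split; first by case: tr => _ /ltW.
  by rewrite (lcoordK tr) mulVg.
move=> k Kk kr; rewrite v0K; apply: vmin; rewrite inE; split; first by case: kr => _ /ltW.
by rewrite (lcoordK kr) mulgA; exact: KM.
Qed.

(* If the stabiliser K of A in T were not open, elements of T outside K, taken
   as short as possible in their K-coset, would accumulate in a direction X of the
   Lie algebra of T; then exp (s X) lies in K and could be used to shorten them. *)
Lemma torus_fix_near A :
  (forall X, lie_of_subgroup S T X -> lie_bracket S X A = 0) ->
  exists2 r, 0 < r & forall t, T t -> B r t -> Ad S t A = A.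
Proof.
move=> hA; apply: contrapT => nex.
have [T1 TM TV TC [Tc Tconn]] := T_torus.
have [C [r0 lm]] := local_mul_exists S; have r00 := lm_r lm; have C0 := lm_C lm.
pose K := [set x | T x /\ Ad S x A = A].
have K1 : K 1%g by split; rewrite ?Ad1.
have KM x y : K x -> K y -> K (x * y)%g.
  by move=> [Tx xA] [Ty yA]; split; [exact: TM|rewrite AdM yA].
have KV x : K x -> K (x^-1)%g.
  by move=> [Tx xA]; split; [exact: TV|rewrite -{1}xA AdK].
have Kc : closed K by exact: torus_fix_closed.
pose r := r0 / 2; have rr0 : r < r0 by rewrite /r; lra.
have rpos : 0 < r by rewrite /r; lra.
have /choice[x hx] : forall n : nat, exists x, [/\ T x /\ ~ K x, B r0 x,
    `|kappa x| <= n.+1%:R^-1, `|kappa x| < r &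
    forall k, K k -> B r (x * k)%g -> `|kappa x| <= `|kappa (x * k)%g|].
  move=> n; apply: contrapT => nx; apply: nex.
  have nr : 0 < Num.min r n.+1%:R^-1 by rewrite lt_min rpos invr_gt0 ltr0n.
  exists (Num.min r n.+1%:R^-1) => // t Tt tr; apply: contrapT => tA; apply: nx.
  have tr' : B r t by apply: lball_sub tr; rewrite ge_min lexx.
  have [t' [Kt' t'r t'le t'min]] := coset_minimizer lm rr0 Kc K1 KM tr'.
  have tE : t' = (t * (t^-1 * t'))%g by rewrite mulVKg.
  exists t'; split => //.
  - split; first by rewrite tE; apply: TM => //; case: Kt'.
    move=> Kt; apply: tA; have [] // := KM _ _ Kt (KV _ Kt').
    by rewrite invgM invgK mulVKg.
  - by apply: le_trans t'le _; case: tr => _; rewrite lt_min => /andP[_ /ltW].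
  - by apply: le_lt_trans t'le _; case: tr'.
pose dl n := `|kappa (x n)|.
have dl0 n : 0 < dl n.
  rewrite normr_gt0; apply/eqP => k0; have [[_ nK] xB _ _ _] := hx n; apply: nK.
  by rewrite (lcoord_inj xB (lball1 S r00)) // lcoord1.
have [U [UU Uoo]] := ultrafilter_nat.
have PU := @ultra_proper _ _ UU.
have harm : n.+1%:R^-1 @[n --> U] --> (0 : R) by apply: cvg_trans (cvg_app _ Uoo) cvg_harmonic.
have dlc : dl n @[n --> U] --> (0 : R).
  apply/cvgrPdist_le => e e0.
  have he : \forall n \near U, `|n.+1%:R^-1 : R| < e.
    by apply: (cvgr_norm_lt _ harm); rewrite normr0.
  apply: filterS he => n ne; rewrite sub0r normrN gtr0_norm //.
  rewrite gtr0_norm ?invr_gt0 ?ltr0n // in ne.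
  by apply: le_trans (ltW ne); have [] := hx n.
have kc : kappa (x n) @[n --> U] --> (0 : V) by apply/norm_cvg0P.
have xc : x n @[n --> U] --> (1%g : G).
  apply: cvg_trans (cvg_comp _ _ kc (@lpoint_cvg0 _ _ _ S)).
  by apply: near_eq_cvg; apply: nearW => n /=; have [_ xB _ _ _] := hx n; rewrite (lcoordK xB).
have unit n : `|(dl n)^-1 *: kappa (x n)| = 1.
  by rewrite normrZ normfV gtr0_norm // mulVf // gt_eqF.
have [|X X1 xX] := @ultra_bounded_cvg _ _ _ U (fun n => (dl n)^-1 *: kappa (x n)) 1 UU.
  by apply: nearW => n; rewrite unit.
have [g [Tg gX]] : exists g, (forall s, T (g s)) /\ one_param S g X.
  apply: (@limit_one_param _ _ _ S T U x dl X UU Tc) => //.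
  - by apply: nearW => n; case: (hx n) => [[]].
  - exact: nearW.
have Kg s : K (g s).
  split; first exact: Tg.
  by apply: (Ad_one_param_fix gX); apply: hA; apply/lie_of_subgroupP; exists g.
have e0 : (0 : R) < 4^-1 by rewrite invr_gt0.
have [d d0 hd] := one_param_small gX e0.
have gB : \forall s \near (0 : R), B r0 (g s).
  have [gc gD _] := gX.
  by apply: (gc 0); rewrite (hom0 gD); exact: nbhs_lball.
have /nbhs_ballP[d' /= d'0 hd'] := gB.
have nearx : \forall n \near U, `|X - (dl n)^-1 *: kappa (x n)| <= 4^-1.
  by move/cvgrPdist_le: xX; apply.
have neard : \forall n \near U, `|dl n| < Num.min (Num.min d d') (8 * C)^-1.
  by apply: (cvgr_norm_lt _ dlc); rewrite normr0 !lt_min d0 d'0 invr_gt0 mulr_gt0.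
have [n [nx nd]] := filter_ex (filterI nearx neard).
move: nd; rewrite (gtr0_norm (dl0 n)) !lt_min => /andP[/andP[nd nd'] ndC].
have [[Tx nK] xB _ xr xmin] := hx n.
have ds : `|- dl n| < d by rewrite normrN gtr0_norm.
have := hd _ ds; rewrite normrN (gtr0_norm (dl0 n)) scaleNr opprK => gk.
have gBn : B r0 (g (- dl n)) by apply: hd'; rewrite -ball_normE /= sub0r opprK gtr0_norm.
have M := lm_mul lm xB gBn.
have gk2 : `|kappa (g (- dl n))| <= 2 * dl n.
  rewrite -(addrK (dl n *: X) (kappa (g (- dl n)))); apply: le_trans (ler_normB _ _) _.
  rewrite normrZ gtr0_norm //.
  have := ler_wpM2l (ltW (dl0 n)) X1; have := dl0 n; lra.
have xk : `|kappa (x n) - dl n *: X| <= 4^-1 * dl n.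
  have E : kappa (x n) - dl n *: X = - (dl n *: (X - (dl n)^-1 *: kappa (x n))).
    by rewrite scalerBr scalerA divff ?gt_eqF // scale1r opprB.
  by rewrite E normrN normrZ gtr0_norm // mulrC ler_pM2r.
have small : `|kappa (x n * g (- dl n))%g| < dl n.
  have E : kappa (x n * g (- dl n))%g =
      (kappa (x n * g (- dl n))%g - kappa (x n) - kappa (g (- dl n)))
      + (kappa (x n) - dl n *: X) + (kappa (g (- dl n)) + dl n *: X).
    by apply/rowP => i; rewrite !mxE; ring.
  rewrite E; apply: le_lt_trans (ler_normD _ _) _.
  apply: le_lt_trans (lerD (ler_normD _ _) (lexx _)) _.
  have CM : C * dl n * `|kappa (g (- dl n))| <= C * dl n * (2 * dl n).
    by rewrite ler_wpM2l // mulr_ge0 // ltW.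
  rewrite -/(dl n) in M.
  have dC : C * dl n <= 8^-1.
    by move: ndC; rewrite invfM ltr_pdivlMr // mulrC => /ltW.
  have := ler_wpM2r (ltW (dl0 n)) dC; have := dl0 n; lra.
have Br : B r (x n * g (- dl n))%g.
  split; first exact: (lm_dom lm xB gBn).
  by apply: lt_trans small _.
by have := xmin _ (Kg _) Br; rewrite leNgt -/(dl n) small.
Qed.

(** The stabilizer of [A] in [T] contains a neighbourhood of 1 in [T], so it is open as well as
    closed, and [T] is connected. *)
Lemma torus_fix A :
  (forall X, lie_of_subgroup S T X -> lie_bracket S X A = 0) ->
  forall t, T t -> Ad S t A = A.
Proof.
move=> hA t Tt; have [r r0 hr] := torus_fix_near hA.
have [T1 TM TV TC [Tc Tconn]] := T_torus.
pose K := [set x | T x /\ Ad S x A = A].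
suff KT : K = T by have [] : K t by rewrite KT.
apply: Tconn.
- by exists 1%g; split; rewrite ?Ad1.
- exists (\bigcup_(k in K) [set x | B r (k^-1 * x)%g]).
    apply: bigcup_open => k _.
    apply: (@open_comp _ _ (fun x => (k^-1 * x)%g)); last exact: lball_open.
    by move=> x _; apply: mulg_cvg; [exact: cvg_cst|exact: cvg_id].
  apply/seteqP; split=> [x [Tx xA]|x [Tx [k [Tk kA] /= kx]]].
    split => //; exists x; first by split.
    by rewrite /= mulVg; exact: lball1.
  split => //; rewrite -(mulVKg k x) AdM hr //.
  by apply: TM => //; exact: TV.
- exists K; first exact: torus_fix_closed.
  by apply/seteqP; split=> [x Kx|x []//]; split => //; case: Kx.
Qed.

Lemma Ad_torus_lie X : lie_of_subgroup S T X -> forall t, T t -> Ad S t X = X.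
Proof.
have [T1 TM TV TC [Tc Tconn]] := T_torus.
move=> /lie_of_subgroupP[g gX Tg] t Tt.
have h := one_param_conj t gX.
have E : (fun s => t * g s * t^-1)%g = g.
  by apply/funext => s; rewrite (TC _ _ Tt (Tg s)) mulgK.
rewrite E in h; have [_ _ [_ e1]] := gX; have [_ _ [_ e2]] := h.
exact: etrans (esym e2) e1.
Qed.

Lemma lie_bracket_torus X Y : lie_of_subgroup S T X -> lie_of_subgroup S T Y ->
  lie_bracket S X Y = 0.
Proof.
move=> /lie_of_subgroupP[g gX Tg] hY.
have h := is_derive_one_param gX (lin_approx_Ad S Y).
have E : (fun x => Ad S x Y) \o g = fun=> Y.
  by apply/funext => s /=; exact: Ad_torus_lie.
rewrite E in h; case: h => _ <-; exact: derive_cst.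
Qed.

Lemma torus_extension g A : compact [set: G] -> one_param S g A ->
  (forall t, T t -> Ad S t A = A) ->
  is_torus (closure [set (p.1 * g p.2)%g | p in T `*` [set: R]]).
Proof.
move=> Gc gA fixA; have [T1 TM TV TC [Tc Tconn]] := T_torus.
have [gc gD _] := gA.
set P := [set _ | _ in _].
have gt s t : T t -> (t * g s = g s * t)%g.
  move=> Tt; have h := one_param_conj t gA; rewrite fixA // in h.
  by rewrite -[in RHS](one_param_unique h gA s) mulgVK.
have PM x y : P x -> P y -> P (x * y)%g.
  move=> [[t s] /= [Tt _] <-] [[t' s'] /= [Tt' _] <-].
  exists ((t * t')%g, s + s'); first by split => //; exact: TM.
  by rewrite /= gD !mulgA -(mulgA t) (gt s t' Tt') !mulgA.
have PV x : P x -> P (x^-1)%g.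
  move=> [[t s] /= [Tt _] <-]; exists ((t^-1)%g, - s); first by split => //; exact: TV.
  by rewrite /= (homN _ gD) -invgM (gt s t Tt).
have PC x y : P x -> P y -> (x * y = y * x)%g.
  move=> [[t s] /= [Tt _] <-] [[t' s'] /= [Tt' _] <-].
  rewrite -!mulgA (mulgA (g s)) -(gt s t') // (mulgA (g s')) -(gt s' t) //.
  by rewrite !mulgA (TC t t') // -!mulgA -!gD addrC.
have P1 : P 1%g by exists (1%g, 0) => //; rewrite /= (hom0 gD) mulg1.
have two (x y : G) (O : set G) : nbhs (x * y)%g O -> closure P x -> closure P y ->
    forall O', nbhs (y * x)%g O' ->
    exists a b, [/\ P a, P b, O (a * b)%g & O' (b * a)%g].
  move=> xyO clx cly O' yxO'.
  have [[A1 B1] /= [xA yB] AB] := @mulg_continuous G (x, y) _ xyO.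
  have [[B2 A2] /= [yB2 xA2] BA] := @mulg_continuous G (y, x) _ yxO'.
  have [a [Pa [a1 a2]]] := clx _ (filterI xA xA2).
  have [b [Pb [b1 b2]]] := cly _ (filterI yB yB2).
  by exists a, b; split => //; [exact: (AB (a, b))|exact: (BA (b, a))].
split.
- exact: subset_closure.
- move=> x y clx cly O xyO.
  have [a [b [Pa Pb Oab _]]] := two _ _ _ xyO clx cly _ (filterT).
  by exists (a * b)%g; split => //; exact: PM.
- move=> x clx O xO.
  have [a [Pa Oa]] := clx _ (@invg_continuous G x _ xO).
  by exists (a^-1)%g; split => //; exact: PV.
- move=> x y clx cly; apply: (lie_hausdorff S) => O O' xyO yxO'.
  have [a [b [Pa Pb Oab Oba]]] := two _ _ _ xyO clx cly _ yxO'.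
  by exists (a * b)%g; split => //; rewrite PC.
split.
  apply: (subclosed_compact (@closed_closure _ _) Gc) => //.
apply: connected_closure.
(* Each curve [t * g s] meets [T] at [s = 0], so [T] together with the curve is connected, and all
   these unions contain 1. *)
have -> : P = \bigcup_(t in T) (T `|` range (fun s => t * g s)%g).
  apply/seteqP; split=> [x [[t s] /= [Tt _] <-]|x [t Tt [Tx|[s _ <-]]]].
  - by exists t => //; right; exists s.
  - by exists (x, 0) => //=; rewrite (hom0 gD) mulg1.
  - by exists (t, s).
apply: bigcup_connected; first by exists 1%g => t _; left.
move=> t Tt; apply: connectedU => //.
  by exists t; split => //; exists 0 => //; rewrite (hom0 gD) mulg1.
apply: connected_continuous_connected; first by apply/connected_intervalP.
apply: continuous_subspaceT => s; apply: mulg_cvg; first exact: cvg_cst.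
exact: gc.
Qed.

(** Such an [A] generates, together with [T], a torus containing [T], which equals [T] by
    maximality. The Lie algebra of a maximal torus is thus its own centralizer. *)
Lemma maximal_torus_lie A : compact [set: G] -> maximal_torus T ->
  (forall X, lie_of_subgroup S T X -> lie_bracket S X A = 0) ->
  lie_of_subgroup S T A.
Proof.
move=> Gc [_ Tmax] hA; have fixA := torus_fix hA.
have [g gA] := exp_exists S A Gc; have [gc gD _] := gA.
have [T1 TM TV TC [Tc Tconn]] := T_torus.
have tor := torus_extension Gc gA fixA.
apply/lie_of_subgroupP; exists g => // s.
rewrite -(Tmax _ tor).
  by apply: subset_closure; exists (1%g, s) => //=; rewrite mul1g.
move=> t Tt; apply: subset_closure; exists (t, 0) => //=.
by rewrite (hom0 gD) mulg1.
Qed.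

End torus.

(** * Bounded representations act semisimply with imaginary spectrum *)

Section bounded_orbits.
Variable R : realType.

Lemma bounded_affine (f : R -> R) (k M : R) :
  (forall s, is_derive s (1 : R) f k) -> (forall s, `|f s| <= M) -> k = 0.
Proof.
move=> df fM.
have cst s : f s - k * s = f 0 - k * 0.
  apply: (@is_derive_0_is_cst _ (fun s => f s - k * s)) => t.
  have d2 : is_derive t (1 : R) (fun s => k * s) k.
    by apply: is_derive_eq; rewrite scaler1.
  by have := is_deriveB (df t) d2; rewrite subrr.
apply: contrapT => /eqP k0.
have := cst ((2 * M + 1) / k); rewrite mulr0 subr0 [k * _]mulrC divfK // => E.
have := fM ((2 * M + 1) / k); have := fM 0; rewrite !ler_norml.
move=> /andP[a1 a2] /andP[b1 b2]; lra.
Qed.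

Lemma bounded_exponential (N : R -> R) (k M : R) :
  (forall s, is_derive s (1 : R) N (k * N s)) -> (forall s, `|N s| <= M) ->
  N 0 != 0 -> k = 0.
Proof.
move=> dN NM N0.
have cst s : N s * expR (- k * s) = N 0 * expR (- k * 0).
  apply: (@is_derive_0_is_cst _ (fun s => N s * expR (- k * s))) => t.
  have d1 : is_derive t (1 : R) (fun s => - k * s) (- k).
    by apply: is_derive_eq; rewrite scaler1.
  have d2 : is_derive t (1 : R) (fun s => expR (- k * s)) (- k * expR (- k * t)).
    by have := is_derive1_comp (is_derive_expR (- k * t)) d1; rewrite mulrC.
  have := is_deriveM (dN t) d2; congr is_derive.
  by rewrite -![_ *: _]/(_ * _); ring.
have M0 : `|N 0| <= M by exact: NM.
have N0' : 0 < `|N 0| by rewrite normr_gt0.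
apply: contrapT => /eqP k0.
(* At this time the exponential factor is [exp (M / |N 0|)], which exceeds [M / |N 0|] and so
   violates the bound. *)
have := cst (M / `|N 0| / k); rewrite mulr0 expR0 mulr1 => E.
have kk : - k * (M / `|N 0| / k) = - (M / `|N 0|) by rewrite mulNr [k * _]mulrC divfK.
have Nle : `|N (M / `|N 0| / k)| <= M by exact: NM.
have : `|N 0| <= M * expR (- (M / `|N 0|)).
  by rewrite -{1}E normrM kk (ger0_norm (expR_ge0 _)) ler_wpM2r // expR_ge0.
rewrite expRN -ler_pdivrMl; last by apply: lt_le_trans M0.
rewrite leNgt => /negP; apply.
rewrite invf_plt ?posrE ?expR_gt0 //; last first.
  by rewrite mulr_gt0 ?invr_gt0 //; apply: lt_le_trans M0.
rewrite invfM invrK; apply: lt_le_trans (expR_ge1Dx _).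
by rewrite ltrDr.
Qed.

(** Take a subspace of largest dimension contained in [P]: a vector satisfying [P] outside it would
    enlarge it. This lets subspaces given by a property be used with the [vspace] formulations of
    irreducibility and dimension. *)
Lemma linear_pred_vspace (K : fieldType) (vT : vectType K) (P : vT -> Prop) :
  P 0 -> (forall a u v, P u -> P v -> P (a *: u + v)) ->
  exists W : {vspace vT}, forall v, v \in W <-> P v.
Proof.
move=> P0 PL.
pose Q n := `[< exists W : {vspace vT}, \dim W = n /\ forall v, v \in W -> P v >].
have Q0 : exists n, Q n.
  exists 0%N; apply/asboolP; exists 0%VS; rewrite dimv0; split => // v.
  by rewrite memv0 => /eqP ->.
have Qb n : Q n -> (n <= \dim (fullv : {vspace vT}))%N.
  by move=> /asboolP[W [<- _]]; rewrite dimvS ?subvf.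
have [n /asboolP[W [Wn WP]] nmax] := ex_maxnP Q0 Qb.
exists W => v; split=> [|Pv]; first exact: WP.
apply: contrapT => /negP vW.
have : Q n.+1.
  apply/asboolP; exists (W + <[v]>)%VS; split.
    rewrite dimv_disjoint_sum ?Wn ?dim_vline; first by rewrite (_ : v != 0) ?addn1 //; apply: contraNneq vW => ->; rewrite mem0v.
    apply/eqP; rewrite -subv0; apply/subvP => u; rewrite memv_cap => /andP[uW /vlineP[a ua]].
    rewrite memv0 ua; have [->|a0] := eqVneq a 0; first by rewrite scale0r.
    by case/negP: vW; rewrite -[v]scale1r -(mulVf a0) -scalerA -ua memvZ.
  move=> u /memv_addP[w wW [x /vlineP[a ->] ->]].
  by rewrite addrC; apply: PL => //; exact: WP.
by move=> /nmax; rewrite ltnn.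
Qed.

End bounded_orbits.

Section bounded_rep.
Context {R : realType} {m : nat} {G : topologicalGroupType}.
Variable S : @lieGroup R m G.

Definition rdot p (x y : 'cV[R]_p) : R := \sum_k x k 0 * y k 0.

Lemma rdotDl p (x y z : 'cV[R]_p) : rdot (x + y) z = rdot x z + rdot y z.
Proof. by rewrite -big_split; apply: eq_bigr => k _; rewrite mxE mulrDl. Qed.

Lemma rdotDr p (x y z : 'cV[R]_p) : rdot z (x + y) = rdot z x + rdot z y.
Proof. by rewrite -big_split; apply: eq_bigr => k _; rewrite mxE mulrDr. Qed.

Lemma rdotZl p a (x z : 'cV[R]_p) : rdot (a *: x) z = a * rdot x z.
Proof. by rewrite mulr_sumr; apply: eq_bigr => k _; rewrite mxE mulrA. Qed.

Lemma rdotZr p a (x z : 'cV[R]_p) : rdot z (a *: x) = a * rdot z x.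
Proof. by rewrite mulr_sumr; apply: eq_bigr => k _; rewrite mxE mulrCA. Qed.

Lemma rdotC p (x y : 'cV[R]_p) : rdot x y = rdot y x.
Proof. by apply: eq_bigr => k _; rewrite mulrC. Qed.

Lemma rdotNl p (x z : 'cV[R]_p) : rdot (- x) z = - rdot x z.
Proof. by rewrite -scaleN1r rdotZl mulN1r. Qed.

Lemma rdotNr p (x z : 'cV[R]_p) : rdot z (- x) = - rdot z x.
Proof. by rewrite -scaleN1r rdotZr mulN1r. Qed.

Lemma rdot_ge0 p (x : 'cV[R]_p) : 0 <= rdot x x.
Proof. by apply: sumr_ge0 => k _; rewrite -expr2 sqr_ge0. Qed.

Lemma rdot_eq0 p (x : 'cV[R]_p) : rdot x x = 0 -> x = 0.
Proof.
move=> /eqP; rewrite psumr_eq0 => [/allP h|k _]; last by rewrite -expr2 sqr_ge0.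
apply/colP => k; rewrite mxE; apply/eqP; rewrite -sqrf_eq0 expr2.
exact: (h k (mem_index_enum k)).
Qed.

Lemma rdot_le p (x y : 'cV[R]_p) : `|rdot x y| <= p%:R * (`|x| * `|y|).
Proof.
apply: le_trans (ler_norm_sum _ _ _) _.
apply: le_trans (ler_sum _ (G := fun=> `|x| * `|y|) _) _.
  by move=> k _; rewrite normrM; apply: ler_pM => //; exact: le_mx_norm.
by rewrite sumr_const card_ord mulr_natl.
Qed.

Lemma is_derive_rdot p (f g : R -> 'cV[R]_p) f' g' s :
  is_derive s (1 : R) f f' -> is_derive s (1 : R) g g' ->
  is_derive s (1 : R) (fun t => rdot (f t) (g t)) (rdot f' (g s) + rdot (f s) g').
Proof.
move=> df dg; rewrite /rdot -big_split /=.
have -> : (fun t => \sum_k f t k 0 * g t k 0) = \sum_k (fun t => f t k 0 * g t k 0).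
  by apply/funext => t; rewrite fct_sumE.
apply: is_derive_sum => k.
have := is_deriveM (is_derive_coord k 0 df) (is_derive_coord k 0 dg).
congr is_derive; rewrite -![_ *: _]/(_ * _) addrC; congr (_ + _).
by rewrite mulrC.
Qed.

Variables (p : nat) (Phi : G -> 'M[R]_p) (g : R -> G) (X : 'rV[R]_m) (M : R).
Hypotheses (PhiR : real_rep Phi) (gX : one_param S g X) (PhiM : forall x, `|Phi x| <= M).

Local Notation A := (drep S Phi X).
Local Notation F s := (Phi (g s)).

Lemma bounded_orbit (w : 'cV[R]_p) s : `|F s *m w| <= p%:R * M * `|w|.
Proof.
apply: le_trans (mulmx_norm_le _ _) _.
by rewrite ler_wpM2r // ler_wpM2l.
Qed.

Lemma F0 (w : 'cV[R]_p) : F 0 *m w = w.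
Proof. by have [_ gD _] := gX; have [_ Phi1 _] := PhiR; rewrite (hom0 gD) Phi1 mul1mx. Qed.

(* [w1 + i w2] is an eigenvector for [a + i b]. *)
Lemma bounded_rep_eigenvalue (w1 w2 : 'cV[R]_p) (a b : R) :
  A *m w1 = a *: w1 - b *: w2 -> A *m w2 = b *: w1 + a *: w2 ->
  rdot w1 w1 + rdot w2 w2 != 0 -> a = 0.
Proof.
move=> E1 E2 w0.
pose N s := rdot (F s *m w1) (F s *m w1) + rdot (F s *m w2) (F s *m w2).
suff : 2 * a = 0 by lra.
apply: (@bounded_exponential _ N _
  (p%:R * ((p%:R * M * `|w1|) * (p%:R * M * `|w1|)) + p%:R * ((p%:R * M * `|w2|) * (p%:R * M * `|w2|)))).
- move=> s.
  have d1 := rep_vec_derive w1 s PhiR gX; have d2 := rep_vec_derive w2 s PhiR gX.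
  have := is_deriveD (is_derive_rdot d1 d1) (is_derive_rdot d2 d2).
  congr is_derive; rewrite E1 E2 !(mulmxDr, mulmxN) -!scalemxAr /N.
  rewrite !(rdotDl, rdotDr, rdotNl, rdotNr, rdotZl, rdotZr).
  rewrite (rdotC (F s *m w2) (F s *m w1)); ring.
- move=> s; apply: le_trans (ler_normD _ _) _; apply: lerD;
    apply: le_trans (rdot_le _ _) _; rewrite ler_wpM2l // ler_pM // bounded_orbit //.
- by rewrite /N !F0.
Qed.

(** Here [v1 + i v2] is a generalized eigenvector over the eigenvector [w1 + i w2] with eigenvalue
    [i b]. The real pairing of their orbits has derivative [N s], which is constant in [s]; the
    pairing is bounded, so this constant is 0. Boundedness of orbits does the work of an invariant
    inner product. *)
Lemma bounded_rep_semisimple (v1 v2 w1 w2 : 'cV[R]_p) (b : R) :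
  A *m w1 = - (b *: w2) -> A *m w2 = b *: w1 ->
  A *m v1 = - (b *: v2) + w1 -> A *m v2 = b *: v1 + w2 ->
  rdot w1 w1 + rdot w2 w2 = 0.
Proof.
move=> E1 E2 D1 D2.
pose N s := rdot (F s *m w1) (F s *m w1) + rdot (F s *m w2) (F s *m w2).
have dw1 s := rep_vec_derive w1 s PhiR gX; have dw2 s := rep_vec_derive w2 s PhiR gX.
have dv1 s := rep_vec_derive v1 s PhiR gX; have dv2 s := rep_vec_derive v2 s PhiR gX.
have Ncst s : N s = rdot w1 w1 + rdot w2 w2.
  transitivity (N 0); last by rewrite /N !F0.
  apply: (@is_derive_0_is_cst _ N) => t.
  have := is_deriveD (is_derive_rdot (dw1 t) (dw1 t)) (is_derive_rdot (dw2 t) (dw2 t)).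
  congr is_derive; rewrite E1 E2 !(mulmxDr, mulmxN) -!scalemxAr.
  rewrite !(rdotDl, rdotDr, rdotNl, rdotNr, rdotZl, rdotZr).
  rewrite (rdotC (F t *m w2) (F t *m w1)); ring.
apply: (@bounded_affine _ (fun s => rdot (F s *m v1) (F s *m w1) + rdot (F s *m v2) (F s *m w2)) _
  (p%:R * ((p%:R * M * `|v1|) * (p%:R * M * `|w1|)) + p%:R * ((p%:R * M * `|v2|) * (p%:R * M * `|w2|)))).
- move=> s.
  have := is_deriveD (is_derive_rdot (dv1 s) (dw1 s)) (is_derive_rdot (dv2 s) (dw2 s)).
  congr is_derive; rewrite -(Ncst s) /N E1 E2 D1 D2 !(mulmxDr, mulmxN) -!scalemxAr.
  rewrite !(rdotDl, rdotDr, rdotNl, rdotNr, rdotZl, rdotZr); ring.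
- move=> s; apply: le_trans (ler_normD _ _) _; apply: lerD;
    apply: le_trans (rdot_le _ _) _; rewrite ler_wpM2l // ler_pM // bounded_orbit //.
Qed.

End bounded_rep.

Section complex_matrices.
Context {R : realType}.
Local Notation C := R[i].
Local Notation rcm := (map_mx (real_complex R)).
Local Open Scope complex_scope.

Definition cmx a b (A B : 'M[R]_(a, b)) : 'M[C]_(a, b) := \matrix_(i, j) (A i j +i* B i j).

Definition remx a b (A : 'M[C]_(a, b)) : 'M[R]_(a, b) := \matrix_(i, j) complex.Re (A i j).

Definition immx a b (A : 'M[C]_(a, b)) : 'M[R]_(a, b) := \matrix_(i, j) complex.Im (A i j).

Lemma cmxK a b (A : 'M[C]_(a, b)) : cmx (remx A) (immx A) = A.
Proof. by apply/matrixP => i j; rewrite !mxE; case: (A i j). Qed.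

Lemma remx_cmx a b (A B : 'M[R]_(a, b)) : remx (cmx A B) = A.
Proof. by apply/matrixP => i j; rewrite !mxE. Qed.

Lemma immx_cmx a b (A B : 'M[R]_(a, b)) : immx (cmx A B) = B.
Proof. by apply/matrixP => i j; rewrite !mxE. Qed.

Lemma cmxE a b (A B : 'M[R]_(a, b)) : cmx A B = rcm A + 'i *: rcm B.
Proof. by apply/matrixP => i j; rewrite !mxE; simpc. Qed.

Lemma rcmE a b (A : 'M[R]_(a, b)) : rcm A = cmx A 0.
Proof. by apply/matrixP => i j; rewrite !mxE. Qed.

Lemma cmx0 a b : cmx 0 0 = 0 :> 'M[C]_(a, b).
Proof. by apply/matrixP => i j; rewrite !mxE. Qed.

Lemma cmxD a b (A B A' B' : 'M[R]_(a, b)) : cmx A B + cmx A' B' = cmx (A + A') (B + B').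
Proof. by apply/matrixP => i j; rewrite !mxE; simpc. Qed.

Lemma cmxZ a b x y (A B : 'M[R]_(a, b)) :
  (x +i* y) *: cmx A B = cmx (x *: A - y *: B) (x *: B + y *: A).
Proof. by apply/matrixP => i j; rewrite !mxE; simpc. Qed.

Lemma cmxM a b c (A B : 'M[R]_(a, b)) (A' B' : 'M[R]_(b, c)) :
  cmx A B *m cmx A' B' = cmx (A *m A' - B *m B') (A *m B' + B *m A').
Proof.
rewrite !cmxE mulmxDl !mulmxDr -!scalemxAl -!scalemxAr scalerA -expr2 sqr_i scaleN1r.
rewrite map_mxB map_mxD !map_mxM /= scalerDr.
by apply/matrixP => i j; rewrite !mxE; ring.
Qed.

Lemma trmx_cmx a b (A B : 'M[R]_(a, b)) : (cmx A B)^T = cmx A^T B^T.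
Proof. by apply/matrixP => i j; rewrite !mxE. Qed.

End complex_matrices.

Section bounded_rep_diagonal.
Context {R : realType} {m : nat} {G : topologicalGroupType}.
Variable S : @lieGroup R m G.
Variables (p : nat) (Phi : G -> 'M[R]_p) (g : R -> G) (X : 'rV[R]_m) (M : R).
Hypotheses (PhiR : real_rep Phi) (gX : one_param S g X) (PhiM : forall x, `|Phi x| <= M).
Local Notation C := R[i].

Local Notation A := (drep S Phi X).
Local Notation N := (map_mx (real_complex R) A)^T.
Local Open Scope complex_scope.

Lemma cmx_mul_trmx (u v : 'rV[R]_p) : cmx u v *m N = cmx (A *m u^T)^T (A *m v^T)^T.
Proof.
rewrite rcmE trmx_cmx cmxM trmx0 !mulmx0 subr0 add0r.
by rewrite !trmx_mul !trmxK.
Qed.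

Lemma cmx_inj a b (A1 B1 A2 B2 : 'M[R]_(a, b)) : cmx A1 B1 = cmx A2 B2 -> A1 = A2 /\ B1 = B2.
Proof.
by move=> E; split; [rewrite -(remx_cmx A1 B1) E remx_cmx|rewrite -(immx_cmx A1 B1) E immx_cmx].
Qed.

Lemma bounded_rep_imaginary (v : 'rV[C]_p) (z : C) :
  v *m N = z *: v -> v != 0 -> complex.Re z = 0.
Proof.
rewrite -{1 2}(cmxK v); case: z => a b /=.
rewrite cmx_mul_trmx cmxZ => /cmx_inj[E1 E2] v0.
apply: (bounded_rep_eigenvalue (w1 := (remx v)^T) (w2 := (immx v)^T) (b := b) PhiR gX PhiM).
- by apply: trmx_inj; rewrite E1 linearB !linearZ /= !trmxK.
- by apply: trmx_inj; rewrite E2 linearD !linearZ /= !trmxK addrC.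
apply: contra_neq v0 => E.
have h1 := rdot_ge0 (remx v)^T; have h2 := rdot_ge0 (immx v)^T.
rewrite -(cmxK v).
have /rdot_eq0/(congr1 trmx) : rdot (remx v)^T (remx v)^T = 0 by lra.
have /rdot_eq0/(congr1 trmx) : rdot (immx v)^T (immx v)^T = 0 by lra.
by rewrite !trmxK !trmx0 => -> ->; rewrite cmx0.
Qed.

Lemma bounded_rep_nilpotent (v : 'rV[C]_p) (z : C) :
  v *m (N - z%:M) *m (N - z%:M) = 0 -> v *m (N - z%:M) = 0.
Proof.
set w := v *m _; rewrite mulmxBr mul_mx_scalar => /eqP; rewrite subr_eq0 => /eqP wz.
apply/eqP; apply: contraT => w0.
have z0 := bounded_rep_imaginary wz w0.
case: z => a b in w wz w0 z0 *; rewrite /= in z0.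
have vE : v *m N = w + (a +i* b) *: v by rewrite /w mulmxBr mul_mx_scalar subrK.
subst a; move: (wz) (vE) w0; rewrite -{1 2}(cmxK v) -(cmxK w) !cmx_mul_trmx !cmxZ cmxD.
move=> /cmx_inj[E1 E2] /cmx_inj[E3 E4].
rewrite !scale0r !add0r in E1 E2 E3 E4.
have E : rdot (remx w)^T (remx w)^T + rdot (immx w)^T (immx w)^T = 0.
  apply: (bounded_rep_semisimple (v1 := (remx v)^T) (v2 := (immx v)^T)
    (w1 := (remx w)^T) (w2 := (immx w)^T) (b := b) PhiR gX PhiM);
  apply: trmx_inj; rewrite ?E1 ?E2 ?E3 ?E4 ?linearD ?linearN /= ?linearZ /= ?trmxK //.
  - by rewrite addrC.
  - by rewrite addrC.
have h1 := rdot_ge0 (remx w)^T; have h2 := rdot_ge0 (immx w)^T.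
have /rdot_eq0/(congr1 trmx) : rdot (remx w)^T (remx w)^T = 0 by lra.
have /rdot_eq0/(congr1 trmx) : rdot (immx w)^T (immx w)^T = 0 by lra.
by rewrite !trmxK !trmx0 => -> ->; rewrite cmx0 eqxx.
Qed.

End bounded_rep_diagonal.

(** If a root [z] of the minimal polynomial were repeated, the hypothesis would allow one factor
    ['X - z%:P] to be dropped, against minimality. A split minimal polynomial with simple roots
    gives diagonalizability. *)
Lemma semisimple_diagonalizable (F : closedFieldType) p (N : 'M[F]_p) :
  (forall (v : 'rV_p) z, v *m (N - z%:M) *m (N - z%:M) = 0 -> v *m (N - z%:M) = 0) ->
  diagonalizable N.
Proof.
case: p N => [|p] N hN; first by rewrite (flatmx0 N); exact: diagonalizable0.
apply/diagonalizableP.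
have [rs E] := closed_field_poly_normal (mxminpoly N).
rewrite (monicP (mxminpoly_monic N)) scale1r in E.
exists rs; last by rewrite E dvdpp.
apply: count_mem_uniq => z; apply/eqP; case: (boolP (z \in rs)) => [zrs|/count_memPn -> //].
have P1 := perm_to_rem zrs.
case: (boolP (z \in rem z rs)) => [zr2|/count_memPn z0]; last first.
  by rewrite (permP P1) /= z0 eqxx.
have P2 := perm_to_rem zr2; exfalso.
pose q := \prod_(x <- rem z (rem z rs)) ('X - x%:P).
have qE : mxminpoly N = q * ('X - z%:P) * ('X - z%:P).
  by rewrite E (perm_big _ P1) big_cons (perm_big _ P2) big_cons /= -/q mulrC; congr (_ * _); rewrite mulrC.
have NE : horner_mx N ('X - z%:P) = N - z%:M by rewrite rmorphB /= horner_mx_X horner_mx_C.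
have q0 : horner_mx N (q * ('X - z%:P)) = 0.
  apply/row_matrixP => i; rewrite row0 rmorphM /= NE -mulmxE row_mul; apply: hN.
  rewrite -!row_mul -NE !mulmxE -!rmorphM /= -qE.
  by rewrite (mx_root_minpoly N) row0.
have := mxminpoly_min q0; rewrite qE => /dvdp_leq.
have qm : q * ('X - z%:P) \is monic by rewrite monicMr ?monicXsubC ?monic_prod_XsubC.
rewrite size_Mmonic ?monicXsubC ?monic_neq0 // size_XsubC addn2 /= ltnn.
by move=> /(_ isT).
Qed.

(** * Root decomposition of the complexified Lie algebra *)

Section root_decomposition.
Context {R : realType} {m : nat} {G : topologicalGroupType}.
Variable S : @lieGroup R m G.
Variables (T : set G) (X0 : 'rV[R]_m).
Hypotheses (G_compact : compact [set: G]) (T_maximal : maximal_torus T).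
Hypothesis X0_regular : regular_element S T X0.
Local Notation C := R[i].
Local Notation V := 'rV[R]_m.
Local Notation ad X := (map_mx (real_complex R) (drep S (Admx S) X))^T.
Local Open Scope complex_scope.

Lemma compact_rep_bounded p (Phi : G -> 'M[R]_p) : real_rep Phi ->
  exists M, forall x, `|Phi x| <= M.
Proof.
move=> PhiR.
have /compact_bounded [M [_ hM]] : compact (Phi @` [set: G]).
  apply: continuous_compact => //; apply: continuous_subspaceT => x.
  exact: real_rep_continuous.
by exists (M + 1) => x; apply: (hM (M + 1)); [rewrite ltrDl|exists x].
Qed.

Lemma cmx_mul_ad A B X : cmx A B *m ad X = cmx (lie_bracket S X A) (lie_bracket S X B).
Proof. by rewrite cmx_mul_trmx !lie_bracketE. Qed.

(** It is not evident from one-parameter groups that sums of their velocities are again velocities;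
    linearity becomes immediate once this Lie algebra is known to be its own centralizer. *)
Lemma torus_lie_vspace : exists W : {vspace V}, forall X, X \in W <-> lie_of_subgroup S T X.
Proof.
have T_torus := T_maximal.1.
apply: linear_pred_vspace => [|a u v hu hv]; apply: (maximal_torus_lie T_torus) => // X hX.
- by rewrite lie_bracketE trmx0 mulmx0 trmx0.
- rewrite lie_bracketE linearD linearZ /= mulmxDr -scalemxAr linearD linearZ /=.
  by rewrite -!lie_bracketE !(lie_bracket_torus T_torus hX) // scaler0 addr0.
Qed.

(** The operators [ad X], for [X] in a basis of the Lie algebra of [T], commute and are
    diagonalizable, so they have a common eigenbasis; their eigenvalues are imaginary, as
    [in_root_space] demands. Here [alpha] may vanish on the Lie algebra of [T]. *)
Lemma torus_root_basis : exists P : 'M[C]_m, P \in unitmx /\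
  forall i, exists alpha, in_root_space S T alpha (remx (row i P)) (immx (row i P)).
Proof.
have T_torus := T_maximal.1.
have [W WP] := torus_lie_vspace.
have [M AdM] := compact_rep_bounded (Admx_rep S).
pose As := [seq ad X | X <- vbasis W].
have imag X (v : 'rV[C]_m) (z : C) : v *m ad X = z *: v -> v != 0 -> complex.Re z = 0.
  have [g gX] := exp_exists S X G_compact.
  exact: (bounded_rep_imaginary (Admx_rep S) gX AdM).
have [P Pu /allP /= PA] : codiagonalizable As.
  apply/codiagonalizableP; split.
    move=> A B /mapP[X /vbasis_mem /WP hX ->] /mapP[Y /vbasis_mem /WP hY ->].
    have := drep_bracket S X Y (Admx_rep S).
    rewrite (lie_bracket_torus T_torus hX hY).
    have -> : drep S (Admx S) 0 = 0 by exact: linear_map0 (drep_linear S (Admx_rep S)).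
    move=> /esym/eqP; rewrite subr_eq0 => /eqP.
    move: (drep S (Admx S) X) (drep S (Admx S) Y) => a b E.
    by rewrite /comm_mx -[LHS]trmx_mul -[RHS]trmx_mul -2!map_mxM E.
  move=> A /mapP[X _ ->]; apply: semisimple_diagonalizable => v z.
  have [g gX] := exp_exists S X G_compact.
  exact: (bounded_rep_nilpotent (Admx_rep S) gX AdM).
exists P; split => // i.
have row0 : row i P != 0.
  apply: contraTneq Pu => E; rewrite unitmxE (expand_det_row _ i).
  rewrite big1 ?unitr0 // => j _.
  by have /rowP/(_ j) := E; rewrite !mxE => ->; rewrite mul0r.
have eigen X : lie_of_subgroup S T X -> exists z, row i P *m ad X = z *: row i P.
  move=> /WP XW; rewrite (coord_vbasis XW).
  have [N NE] : exists N : V -> 'M[C]_m, forall Y, ad Y = N Y by exists (fun Y => ad Y).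
  have adD (a : R) Y Z : N (a *: Y + Z) = a%:C *: N Y + N Z.
    by rewrite -!NE (drep_linear S (Admx_rep S)) map_mxD map_mxZ linearD linearZ.
  have ad0 : N 0 = 0.
    rewrite -NE (_ : drep S (Admx S) 0 = 0) ?map_mx0 ?trmx0 //.
    exact: linear_map0 (drep_linear S (Admx_rep S)).
  rewrite NE.
  elim/big_ind: _ => [|Y Z [y hy] [z hz]|j _].
  - by exists 0; rewrite ad0 mulmx0 scale0r.
  - exists (y + z); have := adD 1 Y Z; rewrite scale1r => ->.
    by rewrite mulmxDr -scalemxAr hy hz scalerDl rmorph1 scale1r.
  - have /PA/diagonalizable_forPex[D /(simmxP Pu) E] : ad (vbasis W)`_j \in As.
      by apply: map_f; apply: mem_nth; rewrite size_tuple.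
    exists ((coord (vbasis W) j X)%:C * D 0 i).
    have := adD (coord (vbasis W) j X) (vbasis W)`_j 0; rewrite ad0 !addr0 => ->.
    rewrite -scalemxAr -NE -row_mul E -scalerA; congr (_ *: _).
    by apply/rowP => k; rewrite mul_diag_mx !mxE.
have [f fP] : {f : V -> C & forall X, lie_of_subgroup S T X ->
    row i P *m ad X = f X *: row i P}.
  suff /boolp.choice : forall X, exists z, lie_of_subgroup S T X -> row i P *m ad X = z *: row i P by [].
  move=> X; have [/eigen[z zP]|nX] := pselect (lie_of_subgroup S T X).
    by exists z.
  by exists 0 => /nX.
exists (fun X => complex.Im (f X)) => X /fP; move: (f X) => z zP.
have z0 := imag _ _ _ zP row0; case: z => a b in zP z0 *; rewrite /= in z0 *.
subst a; move: zP; rewrite -{1 2}(cmxK (row i P)) cmx_mul_ad cmxZ.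
by rewrite !scale0r !add0r => /cmx_inj.
Qed.

(** Each vector of the common eigenbasis is a positive root vector, the conjugate of one, or of
    weight zero. In the last case its real and imaginary parts centralize the Lie algebra of [T] and
    therefore belong to it. The statement has the form of an induction principle for predicates
    stable under linear combinations. *)
Lemma root_decomposition (P : 'rV[C]_m -> Prop) :
  P 0 -> (forall a u v, P u -> P v -> P (a *: u + v)) ->
  (forall alpha A B, positive_root S T X0 alpha -> in_root_space S T alpha A B ->
     P (cmx A B)) ->
  (forall alpha A B, positive_root S T X0 alpha -> in_root_space S T alpha A B ->
     P (cmx A (- B))) ->
  (forall X, lie_of_subgroup S T X -> P (cmx X 0)) ->
  forall Z, P Z.
Proof.
move=> P0 PL Ppos Pneg Ptor Z.
have T_torus := T_maximal.1.
have [Q [Qu Qroot]] := torus_root_basis.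
have Prow i : P (row i Q).
  have [alpha root] := Qroot i; rewrite -(cmxK (row i Q)).
  set A := remx _ in root *; set B := immx _ in root *.
  have [nz|z] := pselect (exists2 X, lie_of_subgroup S T X & alpha X != 0).
    have [E|AB0] := eqVneq (A, B) (0, 0).
      by case: E => -> ->; rewrite cmx0.
    have isr : is_root S T alpha by split => //; exists A, B.
    have := X0_regular.2 _ isr; rewrite neq_lt => /orP[lt0|gt0]; last first.
      by apply: (Ppos alpha).
    (* Conjugating a root vector for [alpha] gives one for the opposite root, which is positive when
       [alpha X0 < 0]. *)
    rewrite -(opprK B); apply: (Pneg (fun X => - alpha X)).
      split; last by rewrite oppr_gt0.
      split; first by have [X hX aX] := nz; exists X => //; rewrite oppr_eq0.
      exists A, (- B); split; last first.
        apply: contra_neq AB0 => -[-> /eqP]; rewrite oppr_eq0 => /eqP -> //.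
      move=> X hX; have [h1 h2] := root _ hX.
      rewrite h1 scaleNr scalerN opprK; split => //.
      by rewrite lie_bracketE linearN /= mulmxN linearN /= -lie_bracketE h2 scaleNr.
    move=> X hX; have [h1 h2] := root _ hX.
    rewrite h1 scaleNr scalerN opprK; split => //.
    by rewrite lie_bracketE linearN /= mulmxN linearN /= -lie_bracketE h2 scaleNr.
  have al0 X : lie_of_subgroup S T X -> alpha X = 0.
    by move=> hX; apply: contrapT => /eqP h; apply: z; exists X.
  have hA : lie_of_subgroup S T A.
    apply: (maximal_torus_lie T_torus) => // X hX.
    by have [-> _] := root _ hX; rewrite al0 // scale0r oppr0.
  have hB : lie_of_subgroup S T B.
    apply: (maximal_torus_lie T_torus) => // X hX.
    by have [_ ->] := root _ hX; rewrite al0 // scale0r.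
  have -> : cmx A B = 'i *: cmx B 0 + cmx A 0.
    by apply/matrixP => k l; rewrite !mxE; simpc.
  by apply: PL; exact: Ptor.
rewrite -(mulmxKV Qu Z) mulmx_sum_row.
elim/big_ind: _ => [//|u v hu hv|i _]; first by have := PL 1 u v hu hv; rewrite scale1r.
by have := PL ((Z *m invmx Q) 0 i) _ _ (Prow i) P0; rewrite addr0.
Qed.

End root_decomposition.

(** * Complex and unitary representations *)

Section realification.
Context {R : realType}.
Local Notation C := R[i].
Local Open Scope complex_scope.

(** The real matrix of a complex linear map. It is injective and multiplicative, so results on
    differentials of real representations carry over to complex ones. *)
Definition rl a b (M : 'M[C]_(a, b)) : 'M[R]_(a + a, b + b) :=
  block_mx (remx M) (- immx M) (immx M) (remx M).

Lemma rl_cmx a b (A B : 'M[R]_(a, b)) : rl (cmx A B) = block_mx A (- B) B A.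
Proof. by rewrite /rl remx_cmx immx_cmx. Qed.

Lemma rlM a b c (A : 'M[C]_(a, b)) (B : 'M[C]_(b, c)) : rl (A *m B) = rl A *m rl B.
Proof.
rewrite -(cmxK A) -(cmxK B) cmxM !rl_cmx mulmx_block !mulNmx !mulmxN opprD.
by rewrite [remx A *m immx B + _]addrC [- (immx A *m immx B) + _]addrC [- _ - _]addrC.
Qed.

Lemma rl1 a : rl 1%:M = 1%:M :> 'M[R]_(a + a).
Proof.
rewrite [RHS]scalar_mx_block /rl.
have -> : remx 1%:M = 1%:M :> 'M[R]_a.
  by apply/matrixP => i j; rewrite !mxE; case: eqP.
have -> : immx 1%:M = 0 :> 'M[R]_a.
  by apply/matrixP => i j; rewrite !mxE; case: eqP.
by rewrite oppr0.
Qed.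

Lemma rl_inj a b : injective (@rl a b).
Proof.
by move=> A B /eq_block_mx[E1 _ E2 _]; rewrite -(cmxK A) -(cmxK B) E1 E2.
Qed.

Lemma rl0 a b : rl 0 = 0 :> 'M[R]_(a + a, b + b).
Proof. by rewrite -cmx0 rl_cmx oppr0 block_mx0. Qed.

Lemma rlZ a b (x : R) (A B : 'M[C]_(a, b)) : rl (x%:C *: A + B) = x *: rl A + rl B.
Proof.
rewrite -(cmxK A) -(cmxK B) cmxZ cmxD !rl_cmx scale_block_mx add_block_mx.
by rewrite !scale0r subr0 addr0 opprD scalerN.
Qed.

Lemma rlB a b (A B : 'M[C]_(a, b)) : rl (A - B) = rl A - rl B.
Proof.
by have := rlZ (-1) B A; rewrite rmorphN rmorph1 !scaleN1r ![- _ + _]addrC.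
Qed.

Lemma rl_norm_le a b (A : 'M[C]_(a, b)) (e : R) : 0 <= e ->
  (forall i j, `|complex.Re (A i j)| <= e /\ `|complex.Im (A i j)| <= e) -> `|rl A| <= e.
Proof.
move=> e0 h; apply: mx_norm_le => // i j; rewrite -(fintype.splitK i) -(fintype.splitK j) /rl.
case: (fintype.split i) => i'; case: (fintype.split j) => j' /=;
  rewrite ?(block_mxEul, block_mxEur, block_mxEdl, block_mxEdr) !mxE ?normrN; by case: (h i' j').
Qed.

End realification.

Section complex_rep.
Context {R : realType} {m : nat} {G : topologicalGroupType}.
Variable S : @lieGroup R m G.
Local Notation C := R[i].
Local Notation V := 'rV[R]_m.
Local Open Scope complex_scope.

Definition complex_rep d (U : G -> 'M[C]_d) : Prop :=
  [/\ forall x y, U (x * y)%g = U x *m U y, U 1%g = 1%:M &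
      forall j k, continuousC (fun x => U x j k)].

Section one_rep.
Variables (d : nat) (U : G -> 'M[C]_d).
Hypothesis U_rep : complex_rep U.

Lemma rl_rep : real_rep (fun x => rl (U x)).
Proof.
have [UM U1 Uc] := U_rep; split => [x y||]; first by rewrite UM rlM.
  by rewrite U1 rl1.
apply/cvgrPdist_le => e e0.
have h j : \forall x \near (1%g : G), forall k,
    `|complex.Re (U x j k - U 1%g j k)| <= e /\ `|complex.Im (U x j k - U 1%g j k)| <= e.
  apply: filter_forall => k; have [cR cI] := Uc j k.
  have /cvgrPdist_le/(_ _ e0) h1 := cR (1%g : G).
  have /cvgrPdist_le/(_ _ e0) h2 := cI (1%g : G).
  move: h1 h2; apply: filterS2 => x; rewrite !raddfB /= => h1 h2.
  by split; rewrite distrC.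
apply: filterS (@filter_forall _ _ _ _ _ h) => x {}h.
rewrite distrC -rl1 -U1 -rlB.
apply: rl_norm_le => [|i j]; first exact: ltW.
by rewrite !mxE; exact: h.
Qed.

Lemma drep_rl_is_derive X i j : is_derive (cmap (lie_chart S) 1%g) X
  (fun v => rl (U (cinv (lie_chart S) v)) i j) (drep S (fun x => rl (U x)) X i j).
Proof.
exact: is_derive_coord (is_derive_lin_approx X (drep_lin_approx S rl_rep)).
Qed.

Lemma rl_ll a b (A : 'M[C]_(a, b)) i j : rl A (lshift a i) (lshift b j) = complex.Re (A i j).
Proof. by rewrite /rl block_mxEul mxE. Qed.

Lemma rl_rl a b (A : 'M[C]_(a, b)) i j : rl A (rshift a i) (lshift b j) = complex.Im (A i j).
Proof. by rewrite /rl block_mxEdl mxE. Qed.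

Lemma rl_lr a b (A : 'M[C]_(a, b)) i j : rl A (lshift a i) (rshift b j) = - complex.Im (A i j).
Proof. by rewrite /rl block_mxEur !mxE. Qed.

Lemma rl_rr a b (A : 'M[C]_(a, b)) i j : rl A (rshift a i) (rshift b j) = complex.Re (A i j).
Proof. by rewrite /rl block_mxEdr !mxE. Qed.

Lemma dU_Re X j k : is_derive (cmap (lie_chart S) 1%g) X
  (fun v => complex.Re (U (cinv (lie_chart S) v) j k)) (complex.Re (dU S U X j k)).
Proof.
have := drep_rl_is_derive X (lshift d j) (lshift d k).
under [X in is_derive _ _ X _]eq_fun do rewrite rl_ll.
by move=> h; rewrite mxE /= derive_val.
Qed.

Lemma dU_Im X j k : is_derive (cmap (lie_chart S) 1%g) X
  (fun v => complex.Im (U (cinv (lie_chart S) v) j k)) (complex.Im (dU S U X j k)).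
Proof.
have := drep_rl_is_derive X (rshift d j) (lshift d k).
under [X in is_derive _ _ X _]eq_fun do rewrite rl_rl.
by move=> h; rewrite mxE /= derive_val.
Qed.

Lemma is_derive_unique (W W' : normedModType R) (f : W -> W') a v (d1 d2 : W') :
  is_derive a v f d1 -> is_derive a v f d2 -> d1 = d2.
Proof. by move=> h1 h2; rewrite -(@derive_val _ _ _ _ _ _ _ h1) (@derive_val _ _ _ _ _ _ _ h2). Qed.

Lemma drep_rl X : drep S (fun x => rl (U x)) X = rl (dU S U X).
Proof.
apply/matrixP => i j; rewrite -(fintype.splitK i) -(fintype.splitK j).
case: (fintype.split i) => i'; case: (fintype.split j) => j' /=;
  (apply: is_derive_unique; first exact: drep_rl_is_derive); rewrite ?(rl_ll, rl_rl, rl_lr, rl_rr).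
- by under eq_fun do rewrite rl_ll; exact: dU_Re.
- by under eq_fun do rewrite rl_lr; apply: is_deriveN; exact: dU_Im.
- by under eq_fun do rewrite rl_rl; exact: dU_Im.
- by under eq_fun do rewrite rl_rr; exact: dU_Re.
Qed.

#[global] Opaque dU.

Lemma dU_linear (a : R) X Y : dU S U (a *: X + Y) = a%:C *: dU S U X + dU S U Y.
Proof. by apply: rl_inj; rewrite rlZ -!drep_rl (drep_linear S rl_rep). Qed.

Lemma dU_bracket X Y :
  dU S U (lie_bracket S X Y) = dU S U X *m dU S U Y - dU S U Y *m dU S U X.
Proof. by apply: rl_inj; rewrite rlB !rlM; have := drep_bracket S X Y rl_rep; rewrite !drep_rl. Qed.

Lemma dU_Ad x X : dU S U (Ad S x X) = U x *m dU S U X *m U (x^-1)%g.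
Proof. by apply: rl_inj; rewrite !rlM -!drep_rl (drep_Ad S rl_rep). Qed.

Lemma complex_words_vanish a b (A : 'M[C]_(a, d)) (B : 'M[C]_(d, b)) :
  connected [set: G] ->
  (forall s, A *m word_mx (dU S U) s *m B = 0) -> forall x, A *m U x *m B = 0.
Proof.
move=> Gc h x; apply: rl_inj; rewrite !rlM rl0.
apply: (rep_words_vanish (S := S) rl_rep) => // s.
have -> : word_mx (drep S (fun x => rl (U x))) s = rl (word_mx (dU S U) s).
  by elim: s => [|X s IH]; rewrite /= ?rl1 // IH drep_rl rlM.
by rewrite -!rlM h rl0.
Qed.

End one_rep.
End complex_rep.

#[global] Opaque cmx.

Section unitary.
Local Open Scope complex_scope.
Local Open Scope sesquilinear_scope.
Context {R : realType} {m : nat} {G : topologicalGroupType}.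
Variable S : @lieGroup R m G.
Local Notation C := R[i].
Local Notation V := 'rV[R]_m.

Lemma unitary_complex_rep d (U : G -> 'M[C]_d) : unitary_rep U -> complex_rep U.
Proof.
move=> [UM Uu Uc]; split => //.
have := UM 1%g 1%g; rewrite mulg1 => E.
have u1 := unitarymx_unit (Uu 1%g).
by rewrite -[LHS](mulKmx u1) -E mulVmx.
Qed.

Lemma unitary_repV d (U : G -> 'M[C]_d) x : unitary_rep U -> U (x^-1)%g = (U x)^t*.
Proof.
move=> UU; have [UM U1 _] := unitary_complex_rep UU; have [_ Uu _] := UU.
rewrite -(invmx_unitary (Uu x)).
have : U x *m U (x^-1)%g = 1%:M by rewrite -UM mulgV U1.
by move=> E; rewrite -[LHS](mulKmx (unitarymx_unit (Uu x))) E mulmx1.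
Qed.

Lemma rl_adj a b (A : 'M[C]_(a, b)) : rl (A^t*) = (rl A)^T.
Proof.
rewrite /rl tr_block_mx; congr block_mx; apply/matrixP => i j; rewrite !mxE;
  by case: (A j i) => x y /=; rewrite ?opprK.
Qed.

Lemma dU_skew d (U : G -> 'M[C]_d) X : unitary_rep U -> (dU S U X)^t* = - dU S U X.
Proof.
move=> UU; have UC := unitary_complex_rep UU; have [UM U1 _] := UC.
have PR := rl_rep UC; have h := drep_lin_approx S PR.
have Tl : linear_map (@trmx R (d + d) (d + d)) by move=> a u v; rewrite linearP.
have Tn (A : 'M[R]_(d + d)) : `|A^T| <= 1 * `|A|.
  by rewrite mul1r; apply: mx_norm_le => // i j; rewrite mxE; exact: le_mx_norm.
have := lin_approx_mulmx h (lin_approx_linear Tl Tn h).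
have -> : (fun x => rl (U x) *m (rl (U x))^T) = fun=> 1%:M.
  apply/funext => x; rewrite -rl_adj -rlM; have [_ Uu _] := UU.
  by have /unitarymxP -> := Uu x; rewrite rl1.
move=> /lin_approx_unique/(_ (lin_approx_cst S _))/(_ X).
rewrite drep_rl // U1 rl1 trmx1; move: (dU S U X) => D; rewrite mulmx1 mul1mx => E.
by apply: rl_inj; rewrite rl_adj -(addr0_eq E) -[- D]sub0r rlB rl0 sub0r.
Qed.

End unitary.

(** * Highest weight vectors and words in the Lie algebra *)

Section words.
Local Open Scope complex_scope.
Local Open Scope sesquilinear_scope.
Context {R : realType} {m : nat} {G : topologicalGroupType}.
Variable S : @lieGroup R m G.
Local Notation C := R[i].
Local Notation V := 'rV[R]_m.
Variables (T : set G) (X0 : V).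
Hypotheses (G_compact : compact [set: G]) (G_connected : connected [set: G]).
Hypotheses (T_maximal : maximal_torus T) (X0_regular : regular_element S T X0).

(** The complex-linear extension of [dU] to the complexified Lie algebra, whose elements are complex
    row vectors. *)
Definition dC d (U : G -> 'M[C]_d) (Z : 'rV[C]_m) : 'M[C]_d :=
  dU S U (remx Z) + 'i *: dU S U (immx Z).

Variables (d : nat) (U : G -> 'M[C]_d).
Hypothesis U_rep : complex_rep U.

Lemma dU0 : dU S U 0 = 0.
Proof.
by have := dU_linear S U_rep (-1) 0 0; rewrite scaler0 addr0 rmorphN rmorph1 scaleN1r addNr.
Qed.

Lemma dC_cmx A B : dC U (cmx A B) = dU S U A + 'i *: dU S U B.
Proof. by rewrite /dC remx_cmx immx_cmx. Qed.

#[global] Opaque dC.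

Lemma dC_real X : dC U (cmx X 0) = dU S U X.
Proof. by rewrite dC_cmx dU0 scaler0 addr0. Qed.

Lemma dC_linear a Z Z' : dC U (a *: Z + Z') = a *: dC U Z + dC U Z'.
Proof.
rewrite -(cmxK Z) -(cmxK Z'); case: a => a b; rewrite cmxZ cmxD !dC_cmx.
have dD X Y : dU S U (X + Y) = dU S U X + dU S U Y.
  by have := dU_linear S U_rep 1 X Y; rewrite scale1r rmorph1 scale1r.
have dZ x X : dU S U (x *: X) = x%:C *: dU S U X.
  by have := dU_linear S U_rep x X 0; rewrite dU0 !addr0.
rewrite !dD -scaleNr !dZ; move: (dU S U _) (dU S U _) (dU S U _) (dU S U _) => A B A' B'.
apply/matrixP => i j; rewrite !mxE.
by case: (A i j) (B i j) (A' i j) (B' i j) => [? ?] [? ?] [? ?] [? ?]; simpc; congr (_ +i* _); ring.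
Qed.

(** Interchanging two letters of a word costs a word that is shorter by one letter; for inductions
    on the length it is enough that this letter [Z'] exists. *)
Lemma dC_bracket Z Y : exists Z', dC U Z *m dC U Y = dC U Y *m dC U Z + dC U Z'.
Proof.
rewrite -(cmxK Z) -(cmxK Y) !dC_cmx.
move: (remx Z) (immx Z) (remx Y) (immx Y) => A B A' B'.
have h X Y' : exists z, dC U z = dU S U X *m dU S U Y' - dU S U Y' *m dU S U X.
  by exists (cmx (lie_bracket S X Y') 0); rewrite dC_real dU_bracket.
have [z1 h1] := h A A'; have [z2 h2] := h A B'; have [z3 h3] := h B A'; have [z4 h4] := h B B'.
exists (z1 + ('i *: z2 + ('i *: z3 + (-1) *: z4))).
have dD u v : dC U (u + v) = dC U u + dC U v.
  by have := dC_linear 1 u v; rewrite !scale1r.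
have dZ a u : dC U (a *: u) = a *: dC U u.
  by have := dC_linear a u 0; rewrite -cmx0 dC_real dU0 cmx0 !addr0.
rewrite (dD z1) (dD (_ *: z2)) (dD (_ *: z3)) (dZ _ z2) (dZ _ z3) (dZ _ z4).
rewrite h1 h2 h3 h4.
move: (dU S U A) (dU S U B) (dU S U A') (dU S U B') => a b a' b'.
rewrite !(mulmxDl, mulmxDr) -!scalemxAl -!scalemxAr !scalerA -expr2 sqr_i.
move: (a *m a') (a' *m a) (a *m b') (b' *m a) (b *m a') (a' *m b) (b *m b') (b' *m b).
by move=> e1 e2 e3 e4 e5 e6 e7 e8; apply/matrixP => i j; rewrite !mxE; ring.
Qed.

(* A word in the Lie algebra is decomposed into positive root vectors, which are moved to the
   right until they hit [w], and negative root vectors and torus elements, which act on [l]. *)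
Lemma highest_weight_words (w : 'cV[C]_d) (L : 'rV[C]_d -> Prop) :
  (forall alpha A B, positive_root S T X0 alpha -> in_root_space S T alpha A B ->
     (dU S U A + 'i *: dU S U B) *m w = 0) ->
  (forall l alpha A B, L l -> positive_root S T X0 alpha -> in_root_space S T alpha A B ->
     l *m (dU S U A - 'i *: dU S U B) = 0) ->
  (forall l X, L l -> lie_of_subgroup S T X -> L (l *m dU S U X)) ->
  (forall l, L l -> l *m w = 0) ->
  forall l x, L l -> l *m U x *m w = 0.
Proof.
move=> hpos hneg htor hw l x Ll.
apply: (complex_words_vanish (S := S) U_rep) => // s.
have -> : word_mx (dU S U) s = word_mx (dC U) [seq cmx X 0 | X <- s].
  by elim: s => //= X s ->; rewrite dC_real.
move: {s}(map _ s) => s; have [n sn] : exists n, size s = n by exists (size s).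
elim: n l s Ll sn => [|n IH] l s Ll.
  by move=> /size0nil ->; rewrite /= mulmx1 hw.
case: s => [//|Z s] /= [sn]; move: l s Ll sn.
apply: (root_decomposition G_compact T_maximal X0_regular
  (P := fun Z => forall l s, L l -> size s = n -> l *m (dC U Z *m word_mx (dC U) s) *m w = 0)).
- by move=> l s _ _; rewrite -cmx0 dC_real dU0 mul0mx mulmx0 mul0mx.
- move=> a u v hu hv l s Ll sn; rewrite dC_linear mulmxDl mulmxDr mulmxDl.
  by rewrite hv // -scalemxAl -scalemxAr -scalemxAl hu // scaler0 addr0.
- move=> alpha A B apos root l s Ll sn; set E := cmx A B.
  suff key s2 s1 : (size s1 + size s2)%N = n ->
      l *m (word_mx (dC U) s1 *m dC U E *m word_mx (dC U) s2) *m w = 0.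
    by have := key s [::] sn; rewrite /= mul1mx.
  elim: s2 s1 => [|Y s2 IH2] s1 /= sz.
    by rewrite mulmx1 -!mulmxA dC_cmx (hpos alpha) // !mulmx0.
  have [Z' Z'E] := dC_bracket E Y.
  have -> : word_mx (dC U) s1 *m dC U E *m (dC U Y *m word_mx (dC U) s2) =
      word_mx (dC U) (s1 ++ [:: Y]) *m dC U E *m word_mx (dC U) s2 +
      word_mx (dC U) (s1 ++ Z' :: s2).
    rewrite (word_mx_cat _ s1) (word_mx_cat _ s1) /=.
    move: (word_mx _ s1) (word_mx _ s2) (dC U E) (dC U Y) (dC U Z') Z'E => a b e y z yz.
    by rewrite mulmx1 -!mulmxA (mulmxA e) yz mulmxDl mulmxDr !mulmxA.
  rewrite mulmxDr mulmxDl IH2; last by rewrite size_cat /= -sz addn1 addSnnS.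
  by rewrite add0r IH // size_cat.
- move=> alpha A B apos root l s Ll sn; rewrite dC_cmx.
  have dN : dU S U (- B) = - dU S U B.
    by have := dU_linear S U_rep (-1) B 0; rewrite dU0 !addr0 rmorphN rmorph1 !scaleN1r.
  by rewrite dN scalerN mulmxA (hneg l alpha) // !mul0mx.
- move=> X hX l s Ll sn; rewrite dC_real mulmxA.
  by apply: IH => //; exact: htor.
Qed.

End words.

Section adjoint_matrix.
Local Open Scope complex_scope.
Local Open Scope sesquilinear_scope.
Context {R : realType}.
Local Notation C := R[i].

Lemma trmxC_mul a b c (A : 'M[C]_(a, b)) (B : 'M[C]_(b, c)) : (A *m B)^t* = B^t* *m A^t*.
Proof. by rewrite trmx_mul map_mxM. Qed.

Lemma trmxC_add a b (A B : 'M[C]_(a, b)) : (A + B)^t* = A^t* + B^t*.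
Proof. by rewrite linearD map_mxD. Qed.

Lemma trmxC_opp a b (A : 'M[C]_(a, b)) : (- A)^t* = - A^t*.
Proof. by rewrite linearN map_mxN. Qed.

Lemma trmxC_scale a b x (A : 'M[C]_(a, b)) : (x *: A)^t* = conjc x *: A^t*.
Proof. by rewrite linearZ map_mxZ. Qed.

Lemma innerE d (u v : 'cV[C]_d) : inner u v = (v^t* *m u) 0 0.
Proof. by rewrite mxE; apply: eq_bigr => k _; rewrite !mxE mulrC. Qed.

Local Notation tens := mxtens.tensmx.

Lemma tensE a b c d (A : 'M[C]_(a, b)) (B : 'M[C]_(c, d)) i j :
  tens A B i j = A (mxtens.mxtens_unindex i).1 (mxtens.mxtens_unindex j).1 *
                 B (mxtens.mxtens_unindex i).2 (mxtens.mxtens_unindex j).2.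
Proof. by rewrite mxE. Qed.

Lemma tens1 a b : tens (1%:M : 'M[C]_a) (1%:M : 'M[C]_b) = 1%:M.
Proof.
apply/matrixP => i j; case: (mxtens.mxtens_indexP i) => i0 i1.
case: (mxtens.mxtens_indexP j) => j0 j1.
rewrite mxtens.tensmxE !mxE (inj_eq (can_inj (@mxtens.mxtens_indexK a b))) xpair_eqE.
by rewrite -natrM mulnb.
Qed.

(** The Kronecker sum, through which the Lie algebra acts on a tensor product. *)
Definition derivation_mx a b (M : 'M[C]_a) (N : 'M[C]_b) := tens M 1%:M + tens 1%:M N.

Lemma derivation_mxDZ a b (M M' : 'M[C]_a) (N N' : 'M[C]_b) x :
  derivation_mx M N + x *: derivation_mx M' N' = derivation_mx (M + x *: M') (N + x *: N').
Proof. by apply/matrixP => i j; rewrite /derivation_mx !(tensE, mxE); ring. Qed.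

End adjoint_matrix.

Section products.
Local Open Scope complex_scope.
Local Open Scope sesquilinear_scope.
Context {R : realType} {m : nat} {G : topologicalGroupType}.
Variable S : @lieGroup R m G.
Local Notation C := R[i].
Local Notation V := 'rV[R]_m.
Local Notation tens := mxtens.tensmx.

Lemma continuousC_cst (X : topologicalType) (z : C) : continuousC (fun _ : X => z).
Proof. by split => x; exact: cvg_cst. Qed.

Lemma continuousC_mul (X : topologicalType) (f g : X -> C) :
  continuousC f -> continuousC g -> continuousC (fun x => f x * g x).
Proof.
have ReM (z w : C) : complex.Re (z * w) = complex.Re z * complex.Re w - complex.Im z * complex.Im w.
  by case: z w => [a b] [c d].
have ImM (z w : C) : complex.Im (z * w) = complex.Re z * complex.Im w + complex.Im z * complex.Re w.
  by case: z w => [a b] [c d].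
move=> [f1 f2] [g1 g2]; split => x.
  rewrite (_ : (fun x => _) = fun x => complex.Re (f x) * complex.Re (g x) - complex.Im (f x) * complex.Im (g x)).
    by apply: cvgB; apply: cvgM; [exact: f1|exact: g1|exact: f2|exact: g2].
  by apply/funext => y; rewrite ReM.
rewrite (_ : (fun x => _) = fun x => complex.Re (f x) * complex.Im (g x) + complex.Im (f x) * complex.Re (g x)).
  by apply: cvgD; apply: cvgM; [exact: f1|exact: g2|exact: f2|exact: g1].
by apply/funext => y; rewrite ImM.
Qed.

Lemma dU_eq d (W : G -> 'M[C]_d) X (z : C) i j : complex_rep W ->
  is_derive (cmap (lie_chart S) 1%g) X (fun v => complex.Re (W (cinv (lie_chart S) v) i j)) (complex.Re z) ->
  is_derive (cmap (lie_chart S) 1%g) X (fun v => complex.Im (W (cinv (lie_chart S) v) i j)) (complex.Im z) ->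
  dU S W X i j = z.
Proof.
move=> WC h1 h2.
have E1 := is_derive_unique (dU_Re S WC X i j) h1.
have E2 := is_derive_unique (dU_Im S WC X i j) h2.
by move: E1 E2; case: (dU S W X i j) => a b; case: z {h1 h2} => a' b' /= -> ->.
Qed.

Variables (d1 d2 : nat) (U1 : G -> 'M[C]_d1) (U2 : G -> 'M[C]_d2).
Hypotheses (U1_rep : complex_rep U1) (U2_rep : complex_rep U2).

Lemma block_rep : complex_rep (fun x => block_mx (U1 x) 0 0 (U2 x)).
Proof.
have [U1M U11 U1c] := U1_rep; have [U2M U21 U2c] := U2_rep; split => [x y||i j].
- by rewrite U1M U2M mulmx_block !mulmx0 !mul0mx !addr0 !add0r.
- by rewrite U11 U21 -scalar_mx_block.
- rewrite -(fintype.splitK i) -(fintype.splitK j).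
  case: (fintype.split i) => i'; case: (fintype.split j) => j' /=.
  + by under eq_fun do rewrite block_mxEul; exact: U1c.
  + by under eq_fun do rewrite block_mxEur mxE; exact: continuousC_cst.
  + by under eq_fun do rewrite block_mxEdl mxE; exact: continuousC_cst.
  + by under eq_fun do rewrite block_mxEdr; exact: U2c.
Qed.

Lemma dU_block X : dU S (fun x => block_mx (U1 x) 0 0 (U2 x)) X =
  block_mx (dU S U1 X) 0 0 (dU S U2 X).
Proof.
apply/matrixP => i j; rewrite -(fintype.splitK i) -(fintype.splitK j).
case: (fintype.split i) => i'; case: (fintype.split j) => j' /=;
  apply: (dU_eq block_rep).
- by under eq_fun do rewrite block_mxEul; rewrite block_mxEul; exact: dU_Re.
- by under eq_fun do rewrite block_mxEul; rewrite block_mxEul; exact: dU_Im.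
- by under eq_fun do rewrite block_mxEur mxE; rewrite block_mxEur mxE; exact: is_derive_cst.
- by under eq_fun do rewrite block_mxEur mxE; rewrite block_mxEur mxE; exact: is_derive_cst.
- by under eq_fun do rewrite block_mxEdl mxE; rewrite block_mxEdl mxE; exact: is_derive_cst.
- by under eq_fun do rewrite block_mxEdl mxE; rewrite block_mxEdl mxE; exact: is_derive_cst.
- by under eq_fun do rewrite block_mxEdr; rewrite block_mxEdr; exact: dU_Re.
- by under eq_fun do rewrite block_mxEdr; rewrite block_mxEdr; exact: dU_Im.
Qed.

Lemma tens_rep : complex_rep (fun x => tens (U1 x) (U2 x)).
Proof.
have [U1M U11 U1c] := U1_rep; have [U2M U21 U2c] := U2_rep; split => [x y||i j].
- by rewrite U1M U2M mxtens.tensmx_mul.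
- by rewrite U11 U21 tens1.
- by under eq_fun do rewrite tensE; apply: continuousC_mul; [exact: U1c|exact: U2c].
Qed.

Lemma dU_tens X : dU S (fun x => tens (U1 x) (U2 x)) X =
  derivation_mx (dU S U1 X) (dU S U2 X).
Proof.
have [_ U11 _] := U1_rep; have [_ U21 _] := U2_rep.
have c1 : cinv (lie_chart S) (cmap (lie_chart S) 1%g) = 1%g.
  by apply: cmapK; exact: lie_chart1.
apply/matrixP => i j; rewrite (_ : derivation_mx _ _ i j = tens (dU S U1 X) 1%:M i j + tens 1%:M (dU S U2 X) i j);
  last by rewrite /derivation_mx; move: (tens _ _) (tens _ _) => ? ?; rewrite mxE.
rewrite !tensE.
set a := _.1; set b := _.1; set c := _.2; set d := _.2.
have r1 := dU_Re S U1_rep X a b; have i1 := dU_Im S U1_rep X a b.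
have r2 := dU_Re S U2_rep X c d; have i2 := dU_Im S U2_rep X c d.
have ReM (z w : C) : complex.Re (z * w) = complex.Re z * complex.Re w - complex.Im z * complex.Im w.
  by case: z w => [? ?] [? ?].
have ImM (z w : C) : complex.Im (z * w) = complex.Re z * complex.Im w + complex.Im z * complex.Re w.
  by case: z w => [? ?] [? ?].
have ReD (z w : C) : complex.Re (z + w) = complex.Re z + complex.Re w by case: z w => [? ?] [? ?].
have ImD (z w : C) : complex.Im (z + w) = complex.Im z + complex.Im w by case: z w => [? ?] [? ?].
apply: (dU_eq tens_rep).
  under eq_fun do rewrite tensE -/a -/b -/c -/d ReM.
  have := is_deriveB (is_deriveM r1 r2) (is_deriveM i1 i2).
  congr is_derive; rewrite c1 U11 U21 -![_ *: _]/(_ * _) ReD !ReM; ring.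
under eq_fun do rewrite tensE -/a -/b -/c -/d ImM.
have := is_deriveD (is_deriveM r1 i2) (is_deriveM i1 r2).
congr is_derive; rewrite c1 U11 U21 -![_ *: _]/(_ * _) ImD !ImM; ring.
Qed.

End products.

Section highest_weight.
Local Open Scope complex_scope.
Local Open Scope sesquilinear_scope.
Context {R : realType} {m : nat} {G : topologicalGroupType}.
Variable S : @lieGroup R m G.
Local Notation C := R[i].
Local Notation V := 'rV[R]_m.
Local Notation tens := mxtens.tensmx.
Variables (T : set G) (X0 : V).
Hypotheses (G_compact : compact [set: G]) (G_connected : connected [set: G]).
Hypotheses (T_maximal : maximal_torus T) (X0_regular : regular_element S T X0).

Lemma conjCi : conjc ('i : C) = - 'i.
Proof. by apply/eqP; rewrite eq_complex /= oppr0 !eqxx. Qed.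

Lemma conjC_imaginary (x : R) : conjc ('i * x%:C) = - ('i * x%:C).
Proof. by apply/eqP; rewrite eq_complex /=; apply/andP; split; apply/eqP; ring. Qed.

Lemma adj_killed d (U : G -> 'M[C]_d) (w : 'cV[C]_d) A B : unitary_rep U ->
  (dU S U A + 'i *: dU S U B) *m w = 0 -> w^t* *m (dU S U A - 'i *: dU S U B) = 0.
Proof.
move=> UU /(congr1 (fun M => M^t*)); rewrite trmxC_mul trmxC_add trmxC_scale !dU_skew // conjCi.
rewrite trmx0 map_mx0 scalerN scaleNr opprK => E.
by apply: oppr_inj; rewrite oppr0 -mulmxN opprB addrC.
Qed.

Lemma adj_weight d (U : G -> 'M[C]_d) (w : 'cV[C]_d) X (x : R) : unitary_rep U ->
  dU S U X *m w = ('i * x%:C) *: w -> w^t* *m dU S U X = ('i * x%:C) *: w^t*.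
Proof.
move=> UU /(congr1 (fun M => M^t*)); rewrite trmxC_mul trmxC_scale dU_skew // mulmxN conjC_imaginary.
by rewrite scaleNr => /oppr_inj.
Qed.

Definition killed d (U : G -> 'M[C]_d) (w : 'cV[C]_d) :=
  forall alpha A B, positive_root S T X0 alpha -> in_root_space S T alpha A B ->
    (dU S U A + 'i *: dU S U B) *m w = 0.

Definition weight_vector d (U : G -> 'M[C]_d) (w : 'cV[C]_d) (lambda : V -> R) :=
  forall X, lie_of_subgroup S T X -> dU S U X *m w = ('i * (lambda X)%:C) *: w.

Lemma scaleDx d (x y : C) (z w : 'M[C]_d) : x *: z - y *: w = x *: z + (- y) *: w.
Proof. by rewrite scaleNr. Qed.

(** [tens_col] and [tens_row] give [tens] the width or height [1] in place of [1 * 1], so that the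
    result is again a column or a row. *)
Definition tens_col a b (A : 'cV[C]_a) (B : 'cV[C]_b) : 'cV[C]_(a * b) := tens A B.

Definition tens_row a b (A : 'rV[C]_a) (B : 'rV[C]_b) : 'rV[C]_(a * b) := tens A B.

Lemma derivation_mul_tens a b (A : 'cV[C]_a) (B : 'cV[C]_b) M N :
  derivation_mx M N *m tens_col A B = tens_col (M *m A) B + tens_col A (N *m B).
Proof.
rewrite /derivation_mx mulmxDl.
have := mxtens.tensmx_mul M 1%:M A B; have := mxtens.tensmx_mul 1%:M N A B.
by rewrite !mul1mx => h1 h2; congr (_ + _); [exact: h2|exact: h1].
Qed.

Lemma tens_mul_derivation a b (A : 'rV[C]_a) (B : 'rV[C]_b) M N :
  tens_row A B *m derivation_mx M N = tens_row (A *m M) B + tens_row A (B *m N).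
Proof.
rewrite /derivation_mx mulmxDr.
have := mxtens.tensmx_mul A B M 1%:M; have := mxtens.tensmx_mul A B 1%:M N.
by rewrite !mulmx1 => h1 h2; congr (_ + _); [exact: h2|exact: h1].
Qed.

Lemma tens_row_col a b (A : 'rV[C]_a) (B : 'rV[C]_b) (M : 'M[C]_a) (N : 'M[C]_b)
    (A' : 'cV[C]_a) (B' : 'cV[C]_b) :
  (tens_row A B *m tens M N *m tens_col A' B') 0 0 = (A *m M *m A') 0 0 * (B *m N *m B') 0 0.
Proof.
have E1 : tens_row A B *m tens M N = tens_row (A *m M) (B *m N) := mxtens.tensmx_mul A B M N.
have E2 : tens_row (A *m M) (B *m N) *m tens_col A' B' = tens (A *m M *m A') (B *m N *m B') :=
  mxtens.tensmx_mul (A *m M) (B *m N) A' B'.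
rewrite E1 E2; apply: etrans (tensE _ _ _ _) _.
by congr (_ * _); f_equal; exact: ord1.
Qed.

Lemma tens_row_colE a b (A : 'rV[C]_a) (B : 'rV[C]_b) (A' : 'cV[C]_a) (B' : 'cV[C]_b) :
  (tens_row A B *m tens_col A' B') 0 0 = (A *m A') 0 0 * (B *m B') 0 0.
Proof. by have := tens_row_col A B 1%:M 1%:M A' B'; rewrite tens1 !mulmx1. Qed.

Lemma tens_row_scale a b (x y : C) (A : 'rV[C]_a) (B : 'rV[C]_b) :
  tens_row (x *: A) B + tens_row A (y *: B) = (x + y) *: tens_row A B.
Proof. by apply/rowP => j; rewrite !mxE; ring. Qed.

Lemma tens_row0 a b (A : 'rV[C]_a) (B : 'rV[C]_b) : tens_row 0 B + tens_row A 0 = 0.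
Proof. by apply/rowP => j; rewrite !mxE mul0r mulr0 addr0. Qed.

Lemma tens_col0 a b (A : 'cV[C]_a) (B : 'cV[C]_b) : tens_col 0 B + tens_col A 0 = 0.
Proof. by apply/colP => j; rewrite !mxE mul0r mulr0 addr0. Qed.

(** In the direct sum of [U] with the tensor product of [U1] and [U2], let [w'] have the two highest
    weight vectors as components, and let [l'] be the adjoint of the first minus the adjoint of the
    second. Positive root vectors kill [w'], their conjugates are killed by [l'], the torus scales
    [l'] because the weights agree, and [l' *m w' = 1 - 1 = 0]. Hence [l'] vanishes on the orbit of
    [w'], which equates the two matrix coefficients without embedding [U] in the tensor product. *)
Lemma highest_weight_mul d d1 d2 (U : G -> 'M[C]_d) (U1 : G -> 'M[C]_d1) (U2 : G -> 'M[C]_d2)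
    w w1 w2 (l l1 l2 : V -> R) :
  unitary_rep U -> unitary_rep U1 -> unitary_rep U2 ->
  killed U w -> killed U1 w1 -> killed U2 w2 ->
  weight_vector U w l -> weight_vector U1 w1 l1 -> weight_vector U2 w2 l2 ->
  (forall X, l X = l1 X + l2 X) ->
  w^t* *m w = 1%:M -> w1^t* *m w1 = 1%:M -> w2^t* *m w2 = 1%:M ->
  forall x, (w^t* *m U x *m w) 0 0 = (w1^t* *m U1 x *m w1) 0 0 * (w2^t* *m U2 x *m w2) 0 0.
Proof.
move=> UU UU1 UU2 k k1 k2 wl wl1 wl2 lE n n1 n2 x.
have UC := unitary_complex_rep UU; have UC1 := unitary_complex_rep UU1.
have UC2 := unitary_complex_rep UU2; have UCt := tens_rep UC1 UC2.
pose W y := block_mx (U y) 0 0 (tens (U1 y) (U2 y)).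
have WC : complex_rep W := block_rep UC UCt.
have dW X : dU S W X = block_mx (dU S U X) 0 0 (derivation_mx (dU S U1 X) (dU S U2 X)).
  by rewrite -(dU_tens S UC1 UC2); exact: (dU_block S UC UCt).
have dWZ A B z : dU S W A + z *: dU S W B = block_mx (dU S U A + z *: dU S U B) 0 0
    (derivation_mx (dU S U1 A + z *: dU S U1 B) (dU S U2 A + z *: dU S U2 B)).
  by rewrite !dW scale_block_mx add_block_mx !scaler0 !addr0 derivation_mxDZ.
pose w' := col_mx w (tens_col w1 w2).
pose l' : 'rV_(d + d1 * d2) := row_mx (w^t*) (- tens_row (w1^t*) (w2^t*)).
have key : l' *m W x *m w' = 0.
  apply: (highest_weight_words G_compact G_connected T_maximal X0_regular WC
    (L := fun v => exists c, v = c *: l')); last by exists 1; rewrite scale1r.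
  - move=> alpha A B pa rt; rewrite dWZ /w' mul_block_col !mul0mx addr0 add0r.
    rewrite (k alpha) // derivation_mul_tens (k1 alpha) // (k2 alpha) //.
    by rewrite tens_col0 col_mx0.
  - move=> _ alpha A B [c ->] pa rt; rewrite -scaleNr dWZ -scalemxAl /l' mul_row_block.
    rewrite !mulmx0 addr0 add0r mulNmx tens_mul_derivation !scaleNr.
    rewrite !adj_killed; [|exact: UU2|exact: (k2 alpha)|exact: UU1|exact: (k1 alpha)|exact: UU|exact: (k alpha)].
    by rewrite tens_row0 oppr0 row_mx0 scaler0.
  - move=> _ X [c ->] hX; exists (c * ('i * (l X)%:C)).
    rewrite -scalemxAl dW /l' mul_row_block !mulmx0 addr0 add0r mulNmx tens_mul_derivation.
    rewrite (adj_weight UU (wl _ hX)) (adj_weight UU1 (wl1 _ hX)) (adj_weight UU2 (wl2 _ hX)).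
    rewrite tens_row_scale -mulrDr -rmorphD -lE.
    by rewrite -scalerN -scale_row_mx scalerA.
  - move=> _ [c ->]; rewrite -scalemxAl /l' /w' mul_row_col n mulNmx.
    rewrite [tens_row _ _ *m _]mx11_scalar tens_row_colE n1 n2.
    by rewrite !mxE mulr1 subrr scaler0.
move: key; rewrite /l' /W /w' mul_row_block !mulmx0 addr0 add0r mul_row_col !mulNmx.
by move=> /eqP; rewrite subr_eq0 => /eqP ->; rewrite tens_row_col.
Qed.

End highest_weight.

(** * The top eigenspace of a regular element *)

Section top_weight.
Local Open Scope complex_scope.
Local Open Scope sesquilinear_scope.
Context {R : realType} {m : nat} {G : topologicalGroupType}.
Variable S : @lieGroup R m G.
Local Notation C := R[i].
Local Notation V := 'rV[R]_m.
Variables (T : set G) (X0 : V).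
Hypotheses (G_compact : compact [set: G]) (G_connected : connected [set: G]).
Hypotheses (T_maximal : maximal_torus T) (X0_regular : regular_element S T X0).

(** The vectors whose whole orbit is annihilated by [l] form an invariant subspace; it contains
    [xi], so it is everything. *)
Lemma irreducible_separating d (U : G -> 'M[C]_d) (xi : 'cV[C]_d) (l : 'rV[C]_d) :
  complex_rep U -> irreducible_rep U -> xi != 0 ->
  (forall x, l *m U x *m xi = 0) -> l = 0.
Proof.
move=> [UM U1 _] [_ irr] xi0 h.
have [||W WP] := @linear_pred_vspace C 'cV[C]_d (fun u => forall x, l *m U x *m u = 0).
- by move=> x; rewrite mulmx0.
- by move=> a u v hu hv x; rewrite mulmxDr -scalemxAr hu hv scaler0 addr0.
have Wx : xi \in W by apply/WP.
have [|W0|WT] := irr W.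
- by move=> x v /WP hv; apply/WP => y; rewrite !mulmxA -(mulmxA l) -UM.
- by move: Wx; rewrite W0 memv0 (negPf xi0).
apply/row_matrixP => i; rewrite row0.
apply/rowP => j; rewrite !mxE.
have /WP/(_ 1%g) : delta_mx j 0 \in W by rewrite WT memvf.
by rewrite U1 mulmx1 -colE => /colP/(_ i); rewrite !mxE.
Qed.

Variables (d : nat) (U : G -> 'M[C]_d) (xi : 'cV[C]_d) (lambda : V -> R).
Hypotheses (UU : unitary_rep U) (Uirr : irreducible_rep U).
Hypotheses (xik : killed S T X0 U xi) (xiw : weight_vector S T U xi lambda).
Hypothesis xi1 : xi^t* *m xi = 1%:M.
Let UC := unitary_complex_rep UU.
Local Notation D := (dU S U X0).
Local Notation eig mu v := (D *m (v : 'cV[C]_d) = ('i * mu%:C) *: v).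

Lemma xi_neq0 : xi != 0.
Proof.
apply: contra_eq_neq xi1 => ->; rewrite mulmx0 eq_sym.
by apply/eqP => /matrixP/(_ 0 0)/eqP; rewrite !mxE oner_eq0.
Qed.

Lemma eigen_torus mu v X : lie_of_subgroup S T X -> eig mu v -> eig mu (dU S U X *m v).
Proof.
move=> hX hv; have := dU_bracket S UC X0 X.
rewrite (lie_bracket_torus T_maximal.1 X0_regular.1 hX) (dU0 S UC).
move=> /esym/eqP; rewrite subr_eq0 => /eqP E.
by rewrite mulmxA E -mulmxA hv -scalemxAr.
Qed.

Lemma eigen_raise mu v alpha A B : in_root_space S T alpha A B -> eig mu v ->
  eig (mu + alpha X0) ((dU S U A + 'i *: dU S U B) *m v).
Proof.
move=> root hv; have [bA bB] := root _ X0_regular.1.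
have := dU_bracket S UC X0 A; have := dU_bracket S UC X0 B; rewrite bA bB.
have dZ x X : dU S U (x *: X) = x%:C *: dU S U X.
  by have := dU_linear S UC x X 0; rewrite (dU0 S UC) !addr0.
rewrite -scaleNr !dZ; move: (dU S U A) (dU S U B) D hv => a b e hv /eqP hb /eqP ha.
rewrite eq_sym subr_eq in hb; rewrite eq_sym subr_eq in ha.
rewrite mulmxA mulmxDr -scalemxAr (eqP ha) (eqP hb).
rewrite !mulmxDl -!scalemxAl !mulmxDl -!scalemxAl -!mulmxA hv -!scalemxAr.
have -> : (- alpha X0)%:C = - (alpha X0)%:C by exact: rmorphN.
have -> : (mu + alpha X0)%:C = mu%:C + (alpha X0)%:C by exact: rmorphD.
move: (a *m v) (b *m v) (mu%:C) ((alpha X0)%:C) => av bv y z.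
have ii : 'i * 'i = -1 :> C by rewrite -expr2 sqr_i.
by apply/colP => k; rewrite !mxE; ring: ii.
Qed.

(* [v^*] satisfies the hypotheses of [highest_weight_words] with [w = xi]. *)
Lemma killed_eigen_orthogonal mu v :
  (forall u, eig mu u -> killed S T X0 U u) -> eig mu v -> v^t* *m xi = 0 -> v = 0.
Proof.
move=> Ek Ev vxi; rewrite -(trmxCK v).
suff -> : v^t* = 0 by rewrite trmx0 map_mx0.
apply: (irreducible_separating UC Uirr xi_neq0) => x.
apply: (highest_weight_words G_compact G_connected T_maximal X0_regular UC
  (L := fun l => exists u, [/\ eig mu u, u^t* *m xi = 0 & l = u^t*])).
- exact: xik.
- by move=> _ alpha A B [u [Eu _ ->]] pa rt; apply: (adj_killed UU); exact: (Ek u Eu alpha).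
- move=> _ X [u [Eu uxi ->]] hX; exists (- (dU S U X *m u)); split.
  + by rewrite mulmxN (eigen_torus hX Eu) scalerN.
  + by rewrite trmxC_opp mulNmx trmxC_mul (dU_skew S _ UU) mulmxN mulNmx opprK -mulmxA xiw // -scalemxAr uxi scaler0.
  + by rewrite trmxC_opp trmxC_mul (dU_skew S _ UU) mulmxN opprK.
- by move=> _ [u [_ uxi ->]].
- by exists v.
Qed.

Lemma eigen_orthogonal mu v : eig mu v -> mu != lambda X0 -> v^t* *m xi = 0.
Proof.
move=> Ev ne; have h1 := adj_weight UU Ev; have h2 := xiw X0_regular.1.
have : v^t* *m D *m xi = v^t* *m (D *m xi) by rewrite mulmxA.
rewrite h1 h2 -scalemxAl -scalemxAr => /eqP; rewrite -subr_eq0 -scalerBl scaler_eq0.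
case/orP => [|/eqP //]; rewrite -mulrBr mulf_eq0 => /orP[|].
  by rewrite eq_complex /= oner_eq0 andbF.
by rewrite -rmorphB fmorph_eq0 subr_eq0 (negPf ne).
Qed.

Let P := spectralmx D.
Let mu k : R := complex.Im (spectral_diag D 0 k).
Let e k : 'cV[C]_d := (row k P)^t*.

Lemma spectral_intertwine : P *m D = diag_mx (spectral_diag D) *m P.
Proof.
have Dn : D \is normalmx by apply/normalmxP; rewrite (dU_skew S _ UU) mulNmx mulmxN.
have /orthomx_spectralP E := Dn.
by rewrite {1}E !mulmxA mulmxV ?mul1mx // spectral_unit.
Qed.

Lemma e_norm k : row k P *m e k = 1%:M.
Proof.
have /unitarymxP/matrixP/(_ k k) := spectral_unitarymx D; rewrite !mxE eqxx => E.
rewrite [LHS]mx11_scalar; congr (_%:M); rewrite -[RHS]E mxE.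
by apply: eq_bigr => j _; rewrite !mxE.
Qed.

Lemma spectral_imaginary k : spectral_diag D 0 k = 'i * (mu k)%:C.
Proof.
have h : row k P *m D = spectral_diag D 0 k *: row k P.
  by rewrite -row_mul spectral_intertwine; apply/rowP => j; rewrite mxE mul_diag_mx !mxE.
have h' : D *m e k = - conjc (spectral_diag D 0 k) *: e k.
  have := congr1 (fun M => M^t*) h; rewrite trmxC_mul trmxC_scale (dU_skew S _ UU) mulNmx.
  by rewrite scaleNr => <-; rewrite opprK.
have : row k P *m D *m e k = row k P *m (D *m e k) by rewrite mulmxA.
rewrite h h' -scalemxAl -scalemxAr e_norm => /matrixP/(_ 0 0); rewrite !mxE !mulr1.
rewrite /mu; case: (spectral_diag D 0 k) => a b /= /eqP; rewrite eq_complex /= => /andP[/eqP aa _].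
by have -> : a = 0 by [lra]; simpc.
Qed.

Lemma e_eigen k : eig (mu k) (e k).
Proof.
have h : row k P *m D = spectral_diag D 0 k *: row k P.
  by rewrite -row_mul spectral_intertwine; apply/rowP => j; rewrite mxE mul_diag_mx !mxE.
have := congr1 (fun M => M^t*) h; rewrite trmxC_mul trmxC_scale (dU_skew S _ UU) mulNmx.
by rewrite spectral_imaginary conjC_imaginary scaleNr => /oppr_inj.
Qed.

Lemma eigenvalue_spectral nu u : u != 0 -> eig nu u -> exists k, nu = mu k.
Proof.
move=> u0 Eu.
have y0 : P *m u != 0.
  apply: contra_neq u0 => h; rewrite -[u](mulKmx (spectral_unit D)) h mulmx0 //.
have [k yk] : exists k, (P *m u) k 0 != 0.
  apply/existsP; apply: contra_neqT y0 => /existsPn h; apply/colP => k.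
  by rewrite [RHS]mxE; apply/eqP; have := h k; rewrite negbK.
exists k; have : P *m D *m u = P *m (D *m u) by rewrite mulmxA.
rewrite spectral_intertwine Eu -scalemxAr -mulmxA.
move: (P *m u) yk => y yk /colP/(_ k); rewrite mul_diag_mx !mxE spectral_imaginary.
move=> /(mulIf yk)/eqP; rewrite eq_complex /= => /andP[_ /eqP].
by rewrite !mul0r !mul1r !add0r => ->.
Qed.

(** Positive root vectors raise the eigenvalue by [alpha X0 > 0], so all of them kill the
    eigenvectors for the largest eigenvalue. Were this eigenvalue not [lambda X0], such an
    eigenvector would be orthogonal to [xi], hence zero. *)
Lemma top_eigenvalue : (forall k, mu k <= lambda X0) /\
  (forall v, eig (lambda X0) v -> killed S T X0 U v).
Proof.
have k0 : 'I_d by case: Uirr => d0 _; exact: (Ordinal d0).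
case: (@arg_maxP _ _ _ k0 xpredT mu isT) => k _ kmax.
have Ek u : eig (mu k) u -> killed S T X0 U u.
  move=> Eu alpha A B pa rt; apply/eqP; apply: contraT => ne.
  have [j jE] := eigenvalue_spectral ne (eigen_raise rt Eu).
  have : mu k + alpha X0 <= mu k by rewrite jE; exact: kmax.
  by rewrite gerDl leNgt pa.2.
suff E : mu k = lambda X0 by split=> [j|v]; rewrite -E; [exact: kmax|exact: Ek].
apply/eqP; apply: contraT => ne.
have := killed_eigen_orthogonal Ek (e_eigen k) (eigen_orthogonal (e_eigen k) ne).
move=> /(congr1 (fun M => row k P *m M)); rewrite e_norm mulmx0 => /matrixP/(_ 0 0)/eqP.
by rewrite !mxE oner_eq0.
Qed.

Lemma top_eigenspace v : eig (lambda X0) v -> exists c, v = c *: xi.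
Proof.
move=> Ev; exists ((xi^t* *m v) 0 0); apply/eqP; rewrite -subr_eq0; apply/eqP.
apply: (killed_eigen_orthogonal top_eigenvalue.2).
  rewrite mulmxBr Ev -scalemxAr (xiw X0_regular.1) scalerBr !scalerA.
  by congr (_ - _); rewrite mulrC.
have h : xi^t* *m (v - (xi^t* *m v) 0 0 *: xi) = 0.
  by rewrite mulmxBr -scalemxAr xi1 scalemx1 -mx11_scalar subrr.
by have := congr1 (fun M => M^t*) h; rewrite trmxC_mul trmxCK trmx0 map_mx0.
Qed.

Definition normsq (z : C) : R := complex.Re z ^+ 2 + complex.Im z ^+ 2.

Lemma normsqE (z : C) : conjc z * z = (normsq z)%:C.
Proof. by rewrite /normsq; case: z => a b /=; simpc; congr (_ +i* _); ring. Qed.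

(** In an orthonormal eigenbasis of [D], the expectation of [D] at [v] is [i] times a weighted
    average of the [mu k]. It equals the maximum only if all the weight sits on maximal [mu k], so
    [v] is a top eigenvector, and the top eigenspace is the line of [xi]. *)
Lemma top_vector v : v^t* *m v = 1%:M -> v^t* *m D *m v = ('i * (lambda X0)%:C)%:M ->
  exists c, v = c *: xi.
Proof.
move=> v1 vD; apply: top_eigenspace; have [y y_def] : exists y, y = P *m v by exists (P *m v).
have PP : P^t* *m P = 1%:M.
  by rewrite -invmx_unitary ?spectral_unitarymx // mulVmx // spectral_unit.
have yE : y^t* = v^t* *m P^t* by rewrite y_def trmxC_mul.
have Dy : diag_mx (spectral_diag D) *m y = P *m (D *m v).
  by rewrite y_def mulmxA -spectral_intertwine -mulmxA.
have N1 : \sum_k normsq (y k 0) = 1.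
  have : y^t* *m y = 1%:M by rewrite yE y_def mulmxA -(mulmxA (v^t*)) PP mulmx1.
  move=> /matrixP/(_ 0 0); rewrite !mxE => E; apply: (@complexI R).
  rewrite rmorph_sum /= -[RHS]/(1 : C) -[RHS]E.
  by apply: eq_bigr => k _; rewrite -normsqE !mxE.
have N2 : \sum_k normsq (y k 0) * mu k = lambda X0.
  have : y^t* *m (diag_mx (spectral_diag D) *m y) = ('i * (lambda X0)%:C)%:M.
    by rewrite Dy yE mulmxA -(mulmxA (v^t*)) PP mulmx1 mulmxA.
  move=> /matrixP/(_ 0 0); rewrite !mxE => E; apply: (@complexI R).
  have i0 : 'i != 0 :> C by rewrite eq_complex /= oner_eq0 andbF.
  apply: (mulfI i0); rewrite -[RHS]E rmorph_sum mulr_sumr.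
  have NM a (b : R) : (normsq a * b)%:C = conjc a * a * b%:C by rewrite normsqE; exact: rmorphM.
  apply: eq_bigr => k _; transitivity ('i * (normsq (y k 0) * mu k)%:C); first by [].
  rewrite NM mul_diag_mx !mxE spectral_imaginary.
  by move: (y k 0) ((mu k)%:C) => a b; rewrite -[Num.conj _]/(conjc a); ring.
have N3 : \sum_k normsq (y k 0) * (lambda X0 - mu k) = 0.
  under eq_bigr do rewrite mulrBr; rewrite big_split /= -mulr_suml N1 mul1r sumrN N2 subrr //.
have N0 k : normsq (y k 0) * (lambda X0 - mu k) = 0.
  move/eqP: N3; rewrite psumr_eq0 => [/allP/(_ k (mem_index_enum _))/eqP //|j _].
  by rewrite mulr_ge0 ?subr_ge0 ?top_eigenvalue.1 // addr_ge0 ?sqr_ge0.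
have -> : D *m v = P^t* *m (P *m (D *m v)) by rewrite mulmxA PP mul1mx.
have -> : ('i * (lambda X0)%:C) *: v = P^t* *m (('i * (lambda X0)%:C) *: y).
  by rewrite -scalemxAr y_def mulmxA PP mul1mx.
rewrite -Dy; congr (_ *m _); apply/colP => k; rewrite mul_diag_mx !mxE spectral_imaginary.
move/eqP: (N0 k); rewrite mulf_eq0 subr_eq0 => /orP[|/eqP -> //].
rewrite paddr_eq0 ?sqr_ge0 // !sqrf_eq0 => /andP[/eqP r /eqP i].
by move: r i; case: (y k 0) => a b /= -> ->; rewrite -[0 +i* 0]/(0 : C) !mulr0.
Qed.

End top_weight.

Section norms.
Local Open Scope complex_scope.
Local Open Scope sesquilinear_scope.
Context {R : realType}.
Local Notation C := R[i].

Lemma normsq_ge0 (z : C) : 0 <= normsq z.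
Proof. by rewrite addr_ge0 ?sqr_ge0. Qed.

Lemma normsqM (z w : C) : normsq (z * w) = normsq z * normsq w.
Proof. by case: z w => [a b] [c e]; rewrite /normsq /=; ring. Qed.

Lemma normsqJ (z : C) : normsq (conjc z) = normsq z.
Proof. by case: z => [a b]; rewrite /normsq /= sqrrN. Qed.

Lemma normsq1 : normsq (1 : C) = 1.
Proof. by rewrite /normsq /= expr1n expr0n addr0. Qed.

Lemma normsq_eq0 (z : C) : normsq z = 0 -> z = 0.
Proof.
move/eqP; rewrite paddr_eq0 ?sqr_ge0 // !sqrf_eq0; case: z => a b /= /andP[/eqP -> /eqP ->] //.
Qed.

Lemma norm_colE d (u : 'cV[C]_d) : (u^t* *m u) 0 0 = (\sum_k normsq (u k 0))%:C.
Proof.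
rewrite mxE rmorph_sum; apply: eq_bigr => k _; rewrite !mxE.
exact: normsqE.
Qed.

Lemma norm_col_eq0 d (u : 'cV[C]_d) : (u^t* *m u) 0 0 = 0 -> u = 0.
Proof.
rewrite norm_colE => /(@complexI R)/eqP.
rewrite psumr_eq0 => [/allP h|k _]; last exact: normsq_ge0.
by apply/colP => k; rewrite mxE; apply: normsq_eq0; apply/eqP; exact: (h k (mem_index_enum k)).
Qed.

(* Pythagoras for the component of [v] orthogonal to [xi]. *)
Lemma norm_residual d (xi v : 'cV[C]_d) : xi^t* *m xi = 1%:M -> v^t* *m v = 1%:M ->
  let z := (xi^t* *m v) 0 0 in
  \sum_k normsq ((v - z *: xi) k 0) = 1 - normsq z.
Proof.
move=> x1 v1 z; apply: (@complexI R); rewrite -norm_colE.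
have Ez : xi^t* *m v = z%:M by exact: mx11_scalar.
have Ez' : v^t* *m xi = (conjc z)%:M.
  rewrite -[v^t* *m xi]trmxCK trmxC_mul trmxCK Ez tr_scalar_mx map_scalar_mx //.
rewrite -scaleNr trmxC_add trmxC_scale mulmxDl !mulmxDr -!scalemxAl -!scalemxAr.
rewrite x1 v1 Ez Ez' !mxE /= !mulr1n.
have -> : (1 - normsq z)%:C = 1 - (normsq z)%:C by exact: rmorphB.
by rewrite -normsqE rmorphN /=; ring.
Qed.

Lemma unit_inner_le1 d (xi v : 'cV[C]_d) : xi^t* *m xi = 1%:M -> v^t* *m v = 1%:M ->
  normsq ((xi^t* *m v) 0 0) <= 1.
Proof.
move=> x1 v1; rewrite -subr_ge0 -(norm_residual x1 v1).
by apply: sumr_ge0 => k _; exact: normsq_ge0.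
Qed.

Lemma unit_inner_eq1 d (xi v : 'cV[C]_d) : xi^t* *m xi = 1%:M -> v^t* *m v = 1%:M ->
  normsq ((xi^t* *m v) 0 0) = 1 -> v = (xi^t* *m v) 0 0 *: xi.
Proof.
move=> x1 v1 E; apply/eqP; rewrite -subr_eq0; apply/eqP; apply: norm_col_eq0.
by rewrite norm_colE norm_residual // E subrr.
Qed.

End norms.

(** * The stabilizer of the highest weight line and the kernel *)

Section kernel.
Local Open Scope complex_scope.
Local Open Scope sesquilinear_scope.
Context {R : realType} {m : nat} {G : topologicalGroupType}.
Variable S : @lieGroup R m G.
Local Notation C := R[i].
Local Notation V := 'rV[R]_m.
Variables (T : set G) (X0 : V).
Hypotheses (G_compact : compact [set: G]) (G_connected : connected [set: G]).
Hypotheses (T_maximal : maximal_torus T) (X0_regular : regular_element S T X0).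

Definition matrix_coef d (U : G -> 'M[C]_d) (xi : 'cV[C]_d) x : C := (xi^t* *m U x *m xi) 0 0.

(** The trace of the projection onto the line of [xi] times its conjugate by [U x]; up to the
    dimension, this is the integral kernel of the adjoint followed by the symbol map. *)
Definition kern d (U : G -> 'M[C]_d) (xi : 'cV[C]_d) x : R := normsq (matrix_coef U xi x).

Lemma stabilizer1 omega : coadjoint_stabilizer S omega 1%g.
Proof. by move=> X; rewrite invg1 Ad1. Qed.

Lemma stabilizerM omega x y : coadjoint_stabilizer S omega x ->
  coadjoint_stabilizer S omega y -> coadjoint_stabilizer S omega (x * y)%g.
Proof. by move=> hx hy X; rewrite invgM AdM hy hx. Qed.

Lemma stabilizerV omega x : coadjoint_stabilizer S omega x ->
  coadjoint_stabilizer S omega (x^-1)%g.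
Proof. by move=> hx X; rewrite invgK -{2}(AdK S x X) hx. Qed.

Variables (omega : V -> R) (d : nat) (U : G -> 'M[C]_d) (xi : 'cV[C]_d).
Hypothesis hw : highest_weight_rep S T X0 omega U xi.
Local Notation H := (coadjoint_stabilizer S omega).
Local Notation k := (kern U xi).

Let UU : unitary_rep U. Proof. by case: hw. Qed.
Let UC : complex_rep U. Proof. exact: unitary_complex_rep. Qed.
Let Uirr : irreducible_rep U. Proof. by case: hw. Qed.

Lemma hw_norm : xi^t* *m xi = 1%:M.
Proof.
by case: hw => _ _ _ x1 _; rewrite [LHS]mx11_scalar -innerE x1.
Qed.

Lemma hw_omega X : xi^t* *m dU S U X *m xi = ('i * (omega X)%:C)%:M.
Proof.
case: hw => _ _ _ _ wE; rewrite [LHS]mx11_scalar -mulmxA -innerE wE.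
by rewrite mulrA mulrN -expr2 sqr_i opprK mul1r.
Qed.

Lemma hw_killed : killed S T X0 U xi.
Proof. by case: hw => _ _ [_ _ h] _ _; exact: h. Qed.

Lemma hw_weight : weight_vector S T U xi omega.
Proof.
case: (hw) => _ _ [_ [l lP] _] _ _ X hX; rewrite lP //; congr (_ *: _).
have := hw_omega X; rewrite -mulmxA lP // -scalemxAr hw_norm scalemx1.
by move=> /matrixP/(_ 0 0); rewrite !mxE !mulr1n.
Qed.

Lemma orbit_norm x : (U x *m xi)^t* *m (U x *m xi) = 1%:M.
Proof.
rewrite trmxC_mul mulmxA -(mulmxA (xi^t*)) -(unitary_repV x UU).
by have [UM U1 _] := UC; rewrite -UM mulVg U1 mulmx1 hw_norm.
Qed.

Lemma conj_dU_omega x X : (U x *m xi)^t* *m dU S U X *m (U x *m xi) =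
  ('i * (omega (Ad S (x^-1)%g X))%:C)%:M.
Proof.
rewrite -hw_omega (dU_Ad S UC) invgK trmxC_mul -(unitary_repV x UU) !mulmxA //.
Qed.

(** Expectations of [dU] at [U x *m xi] give the coadjoint translate of [omega]. If this is [omega],
    the expectation at [X0] is the extreme eigenvalue, so the vector lies on the line of [xi];
    conversely a phase factor leaves all expectations unchanged. *)
Lemma stabilizer_line x : H x <-> exists c, U x *m xi = c *: xi.
Proof.
split=> [hx|[c cE] X].
  apply: (top_vector G_compact G_connected T_maximal X0_regular UU Uirr hw_killed hw_weight hw_norm).
    exact: orbit_norm.
  by rewrite conj_dU_omega hx.
have c1 : conjc c * c = 1.
  have := orbit_norm x; rewrite cE trmxC_scale -scalemxAl -scalemxAr hw_norm scalerA.
  by rewrite scalemx1 => /matrixP/(_ 0 0); rewrite !mxE !mulr1n.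
have := conj_dU_omega x X; rewrite cE trmxC_scale -!scalemxAl -scalemxAr hw_omega scalerA c1 scale1r.
move=> /matrixP/(_ 0 0); rewrite !mxE !mulr1n => /eqP; rewrite eq_complex /= => /andP[_ /eqP].
by rewrite !mul0r !mul1r !add0r => ->.
Qed.

Lemma stabilizer_scalar x : H x -> exists2 c, normsq c = 1 & U x *m xi = c *: xi.
Proof.
move=> /stabilizer_line[c cE]; exists c => //.
have := orbit_norm x; rewrite cE trmxC_scale -scalemxAl -scalemxAr hw_norm scalerA.
rewrite scalemx1 => /matrixP/(_ 0 0); rewrite !mxE !mulr1n normsqE => h.
exact: (@complexI R).
Qed.

Lemma kern_ge0 x : 0 <= k x. Proof. exact: normsq_ge0. Qed.

Lemma kern_le1 x : k x <= 1.
Proof.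
by rewrite /kern /matrix_coef -mulmxA; apply: unit_inner_le1; [exact: hw_norm|exact: orbit_norm].
Qed.

(** Equality in the Cauchy-Schwarz inequality puts [U x *m xi] on the line of [xi]. *)
Lemma kern_eq1 x : k x = 1 -> H x.
Proof.
rewrite /kern /matrix_coef -mulmxA => E; apply/stabilizer_line.
by exists ((xi^t* *m (U x *m xi)) 0 0); apply: unit_inner_eq1 => //; [exact: hw_norm|exact: orbit_norm].
Qed.

Lemma kernMr x h : H h -> k (x * h)%g = k x.
Proof.
move=> /stabilizer_scalar[c c1 cE]; have [UM _ _] := UC.
by rewrite /kern /matrix_coef UM -!mulmxA cE -!scalemxAr mxE normsqM c1 mul1r.
Qed.

Lemma kern1 : k 1%g = 1.
Proof.
by have [_ U1 _] := UC; rewrite /kern /matrix_coef U1 mulmx1 hw_norm mxE eqxx normsq1.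
Qed.

Lemma kernV x : k (x^-1)%g = k x.
Proof.
rewrite /kern /matrix_coef (unitary_repV x UU).
have -> : xi^t* *m (U x)^t* *m xi = (xi^t* *m U x *m xi)^t* by rewrite !trmxC_mul trmxCK mulmxA.
by move: (xi^t* *m U x *m xi) => M; rewrite !mxE normsqJ.
Qed.

Lemma continuousC_sum (X : topologicalType) (I : finType) (f : I -> X -> C) :
  (forall i, continuousC (f i)) -> continuousC (fun x => \sum_i f i x).
Proof.
move=> fc; have [gR gI] : (forall i, continuous (fun x => complex.Re (f i x))) /\
    (forall i, continuous (fun x => complex.Im (f i x))).
  by split=> i; case: (fc i).
split=> x.
  rewrite (_ : (fun y => _) = fun y => \sum_i complex.Re (f i y)).
    by apply: (continuous_big (U := R) (op := +%R) (x0 := 0)) => [|i _]; [exact: add_continuous|exact: gR].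
  by apply/funext => y; exact: (big_morph _ (fun z w => raddfD _ z w) (raddf0 _)).
rewrite (_ : (fun y => _) = fun y => \sum_i complex.Im (f i y)).
  by apply: (continuous_big (U := R) (op := +%R) (x0 := 0)) => [|i _]; [exact: add_continuous|exact: gI].
by apply/funext => y; exact: (big_morph _ (fun z w => raddfD _ z w) (raddf0 _)).
Qed.

Lemma kern_continuous : continuous k.
Proof.
have [_ _ Uc] := UC.
have [c1 c2] : continuousC (matrix_coef U xi).
  rewrite /matrix_coef; under eq_fun do rewrite mxE.
  apply: continuousC_sum => i; apply: continuousC_mul; last exact: continuousC_cst.
  under eq_fun do rewrite mxE.
  by apply: continuousC_sum => j; apply: continuousC_mul; [exact: continuousC_cst|exact: Uc].
by move=> x; apply: cvgD; apply: cvgM; (exact: c1 || exact: c2).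
Qed.

End kernel.

(** * Integration over the coset space *)

Section coset_integration.
Context {R : realType} {G : topologicalGroupType}.
Variable H : set G.
Hypotheses (H1 : H 1%g) (HM : forall x y, H x -> H y -> H (x * y)%g)
  (HV : forall x, H x -> H (x^-1)%g).
Local Notation Q := (coset_space H).
Local Notation BQ := (borel_coset_space H).
Local Notation pi x := (\pi_(coset_space H) x)%qT.

Lemma pi_eqP x y : pi x = pi y <-> exists2 h, H h & y = (x * h)%g.
Proof.
have rP z : reflect (pi x = pi z) (lcoset_rel H x z) by exact: (@eqmodP _ (lcoset_equiv H) x z).
split=> [/rP/asboolP E|[h Hh ->]].
  have : lcoset_of H y y by exists 1%g => //; rewrite mulg1.
  by rewrite -E => -[h Hh <-]; exists h.
apply/rP/asboolP/seteqP; split=> z [k Hk <-].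
  by exists (h^-1 * k)%g; [apply: HM => //; exact: HV|rewrite -mulgA mulVKg].
by exists (h * k)%g; [exact: HM|rewrite mulgA].
Qed.

Lemma repr_pi x : exists2 h, H h & repr (pi x : Q) = (x * h)%g.
Proof. by apply/pi_eqP; rewrite reprK. Qed.

Lemma translate_pi x y : translate x (pi y) = pi (x * y)%g.
Proof.
have [h Hh E] := repr_pi y; rewrite /translate E.
by apply/esym/pi_eqP; exists h => //; rewrite mulgA.
Qed.

Lemma translate1 (q : Q) : translate 1%g q = q.
Proof. by rewrite /translate mul1g reprK. Qed.

Lemma translate_continuous x : continuous (translate x : Q -> Q).
Proof.
apply/quotient_continuous.
have -> : translate x \o \pi_Q%qT = (fun z => pi z : Q) \o (fun y => x * y)%g.
  by apply/funext => y; exact: translate_pi.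
move=> y; apply: continuous_comp; last exact: pi_continuous.
by apply: mulg_cvg; [exact: cvg_cst|exact: cvg_id].
Qed.

Lemma open_measurable_coset (A : set Q) : open A -> measurable (A : set BQ).
Proof. by move=> oA; exact: sub_sigma_algebra. Qed.

Lemma continuous_measurable_coset (f : Q -> R) : continuous f -> measurable_fun [set: BQ] f.
Proof.
move=> /continuousP fc.
apply: (measurability _ (RGenOpens.measurableE R)).
move=> _ [_ [a [b ->]] <-]; rewrite setTI; apply: open_measurable_coset.
by apply: fc; exact: interval_open.
Qed.

Lemma translate_measurable x : measurable_fun [set: BQ] (translate x : BQ -> BQ).
Proof.
apply: (measurability _ (erefl : @measurable _ BQ = <<s @open Q >>)) => _ [A oA <-].
rewrite setTI; apply: open_measurable_coset.
by move/continuousP: (translate_continuous (x := x)); apply.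
Qed.

Hypothesis G_compact : compact [set: G].

Lemma coset_compact : compact [set: Q].
Proof.
have -> : [set: Q] = (fun x : G => pi x : Q) @` [set: G].
  by apply/seteqP; split => // q _; exists (repr q) => //; rewrite reprK.
by apply: continuous_compact => //; apply: continuous_subspaceT; exact: pi_continuous.
Qed.

Variable mu : probability BQ R.
Hypothesis mu_inv : invariant_measure mu.

Lemma mu_setT : mu [set: BQ] = 1%E. Proof. exact: probability_setT. Qed.

Lemma continuous_integrable (f : Q -> R) : continuous f ->
  mu.-integrable [set: BQ] (EFin \o (f : BQ -> R)).
Proof.
move=> fc; apply: measurable_bounded_integrable => //.
- by have := ltry (1 : R); rewrite -mu_setT.
- exact: continuous_measurable_coset.
- have /compact_bounded [M [Mr hM]] : compact (f @` [set: Q]).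
    by apply: continuous_compact coset_compact; exact: continuous_subspaceT.
  by exists M; split => // x Mx q _; apply: hM => //; exists q.
Qed.

Definition mean (f : Q -> R) : R := \int[mu]_(q in [set: BQ]) f q.

Lemma meanD (f g : Q -> R) : continuous f -> continuous g -> mean (fun q => f q + g q) = mean f + mean g.
Proof. by move=> fc gc; apply: RintegralD => //; exact: continuous_integrable. Qed.

Lemma meanZ (a : R) (f : Q -> R) : continuous f -> mean (fun q => a * f q) = a * mean f.
Proof. by move=> fc; apply: RintegralZl => //; exact: continuous_integrable. Qed.

Lemma mean_cst (a : R) : mean (fun=> a) = a.
Proof. by rewrite /mean Rintegral_cst // (_ : fine _ = 1) ?mulr1 // -[LHS]/(fine (mu [set: BQ])) mu_setT. Qed.

Lemma le_mean (f g : Q -> R) : continuous f -> continuous g -> (forall q, f q <= g q) -> mean f <= mean g.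
Proof. by move=> fc gc fg; apply: le_Rintegral => //; exact: continuous_integrable. Qed.

Lemma mean_norm (f : Q -> R) : continuous f -> `|mean f| <= mean (fun q => `|f q|).
Proof. by move=> fc; apply: le_normr_Rintegral => //; exact: continuous_integrable. Qed.

Lemma mean_translate x (f : Q -> R) : continuous f -> mean (fun q => f (translate x q)) = mean f.
Proof.
move=> fc; rewrite /mean /Rintegral; congr fine.
have fi := continuous_integrable fc.
have fi' : mu.-integrable ((translate x : BQ -> BQ) @^-1` setT) ((EFin \o (f : BQ -> R)) \o translate x).
  apply: (continuous_integrable (f := f \o translate x)) => q.
  by apply: continuous_comp; [exact: translate_continuous|exact: fc].
rewrite -[LHS](integral_pushforward (translate_measurable x) _ fi') //; last first.
  by apply/measurable_EFinP; exact: continuous_measurable_coset.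
by apply: eq_measure_integral => [|? A mA _]; [exact: translate_measurable|exact: mu_inv].
Qed.

Lemma mean_indic (f : Q -> R) (A : set Q) (a : R) : open A -> continuous f -> 0 <= a ->
  (forall q, 0 <= f q) -> (forall q, A q -> a <= f q) -> a * fine (mu (A : set BQ)) <= mean f.
Proof.
move=> oA fc a0 f0 fA; have mA := open_measurable_coset oA.
rewrite -(Rintegral_cst mu mA).
have -> : mean f = \int[mu]_(q in (A `|` ~` A : set BQ)) (f : BQ -> R) q by rewrite setUv.
rewrite Rintegral_setU //; first last.
- by apply/disj_setPS => q [].
- by rewrite setUv; exact: continuous_integrable.
- exact: measurableC.
apply: ler_wpDr; first by apply: Rintegral_ge0.
apply: le_Rintegral => //.
- apply: (integrableS measurableT mA (@subsetT _ _) (continuous_integrable (f := fun=> a) _)).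
  exact: cst_continuous.
- exact: (integrableS measurableT mA (@subsetT _ _) (continuous_integrable fc)).
Qed.

End coset_integration.

(** * Covariant symbols and their adjoints *)

Section schur.
Local Open Scope complex_scope.
Local Open Scope sesquilinear_scope.
Context {R : realType} {G : topologicalGroupType}.
Local Notation C := R[i].

Lemma schur d (U : G -> 'M[C]_d) (N : 'M[C]_d) : irreducible_rep U ->
  (forall x, N *m U x = U x *m N) -> exists a, N = a%:M.
Proof.
move=> [d0 irr] NU.
have [a /eigenvalueP[v vN v0]] := eigenvalue_closed N^T d0.
have vN' : N *m v^T = a *: v^T by apply: trmx_inj; rewrite trmx_mul trmxK vN linearZ /= trmxK.
exists a.
have [||W WP] := @linear_pred_vspace C 'cV[C]_d (fun u => N *m u = a *: u).
- by rewrite mulmx0 scaler0.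
- by move=> b u w hu hw; rewrite mulmxDr -scalemxAr hu hw scalerDr !scalerA mulrC.
have [|W0|WT] := irr W.
- by move=> x u /WP hu; apply/WP; rewrite mulmxA NU -mulmxA hu -scalemxAr.
- have : v^T \in W by apply/WP.
  by rewrite W0 memv0 -trmx0 (inj_eq trmx_inj) (negPf v0).
apply/matrixP => i j; have /WP : delta_mx j 0 \in W by rewrite WT memvf.
rewrite -colE => /colP/(_ i); rewrite !mxE eqxx andbT => ->.
by rewrite mulr_natr.
Qed.

End schur.

Section matrix_continuity.
Local Open Scope complex_scope.
Local Open Scope sesquilinear_scope.
Context {R : realType} {X : topologicalType}.
Local Notation C := R[i].

Lemma continuousC_conj (f : X -> C) : continuousC f -> continuousC (fun x => conjc (f x)).
Proof.
have E z : complex.Re (conjc z : C) = complex.Re z by case: z.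
have E' z : complex.Im (conjc z : C) = - complex.Im z by case: z.
move=> [f1 f2]; split => x; first by under eq_fun do rewrite E; exact: f1.
by under eq_fun do rewrite E'; apply: cvgN; exact: f2.
Qed.

Lemma continuousC_mulmx a b c (A : X -> 'M[C]_(a, b)) (B : X -> 'M[C]_(b, c)) :
  (forall i j, continuousC (fun x => A x i j)) -> (forall i j, continuousC (fun x => B x i j)) ->
  forall i j, continuousC (fun x => (A x *m B x) i j).
Proof.
move=> Ac Bc i j; under eq_fun do rewrite mxE.
by apply: continuousC_sum => k; apply: continuousC_mul; [exact: Ac|exact: Bc].
Qed.

Lemma continuousC_trmxC a b (A : X -> 'M[C]_(a, b)) :
  (forall i j, continuousC (fun x => A x i j)) ->
  forall i j, continuousC (fun x => ((A x)^t*) i j).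
Proof.
move=> Ac i j; under eq_fun do rewrite 2!mxE.
exact: (continuousC_conj (Ac j i)).
Qed.

End matrix_continuity.

Section symbols.
Local Open Scope complex_scope.
Local Open Scope sesquilinear_scope.
Context {R : realType} {G : topologicalGroupType}.
Local Notation C := R[i].
Variable H : set G.
Hypotheses (H1 : H 1%g) (HM : forall x y, H x -> H y -> H (x * y)%g)
  (HV : forall x, H x -> H (x^-1)%g).
Local Notation Q := (coset_space H).
Local Notation BQ := (borel_coset_space H).
Local Notation pi x := (\pi_(coset_space H) x)%qT.
Hypothesis G_compact : compact [set: G].
Variable mu : probability BQ R.
Hypothesis mu_inv : invariant_measure mu.
Variables (d : nat) (U : G -> 'M[C]_d) (xi : 'cV[C]_d).
Hypotheses (UU : unitary_rep U) (Uirr : irreducible_rep U) (xi1 : xi^t* *m xi = 1%:M).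
Hypothesis H_line : forall h, H h -> exists2 c, normsq c = 1 & U h *m xi = c *: xi.

Definition orbit_proj x : 'M[C]_d := U x *m line_proj xi *m (U x)^t*.

Lemma orbit_projE x : orbit_proj x = (U x *m xi) *m (U x *m xi)^t*.
Proof. by rewrite /orbit_proj /line_proj trmxC_mul !mulmxA. Qed.

Lemma orbit_projMr x h : H h -> orbit_proj (x * h)%g = orbit_proj x.
Proof.
move=> /H_line[c c1 cE]; have [UM _ _] := unitary_complex_rep UU.
rewrite !orbit_projE UM -(mulmxA (U x) (U h)) cE -scalemxAr trmxC_scale -scalemxAl -scalemxAr scalerA.
by rewrite mulrC normsqE c1 scale1r.
Qed.

Lemma berezin_pi T x : berezin_symbol U xi T (pi x : Q) = \tr (T *m orbit_proj x).
Proof.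
have [h Hh E] := repr_pi H1 HM HV x.
by rewrite /berezin_symbol E -[U _ *m _ *m _]/(orbit_proj _) orbit_projMr.
Qed.

Lemma continuousC_coset (f : Q -> C) : continuousC (fun x => f (pi x)) -> continuousC f.
Proof.
move=> [f1 f2]; split; first exact/(quotient_continuous (fun q : Q => complex.Re (f q))).
exact/(quotient_continuous (fun q : Q => complex.Im (f q))).
Qed.

Lemma continuousC_pi (f : Q -> C) : continuousC f -> continuousC (fun x => f (pi x)).
Proof.
move=> [f1 f2]; split; first exact/(quotient_continuous (fun q : Q => complex.Re (f q))).
exact/(quotient_continuous (fun q : Q => complex.Im (f q))).
Qed.

Lemma berezin_continuous T : continuousC (berezin_symbol U xi T : Q -> C).
Proof.
apply: continuousC_coset; under eq_fun do rewrite berezin_pi.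
have [_ _ Uc] := UU.
apply: continuousC_sum => i; apply: continuousC_mulmx; first by move=> *; exact: continuousC_cst.
apply: continuousC_mulmx; last exact: continuousC_trmxC.
by apply: continuousC_mulmx => // *; exact: continuousC_cst.
Qed.

Definition coset_kern (y : G) (q : Q) : R := kern U xi (y^-1 * repr q)%g.

Lemma berezin_kern y q : berezin_symbol U xi (orbit_proj y) q = (coset_kern y q)%:C.
Proof.
rewrite /berezin_symbol -[U _ *m _ *m _]/(orbit_proj _) /coset_kern; move: (repr q) => x {q}.
have [UM _ _] := unitary_complex_rep UU.
rewrite !orbit_projE; set u := U y *m xi; set v := U x *m xi.
have E : u^t* *m v = (matrix_coef U xi (y^-1 * x)%g)%:M.
  by rewrite [LHS]mx11_scalar /matrix_coef UM (unitary_repV y UU) /u /v trmxC_mul !mulmxA.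
have E' : v^t* *m u = (conjc (matrix_coef U xi (y^-1 * x)%g))%:M.
  by rewrite -[v^t* *m u]trmxCK trmxC_mul trmxCK E tr_scalar_mx map_scalar_mx.
rewrite -(mulmxA u) mxtrace_mulC (mulmxA (u^t*)) -(mulmxA (u^t* *m v)) E E'.
by rewrite -scalar_mxM mxtrace_scalar mulr1n mulrC normsqE.
Qed.

Lemma coset_kern_pi y x : coset_kern y (pi x) = kern U xi (y^-1 * x)%g.
Proof.
have [h Hh E] := repr_pi H1 HM HV x; rewrite /coset_kern E mulgA.
have [c c1 cE] := H_line Hh; have [UM _ _] := unitary_complex_rep UU.
by rewrite /kern /matrix_coef UM -!mulmxA cE -!scalemxAr mxE normsqM c1 mul1r.
Qed.

Lemma coset_kern_continuous y : continuous (coset_kern y).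
Proof.
have [h _] := berezin_continuous (orbit_proj y).
have -> : coset_kern y = fun q => complex.Re (berezin_symbol U xi (orbit_proj y) q).
  by apply/funext => q; rewrite berezin_kern.
exact: h.
Qed.

Lemma mxtrace_rot a b c (A : 'M[C]_(a, b)) (B : 'M[C]_b) (D : 'M[C]_(b, c)) (P : 'M[C]_(c, a)) :
  \tr (A *m B *m D *m P) = \tr (B *m (D *m P *m A)).
Proof. by rewrite -!mulmxA mxtrace_mulC !mulmxA. Qed.

Lemma orbit_proj_tr x : \tr (orbit_proj x) = 1.
Proof.
rewrite orbit_projE mxtrace_mulC trmxC_mul -mulmxA -(unitary_repV x UU) (mulmxA (U _)).
have [UM U1 _] := unitary_complex_rep UU.
by rewrite -UM mulVg U1 mul1mx xi1 mxtrace_scalar.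
Qed.

Lemma orbit_proj_conj x y : (U x)^t* *m orbit_proj y *m U x = orbit_proj (x^-1 * y)%g.
Proof.
have [UM U1 _] := unitary_complex_rep UU.
have E : U (x^-1 * y)%g *m xi = (U x)^t* *m (U y *m xi) by rewrite UM (unitary_repV x UU) mulmxA.
by rewrite !orbit_projE E; move: (U y *m xi) => w; rewrite trmxC_mul trmxCK !mulmxA.
Qed.

Lemma trmxC_orbit_proj x : (orbit_proj x)^t* = orbit_proj x.
Proof. by rewrite orbit_projE; move: (U x *m xi) => w; rewrite trmxC_mul trmxCK. Qed.

Variable sigma_adj : (Q -> C) -> 'M[C]_d.
Hypothesis sigma_adjP : adjoint_on_continuous mu (berezin_symbol U xi) sigma_adj.

Lemma d_neq0 : (d%:R : C) != 0.
Proof. by have [d0 _] := Uirr; rewrite pnatr_eq0 -lt0n. Qed.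

(** The map [sigma_adj] is known only through the adjunction. The mean of a symbol is unchanged when
    the operator is conjugated by [U x], so the adjoint [N] of the value at 1 commutes with the
    representation and is scalar by Schur's lemma; the symbol of the identity being 1 fixes the
    scalar. *)
Lemma sigma_adj1 : sigma_adj (fun=> 1) = 1%:M.
Proof.
have hP T : integralC mu (berezin_symbol U xi T) = (d%:R)^-1 * \tr (T *m (sigma_adj (fun=> 1))^t*).
  rewrite -[RHS](sigma_adjP T (continuousC_cst _ 1)) /L2_inner; congr integralC.
  by apply/funext => q; rewrite rmorph1 mulr1.
set N := (sigma_adj _)^t* in hP.
have [UM U1 _] := unitary_complex_rep UU.
have NU x : (U x)^t* *m N *m U x = N.
  have trN T : \tr (T *m ((U x)^t* *m N *m U x)) = \tr (T *m N).
    apply: (mulfI (invr_neq0 d_neq0)); rewrite -[RHS]hP.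
    have -> : \tr (T *m ((U x)^t* *m N *m U x)) = \tr ((U x *m T *m (U x)^t*) *m N).
      by rewrite mxtrace_rot.
    rewrite -hP.
    have E (q : Q) : berezin_symbol U xi (U x *m T *m (U x)^t*) q =
        berezin_symbol U xi T (translate (x^-1)%g q).
      have [y ->] : exists y, q = pi y :> Q by exists (repr q); rewrite reprK.
      by rewrite translate_pi // !berezin_pi -orbit_proj_conj mxtrace_rot.
    have [c1 c2] := berezin_continuous T.
    have -> : (berezin_symbol U xi (U x *m T *m (U x)^t*) : Q -> C) =
        fun q => berezin_symbol U xi T (translate (x^-1)%g q) by apply/funext => q; exact: E.
    have m1 := mean_translate H1 HM HV G_compact mu_inv (x^-1)%g c1.
    have m2 := mean_translate H1 HM HV G_compact mu_inv (x^-1)%g c2.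
    by rewrite /mean in m1 m2; rewrite /integralC m1 m2.
  apply/matrixP => i j; have := trN (delta_mx j i).
  have tr_delta (M : 'M[C]_d) : \tr (delta_mx j i *m M) = M i j.
    rewrite -(mul_delta_mx (0 : 'I_1)) -mulmxA mxtrace_mulC -mulmxA mulmxA -rowE -colE.
    by rewrite [col _ _]mx11_scalar mxtrace_scalar !mxE.
  by rewrite !tr_delta.
have [x|a Na] := @schur _ _ _ _ N Uirr.
  rewrite -{2}(NU x) !mulmxA; have [_ Uu _] := UU.
  by have /unitarymxP -> := Uu x; rewrite mul1mx.
have : integralC mu (berezin_symbol U xi 1%:M) = 1.
  have -> : (berezin_symbol U xi 1%:M : Q -> C) = fun=> 1.
    apply/funext => q; have [y ->] : exists y, q = pi y :> Q by exists (repr q); rewrite reprK.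
    by rewrite berezin_pi mul1mx orbit_proj_tr.
  have m1 := mean_cst mu 1; have m0 := mean_cst mu 0.
  by rewrite /mean in m1 m0; rewrite /integralC /= m1 m0.
rewrite hP mul1mx Na mxtrace_scalar -(mulr_natl a) mulrA mulVf ?d_neq0 // mul1r => a1.
by rewrite -[LHS]trmxCK -/N Na a1 tr_scalar_mx map_scalar_mx rmorph1.
Qed.

(** Test the adjunction on [orbit_proj y]: its symbol is the kernel at [y], and its trace pairing
    with [sigma_adj f] is, up to conjugation, the value at [y] of the symbol sought. The factor [d]
    comes from the normalized trace. *)
Lemma berezin_adj (f : Q -> C) y : continuousC f ->
  complex.Re (berezin_symbol U xi (sigma_adj f) (pi y : Q)) =
    d%:R * mean mu (fun q => coset_kern y q * complex.Re (f q)) /\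
  complex.Im (berezin_symbol U xi (sigma_adj f) (pi y : Q)) =
    d%:R * mean mu (fun q => coset_kern y q * complex.Im (f q)).
Proof.
move=> fc; have := sigma_adjP (orbit_proj y) fc.
rewrite berezin_pi /HS_inner.
have -> : \tr (orbit_proj y *m (sigma_adj f)^t*) = conjc (\tr (sigma_adj f *m orbit_proj y)).
  by rewrite -{1}trmxC_orbit_proj -trmxC_mul trace_map_mx mxtrace_tr.
move: (\tr _) => z.
have [f1 f2] := fc; have Kc : continuous (coset_kern y) by exact: coset_kern_continuous.
have c1 : continuous (fun q => coset_kern y q * complex.Re (f q)).
  by move=> q; exact: (cvgM (Kc q) (f1 q)).
have c2 : continuous (fun q => coset_kern y q * complex.Im (f q)).
  by move=> q; exact: (cvgM (Kc q) (f2 q)).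
have -> : L2_inner mu (berezin_symbol U xi (orbit_proj y)) f =
    mean mu (fun q => coset_kern y q * complex.Re (f q)) +i*
    (-1 * mean mu (fun q => coset_kern y q * complex.Im (f q))).
  rewrite -(meanZ G_compact mu (-1) c2) /L2_inner /integralC /mean.
  congr (_ +i* _); congr Rintegral; apply/funext => q; rewrite berezin_kern; case: (f q) => a b /=; ring.
move=> /(congr1 (fun w => d%:R * w)); rewrite mulrA mulfV ?d_neq0 // mul1r.
have -> : (d%:R : C) = (d%:R : R)%:C by rewrite rmorph_nat.
move: (mean _ _) (mean _ _) (d%:R : R) => u v n; case: z => a b /eqP.
by rewrite eq_complex /= => /andP[/eqP e1 /eqP e2]; split; lra.
Qed.

(** The integral formula at [f = 1]: the kernel times the dimension is a probability density. *)
Lemma mean_kern y : d%:R * mean mu (coset_kern y) = 1.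
Proof.
have [h _] := berezin_adj y (continuousC_cst _ 1).
move: h; have -> : (fun q => coset_kern y q * complex.Re (1 : C)) = coset_kern y.
  by apply/funext => q; rewrite mulr1.
by rewrite sigma_adj1 berezin_pi mul1mx orbit_proj_tr => <-.
Qed.

End symbols.

(** * Concentration of powers of the kernel *)

Section concentration.
Context {R : realType} {G : topologicalGroupType}.
Variable H : set G.
Hypotheses (H1 : H 1%g) (HM : forall x y, H x -> H y -> H (x * y)%g)
  (HV : forall x, H x -> H (x^-1)%g).
Local Notation Q := (coset_space H).
Local Notation BQ := (borel_coset_space H).
Local Notation pi x := (\pi_(coset_space H) x)%qT.
Hypothesis G_compact : compact [set: G].
Variables (k ell : G -> R).
Hypotheses (k_cont : continuous k) (k0 : forall x, 0 <= k x) (k_le1 : forall x, k x <= 1).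
Hypotheses (k1 : k 1%g = 1) (k_eq1 : forall x, k x = 1 -> H x).
Hypothesis ell_length : length_function ell.

(** The set [F] of points at distance at least [e] from [H] is compact and misses [H], so the
    maximum of [k] on it is below 1 and serves as [delta]; if [F] is empty, [delta = 0] will do. *)
Lemma kern_concentration (e : R) : 0 < e -> exists delta, [/\ 0 <= delta, delta < 1 &
  forall x, delta < k x -> exists2 h, H h & ell (x * h)%g < e].
Proof.
move=> e0; have [ell_c ell_ge0 ell_eq0 ellV [ellD ellJ]] := ell_length.
pose F := [set x | forall h, H h -> e <= ell (x * h)%g].
have Fc : closed F.
  have -> : F = \bigcap_(h in H) [set x | e <= ell (x * h)%g].
    by apply/seteqP; split => x hx h; apply: hx.
  apply: closed_bigI => h _.
  apply: (closed_comp (f := fun x => ell (x * h)%g) (D := [set r | e <= r])); last exact: closed_ge.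
  move=> x _; apply: (@cvg_comp _ _ _ (fun y : G => (y * h)%g) ell _ (nbhs (x * h)%g)); last exact: ell_c.
  by apply: mulg_cvg; [exact: cvg_id|exact: cvg_cst].
have Fk : compact F by apply: subclosed_compact G_compact _.
have [[x0 Fx0]|F0] := pselect (F !=set0); last first.
  exists 0; split => // x _; apply: contrapT => nh; apply: F0; exists x => h Hh.
  by rewrite leNgt; apply/negP => lt; apply: nh; exists h.
have [|c cF cmax] := @compact_EVT_max _ _ k F (ex_intro _ x0 Fx0) Fk.
  exact: continuous_subspaceT.
exists (k c); split => //.
  rewrite lt_neqAle k_le1 andbT; apply/eqP => /k_eq1 Hc.
  have := (set_mem cF) (c^-1)%g (HV Hc).
  by rewrite mulgV (ell_eq0 1%g).2 // leNgt e0.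
move=> x lt; apply: contrapT => nh.
have Fx : F x.
  by move=> h Hh; rewrite leNgt; apply/negP => l; apply: nh; exists h.
by have := cmax x (mem_set Fx); rewrite leNgt lt.
Qed.

Variable mu : probability BQ R.
Hypothesis mu_inv : invariant_measure mu.
Variable K : G -> Q -> R.
Hypotheses (K_cont : forall y, continuous (K y)) (K_pi : forall y x, K y (pi x) = k (y^-1 * x)%g).

Lemma kern_translate y q : K y q = K 1%g (translate (y^-1)%g q).
Proof.
have [x ->] : exists x, q = pi x :> Q by exists (repr q); rewrite reprK.
by rewrite translate_pi // !K_pi invg1 mul1g.
Qed.

(** The truncation [g = max (K - delta, 0)] satisfies [delta ^+ n * g <= K ^+ n], and [c] is its
    mean. To see that [c > 0], cover the compact coset space by finitely many translates of the open
    set where [K > delta]: the sum of the corresponding translates of [g] has a positive minimum,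
    and by invariance all of them have mean [c]. *)
Lemma kern_mean_lower (delta : R) : 0 <= delta -> delta < 1 ->
  exists2 c, 0 < c & forall n y, delta ^+ n * c <= mean mu (fun q => K y q ^+ n).
Proof.
move=> d0 d1; pose g y q := Num.max (K y q - delta) 0.
have gc y : continuous (g y).
  move=> q; apply: (continuous_max (f := fun q => K y q - delta) (g := fun=> 0)); last exact: cst_continuous.
  exact: (cvgB (@K_cont y q) (cvg_cst delta)).
have gm y : mean mu (g y) = mean mu (g 1%g).
  rewrite -(mean_translate H1 HM HV G_compact mu_inv (y^-1)%g (gc 1%g)).
  by congr (mean mu _); apply/funext => q; rewrite /g kern_translate.
have g0 y q : 0 <= g y q by rewrite le_max lexx orbT.
have Kk y q : exists x, K y q = k x.
  have [x ->] : exists x, q = pi x :> Q by exists (repr q); rewrite reprK.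
  by exists (y^-1 * x)%g; rewrite K_pi.
exists (mean mu (g 1%g)); last first.
  move=> n y; rewrite -(gm y) -meanZ //; apply: le_mean => //.
  - by move=> q; exact: (cvgM (cvg_cst _) (gc _ q)).
  - by move=> q; exact: (cvg_comp _ _ (@K_cont y q) (@exprn_continuous R n (K y q))).
  - move=> q; have [x E] := Kk y q; rewrite /g E; have [le|lt] := leP (k x) delta.
      by rewrite max_r ?subr_le0 // mulr0 exprn_ge0.
    rewrite max_l ?subr_ge0 ?(ltW lt) //.
    apply: (@le_trans _ _ (k x ^+ n * 1)); last by rewrite mulr1.
    apply: ler_pM => //; first by rewrite exprn_ge0.
    + by rewrite subr_ge0 ltW.
    + by rewrite lerXn2r ?nnegrE // ltW.
    + by have := k_le1 x; lra.
pose V y := [set q : Q | delta < K y q].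
have Vo (q : Q) : [set: Q] q -> open (V (repr q)).
  move=> _; move/continuousP: (@K_cont (repr q)) => /(_ [set r | delta < r]).
  by apply; exact: open_gt.
have Vc : [set: Q] `<=` cover [set: Q] (fun q => V (repr q)).
  move=> q _; exists q => //; rewrite /V /= -[X in K _ X]reprK K_pi mulVg k1 //.
have := coset_compact G_compact (H := H); rewrite compact_cover => /(_ _ _ _ Vo Vc)[D' _ D'c].
pose F (s : seq Q) q := \sum_(i <- s) g (repr i) q.
have Fc s : continuous (F s).
  apply: (continuous_big (U := R) (op := +%R) (x0 := 0)) => [|i _]; first exact: add_continuous.
  exact: gc.
have Fm s : mean mu (F s) = (size s)%:R * mean mu (g 1%g).
  elim: s => [|i s IH]; rewrite /F.
    by under eq_fun do rewrite big_nil; rewrite mean_cst mul0r.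
  under eq_fun do rewrite big_cons; rewrite meanD //; last exact: Fc.
  by rewrite gm IH /= -natr1 mulrDl mul1r addrC.
have F0 q : 0 < F (finmap.enum_fset D') q.
  have [i iD Vi] := D'c q I.
  rewrite /F (perm_big _ (perm_to_rem iD)) big_cons; apply: ltr_pwDl.
    by rewrite lt_max subr_gt0 Vi.
  by apply: sumr_ge0.
have [||c _ cmin] := @compact_EVT_min _ _ (F (finmap.enum_fset D')) [set: Q] _ (coset_compact G_compact (H := H)).
- by exists (pi 1%g).
- exact: continuous_subspaceT.
have : F (finmap.enum_fset D') c <= mean mu (F (finmap.enum_fset D')).
  rewrite -[leLHS](mean_cst mu); apply: le_mean => //; first exact: cst_continuous.
  by move=> q; exact: (cmin q (mem_set I)).
rewrite Fm => le; rewrite ltNge; apply/negP => neg.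
have := lt_le_trans (F0 c) le; rewrite ltNge => /negP; apply.
by rewrite mulr_ge0_le0.
Qed.

(** As [D * K ^+ n] has mean one, the error is the average of [g (pi y) - g q] against it. Where
    [K > delta], the coset of [q] has a representative within [e] of [y], which contributes at most
    [L * e]; elsewhere the density is at most [D * delta ^+ n] and the difference at most
    [L * M]. *)
Lemma mean_error (g : Q -> R) (L M e delta : R) n D y : continuous g -> 0 <= L -> 0 <= e -> 0 <= D ->
  (forall x, ell x <= M) -> 0 <= delta ->
  (forall x z, `|g (pi x) - g (pi z)| <= L * ell (z^-1 * x)%g) ->
  (forall x, delta < k x -> exists2 h, H h & ell (x * h)%g < e) ->
  D * mean mu (fun q => K y q ^+ n) = 1 ->
  `|g (pi y) - D * mean mu (fun q => K y q ^+ n * g q)| <= L * (e + M * (D * delta ^+ n)).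
Proof.
move=> gc L0 e0 D0 ellM delta0 gL conc mK.
have [_ ell_ge0 _ ellV _] := ell_length.
have Knc : continuous (fun q => K y q ^+ n).
  by move=> q; exact: (cvg_comp _ _ (@K_cont y q) (@exprn_continuous R n (K y q))).
have Kgc : continuous (fun q => K y q ^+ n * g q) by move=> q; exact: (cvgM (Knc q) (gc q)).
have Dgc : continuous (fun q => K y q ^+ n * (g (pi y) - g q)).
  move=> q; exact: (cvgM (Knc q) (cvgB (cvg_cst _) (gc q))).
have -> : g (pi y) - D * mean mu (fun q => K y q ^+ n * g q) =
    D * mean mu (fun q => K y q ^+ n * (g (pi y) - g q)).
  have -> : (fun q => K y q ^+ n * (g (pi y) - g q)) =
      fun q => g (pi y) * K y q ^+ n + -1 * (K y q ^+ n * g q).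
    by apply/funext => q; ring.
  have c1 : continuous (fun q => g (pi y) * K y q ^+ n).
    by move=> q; exact: (cvgM (cvg_cst _) (Knc q)).
  have c2 : continuous (fun q => -1 * (K y q ^+ n * g q)).
    by move=> q; exact: (cvgM (cvg_cst _) (Kgc q)).
  by rewrite (meanD G_compact mu c1 c2) !meanZ // mulrDr mulrCA mK; ring.
rewrite normrM (ger0_norm D0).
apply: (@le_trans _ _ (D * mean mu (fun q => (L * e) * K y q ^+ n + L * (M * delta ^+ n)))).
  rewrite ler_wpM2l //; apply: le_trans (mean_norm G_compact mu Dgc) _.
  apply: le_mean => //.
  - by move=> q; exact: (cvg_norm (Dgc q)).
  - by move=> q; exact: (cvgD (cvgM (cvg_cst _) (Knc q)) (cvg_cst _)).
  move=> q; have [x ->] : exists x, q = pi x :> Q by exists (repr q); rewrite reprK.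
  rewrite K_pi normrM ger0_norm ?exprn_ge0 //; set t := k _.
  have M0 : 0 <= M := le_trans (ell_ge0 1%g) (ellM 1%g).
  have t0 : 0 <= t ^+ n by rewrite exprn_ge0 // /t.
  have [le|lt] := leP t delta.
    have b : `|g (pi y) - g (pi x)| <= L * M.
      by apply: le_trans (gL _ _) _; rewrite ler_wpM2l.
    have e1 : 0 <= L * e * t ^+ n by rewrite !mulr_ge0.
    apply: le_trans (ler_wpM2l t0 b) _; rewrite -[leLHS]add0r lerD //.
    have -> : t ^+ n * (L * M) = L * (M * t ^+ n) by ring.
    by rewrite ler_wpM2l // ler_wpM2l // lerXn2r ?nnegrE // /t k0.
  have [h Hh eh] := conc _ lt.
  have b : `|g (pi y) - g (pi x)| <= L * e.
    have -> : (pi x : Q) = pi (x * h)%g by apply/(pi_eqP H1 HM HV); exists h.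
    apply: le_trans (gL _ _) _; rewrite ler_wpM2l // ltW //.
    by rewrite -ellV invgM invgK mulgA.
  by apply: le_trans (ler_wpM2l t0 b) _; rewrite mulrC lerDl !mulr_ge0 // exprn_ge0.
rewrite meanD //; first last.
- exact: cst_continuous.
- by move=> q; exact: (cvgM (cvg_cst _) (Knc q)).
rewrite meanZ // mean_cst mulrDr mulrCA mK; lra.
Qed.

End concentration.

(** * The Lip-norm and the sequence of constants *)

Section lipschitz.
Context {R : realType} {G : topologicalGroupType}.
Local Notation C := R[i].
Local Open Scope complex_scope.

Lemma normc_ge_Re_Im (z : C) :
  `|complex.Re z| <= Normc.normc z /\ `|complex.Im z| <= Normc.normc z.
Proof.
case: z => a b /=; rewrite -!sqrtr_sqr; split; apply: ler_wsqrtr.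
  by rewrite lerDl sqr_ge0.
by rewrite lerDr sqr_ge0.
Qed.

Lemma normc_le_Re_Im (z : C) : Normc.normc z <= `|complex.Re z| + `|complex.Im z|.
Proof.
case: z => a b /=; rewrite -[leRHS]ger0_norm ?addr_ge0 // -sqrtr_sqr ler_wsqrtr //.
rewrite sqrrD !real_normK ?num_real // lerD2r lerDl.
by rewrite mulrn_wge0 // mulr_ge0.
Qed.

Variable H : set G.
Hypotheses (H1 : H 1%g) (HM : forall x y, H x -> H y -> H (x * y)%g)
  (HV : forall x, H x -> H (x^-1)%g).
Local Notation Q := (coset_space H).
Local Notation pi x := (\pi_(coset_space H) x)%qT.
Variable ell : G -> R.
Hypothesis ell_length : length_function ell.

Lemma lip_norm_ge0 (f : Q -> C) : (0 <= lip_norm ell f)%E.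
Proof. by apply: ereal_sup_ubound; left. Qed.

Lemma sup_norm_le (f : Q -> C) (c : R) : (forall q, Normc.normc (f q) <= c) -> (sup_norm f <= c%:E)%E.
Proof. by move=> h; apply: ub_ereal_sup => _ [q _ <-]; rewrite lee_fin. Qed.

(** Left translation by [x * z^-1] carries the coset of [z] to that of [x], and conjugation
    invariance gives [x * z^-1] and [z^-1 * x] the same length. *)
Lemma lip_norm_lipschitz (f : Q -> C) (L : R) : lip_norm ell f = L%:E ->
  forall x z, Normc.normc (f (pi x) - f (pi z)) <= L * ell (z^-1 * x)%g.
Proof.
have [_ ell_ge0 ell_eq0 ellV [_ ellJ]] := ell_length.
move=> fL x z.
(* The supremum defining the Lip-norm omits the identity, so the case [x = z] is separate. *)
have [xz|ne] := pselect ((x * z^-1)%g = 1%g).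
  have -> : x = z by rewrite -[x]mulg1 -(mulVg z) mulgA xz mul1g.
  by rewrite subrr Normc.normc0 mulVg (ell_eq0 1%g).2 // mulr0.
have e1 : ell (x * z^-1)%g = ell (z^-1 * x)%g.
  by rewrite -(ellJ z (z^-1 * x)%g) mulVKg.
have epos : 0 < ell (z^-1 * x)%g.
  by rewrite lt_neqAle ell_ge0 andbT eq_sym -e1; apply/eqP => /ell_eq0.
rewrite -ler_pdivrMr // -lee_fin -fL EFinM.
apply: (@le_trans _ _ (sup_norm (fun q => (f (translate ((x * z^-1)^-1)%g q) - f q)%R)
          * ((ell (x * z^-1)%g)^-1)%:E)%E); last first.
  by apply: ereal_sup_ubound; right; exists (x * z^-1)%g.
rewrite e1; apply: lee_wpmul2r; first by rewrite lee_fin invr_ge0.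
apply: ereal_sup_ubound; exists (pi x : Q) => //.
have -> : f (translate ((x * z^-1)^-1)%g (pi x)) = f (pi z).
  by rewrite translate_pi // invgM invgK -mulgA mulVg mulg1.
by rewrite -normcN opprB.
Qed.

End lipschitz.

Section admissible.
Context {R : realType}.

(** The infimum of the admissible constants need not be admissible; adding [1 / (n + 1)] makes it so
    and does not affect the limit. *)
Lemma exists_null_sequence (P : nat -> R -> Prop) :
  (forall n c c', P n c -> c <= c' -> P n c') ->
  (forall n, exists2 c, 0 < c & P n c) ->
  (forall e, 0 < e -> exists N, forall n, (N <= n)%N -> P n e) ->
  exists gamma : nat -> R, gamma @ \oo --> (0 : R) /\ forall n, P n (gamma n).
Proof.
move=> mono ex small.
pose A n := [set c | 0 < c /\ P n c].
have Ainf n : has_inf (A n).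
  split; first by have [c c0 Pc] := ex n; exists c.
  by exists 0 => c [/ltW].
exists (fun n => inf (A n) + n.+1%:R^-1); split; last first.
  move=> n; have n0 : (0 : R) < n.+1%:R^-1 by rewrite invr_gt0.
  have [c [c0 Pc] lt] := inf_adherent n0 (Ainf n).
  by apply: mono Pc _; exact: ltW.
have inf0 n : 0 <= inf (A n).
  by apply: lb_le_inf (Ainf n).1 _ => c [/ltW].
rewrite -[X in _ --> X](addr0 0); apply: cvgD; last exact: cvg_harmonic.
apply/cvgrPdist_le => e e0; have [N hN] := small e e0.
near=> n; rewrite sub0r normrN ger0_norm //.
apply: (ge_inf (Ainf n).2); split => //; apply: hN.
by near: n; exists N.
Unshelve. all: by end_near. Qed.

End admissible.

Theorem theorem3p4 (R : realType) (m : nat) (G : topologicalGroupType)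
  (S : @lieGroup R m G)
  (G_compact : compact [set: G]) (G_connected : connected [set: G])
  (G_semisimple : lie_semisimple S)
  (ell : G -> R) (ell_length : length_function ell)
  (T : set G) (T_maximal : maximal_torus T)
  (X0 : 'rV[R]_m) (X0_regular : regular_element S T X0)
  (omega : 'rV[R]_m -> R)
  (omega_integral : exists (d : nat) (U : G -> 'M[R[i]]_d) (xi : 'cV[R[i]]_d),
     highest_weight_rep S T X0 omega U xi)
  (mu : probability (borel_coset_space (coadjoint_stabilizer S omega)) R)
  (mu_invariant : invariant_measure mu)
  (d : nat -> nat) (U : forall n, G -> 'M[R[i]]_(d n))
  (xi : forall n, 'cV[R[i]]_(d n))
  (U_highest_weight : forall n, (0 < n)%N ->
     highest_weight_rep S T X0 (fun X => n%:R * omega X) (U n) (xi n))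
  (sigma_adj : forall n,
     (coset_space (coadjoint_stabilizer S omega) -> R[i]) -> 'M[R[i]]_(d n))
  (sigma_adjP : forall n, (0 < n)%N ->
     adjoint_on_continuous mu (berezin_symbol (U n) (xi n)) (sigma_adj n)) :
  exists gamma : nat -> R,
    gamma @ \oo --> (0 : R) /\
    forall n, (0 < n)%N ->
    forall f : coset_space (coadjoint_stabilizer S omega) -> R[i],
      continuousC f ->
      (sup_norm (fun q => f q - berezin_symbol (U n) (xi n) (sigma_adj n f) q)%R
         <= (gamma n)%:E * lip_norm ell f)%E.
Proof.
have H1 := stabilizer1 S omega; have HM := @stabilizerM _ _ _ S omega.
have HV := @stabilizerV _ _ _ S omega.
set H := coadjoint_stabilizer S omega in H1 HM HV mu mu_invariant sigma_adj sigma_adjP *.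
have hw n : (0 < n)%N -> _ := @U_highest_weight n.
have hw1 : highest_weight_rep S T X0 omega (U 1%N) (xi 1%N).
  have E : (fun X => 1%:R * omega X) = omega by apply/funext => X; rewrite mul1r.
  by have := hw 1%N isT; rewrite E.
pose k := kern (U 1%N) (xi 1%N).
(* The representation of weight [(n + 2) omega] is compared with the tensor product of those of
   weights [(n + 1) omega] and [omega]. *)
have coefE n x : matrix_coef (U n.+1) (xi n.+1) x = matrix_coef (U 1%N) (xi 1%N) x ^+ n.+1.
  elim: n => [|n IH]; first by rewrite expr1.
  rewrite exprSr -IH.
  have UUn n' (h : (0 < n')%N) : unitary_rep (U n') by case: (hw n' h).
  apply: (highest_weight_mul G_compact G_connected T_maximal X0_regular
    (l := fun X => n.+2%:R * omega X) (l1 := fun X => n.+1%:R * omega X) (l2 := omega)).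
  - exact: UUn. - exact: UUn. - exact: UUn.
  - exact: (hw_killed (hw n.+2 isT)). - exact: (hw_killed (hw n.+1 isT)). - exact: (hw_killed hw1).
  - exact: (hw_weight (hw n.+2 isT)). - exact: (hw_weight (hw n.+1 isT)). - exact: (hw_weight hw1).
  - by move=> X; rewrite -(natr1 n.+1) mulrDl mul1r.
  - exact: (hw_norm (hw n.+2 isT)). - exact: (hw_norm (hw n.+1 isT)). - exact: (hw_norm hw1).
have kernE n x : (0 < n)%N -> kern (U n) (xi n) x = k x ^+ n.
  case: n => // n _; rewrite /kern coefE /k /kern.
  by elim: n => [|n IH]; rewrite ?expr1 // exprS normsqM IH -exprS.
(* An element fixing [omega] also fixes [n * omega], so the line of [xi n] is preserved by [H]. *)
have line n (h : (0 < n)%N) x : H x -> exists2 c, normsq c = 1 & U n x *m xi n = c *: xi n.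
  move=> Hx; apply: (stabilizer_scalar G_compact G_connected T_maximal X0_regular (hw n h)).
  by move=> X; rewrite Hx.
have UUn n (h : (0 < n)%N) : unitary_rep (U n) by case: (hw n h).
have Uirr n (h : (0 < n)%N) : irreducible_rep (U n) by case: (hw n h).
have nrm n (h : (0 < n)%N) := hw_norm (hw n h).
pose K y (q : coset_space H) := coset_kern (U 1%N) (xi 1%N) y q.
have Kc y : continuous (K y).
  exact: (coset_kern_continuous H1 HM HV (UUn 1%N isT) (line 1%N isT)).
have Kpi y x : K y (\pi_(coset_space H) x)%qT = k (y^-1 * x)%g.
  exact: (coset_kern_pi H1 HM HV (UUn 1%N isT) (line 1%N isT)).
have KE n (h : (0 < n)%N) y : coset_kern (U n) (xi n) y = fun q : coset_space H => K y q ^+ n.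
  by apply/funext => q; exact: kernE.
have mK n (h : (0 < n)%N) y : (d n)%:R * mean mu (fun q => K y q ^+ n) = 1.
  rewrite -KE //; exact: (mean_kern H1 HM HV G_compact mu_invariant (UUn n h) (Uirr n h)
    (nrm n h) (line n h) (sigma_adjP n h)).
have k_cont : continuous k := kern_continuous hw1.
have k_ge0 x : 0 <= k x by exact: kern_ge0.
have k_le1 x : k x <= 1 := kern_le1 hw1 x.
have k1 : k 1%g = 1 := kern1 hw1.
have k_eq1 x : k x = 1 -> H x := @kern_eq1 _ _ _ _ _ _ G_compact G_connected T_maximal X0_regular _ _ _ _ hw1 x.
have [ell_c ell_ge0 _ _ _] := ell_length.
have [M ellM] : exists M, forall x, ell x <= M.
  have [||c _ cM] := @compact_EVT_max _ _ ell [set: G] _ G_compact.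
  - by exists 1%g.
  - exact: continuous_subspaceT.
  - by exists (ell c) => x; exact: (cM x (mem_set I)).
have M0 : 0 <= M := le_trans (ell_ge0 1%g) (ellM 1%g).
(* At [n = 0] the condition is vacuous, so admissible constants exist for every index. *)
pose adm n c := (0 < n)%N -> forall f : coset_space H -> R[i], continuousC f ->
  (sup_norm (fun q => f q - berezin_symbol (U n) (xi n) (sigma_adj n f) q)%R
     <= c%:E * lip_norm ell f)%E.
(* The factor 2 comes from estimating real and imaginary parts separately. *)
have key n e delta c : (0 < n)%N -> 0 < e -> 0 <= delta ->
    (forall x, delta < k x -> exists2 h, H h & ell (x * h)%g < e) ->
    2 * (e + M * ((d n)%:R * delta ^+ n)) <= c -> adm n c.
  move=> n0 e0 delta0 conc ec _ f fc.
  have c0 : 0 < c.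
    apply: lt_le_trans ec; rewrite mulr_gt0 // ltr_pwDl // !mulr_ge0 // exprn_ge0 //.
  have := lip_norm_ge0 ell f.
  (* An infinite Lip-norm makes the bound trivial, because [c] is positive. *)
  case E : (lip_norm ell f) => [L| |] // L0; last by rewrite gt0_muley ?leey ?lte_fin.
  rewrite lee_fin in L0; rewrite -EFinM; apply: sup_norm_le => q.
  have [y ->] : exists y, q = (\pi_(coset_space H) y)%qT by exists (repr q); rewrite reprK.
  have [bR bI] := berezin_adj H1 HM HV G_compact (UUn n n0) (Uirr n n0) (line n n0) (sigma_adjP n n0) y fc.
  have lip := lip_norm_lipschitz H1 HM HV ell_length E.
  have ReB (z w : R[i]) : complex.Re (z - w) = complex.Re z - complex.Re w by case: z w => [? ?] [? ?].
  have ImB (z w : R[i]) : complex.Im (z - w) = complex.Im z - complex.Im w by case: z w => [? ?] [? ?].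
  have D0 : (0 : R) <= (d n)%:R by [].
  have err g : continuous g -> (forall x z, `|g (\pi_(coset_space H) x)%qT - g (\pi_(coset_space H) z)%qT|
        <= L * ell (z^-1 * x)%g) ->
      `|g (\pi_(coset_space H) y)%qT - (d n)%:R * mean mu (fun q => coset_kern (U n) (xi n) y q * g q)|
        <= L * (e + M * ((d n)%:R * delta ^+ n)).
    move=> gc gL; rewrite KE //.
    exact: (mean_error H1 HM HV G_compact k_ge0 ell_length Kc Kpi gc L0 (ltW e0) D0 ellM delta0 gL conc (mK n n0 y)).
  apply: le_trans (normc_le_Re_Im _) _; rewrite ReB ImB bR bI.
  apply: le_trans (lerD (err _ fc.1 _) (err _ fc.2 _)) _.
  - by move=> x z; rewrite -ReB; apply: le_trans (lip x z); case: (normc_ge_Re_Im (f (\pi_(coset_space H) x)%qT - f (\pi_(coset_space H) z)%qT)).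
  - by move=> x z; rewrite -ImB; apply: le_trans (lip x z); case: (normc_ge_Re_Im (f (\pi_(coset_space H) x)%qT - f (\pi_(coset_space H) z)%qT)).
  - by have := ler_wpM2r L0 ec; move: (e + _) => X; lra.
have [||e e0|gamma [gamma0 gammaP]] := @exists_null_sequence R adm.
- move=> n c c' Pc cc' n0 f fc; apply: le_trans (Pc n0 f fc) _.
  by apply: lee_wpmul2r; [exact: lip_norm_ge0|rewrite lee_fin].
- case=> [|n]; first by exists 1.
  have [delta [delta0 _ conc]] := kern_concentration HV G_compact k_cont k_ge0 k_le1 k_eq1 ell_length (@ltr01 R).
  exists (2 * (1 + M * ((d n.+1)%:R * delta ^+ n.+1))); last exact: key conc _.
  by rewrite mulr_gt0 // ltr_pwDl // !mulr_ge0 // exprn_ge0.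
- have e4 : 0 < e / 4 by rewrite divr_gt0.
  have [delta [delta0 delta1 conc]] := kern_concentration HV G_compact k_cont k_ge0 k_le1 k_eq1 ell_length e4.
  (* Strictly between [delta] and 1: the lower bound at [delta'] and [mK] give
     [d n * delta' ^+ n * c <= 1], so [d n * delta ^+ n] is at most [(delta / delta') ^+ n / c],
     which tends to 0. *)
  pose delta' := (1 + delta) / 2.
  have [d0 d1 dd] : [/\ 0 < delta', delta' < 1 & delta < delta'] by rewrite /delta'; split; lra.
  have [c c0 lower] := kern_mean_lower H1 HM HV G_compact k_ge0 k_le1 k1 mu_invariant Kc Kpi (ltW d0) d1.
  pose r := delta / delta'.
  have r0 : 0 <= r by rewrite divr_ge0 // ltW.
  have r1 : `|r| < 1 by rewrite ger0_norm // ltr_pdivrMr // mul1r.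
  (* Chosen so that [M * eta <= e / 4]; the total is then at most [2 * (e / 4 + e / 4) = e]. The
     added 1 avoids division by zero when [M = 0]. *)
  pose eta := e / (4 * (M + 1)).
  have M1 : 0 < M + 1 by rewrite ltr_wpDl.
  have eta0 : 0 < eta by rewrite divr_gt0 // mulr_gt0.
  have /cvgrPdist_le/(_ _ (mulr_gt0 eta0 c0)) [N _ hN] := cvg_expr r1.
  exists N => n Nn; rewrite /adm => n0; apply: (key n (e / 4) delta) => //.
  have := hN n Nn; rewrite /= sub0r normrN ger0_norm ?exprn_ge0 // => rn.
  have D0 : (0 : R) <= (d n)%:R by [].
  have Dn : (d n)%:R * delta ^+ n <= eta.
    rewrite -(ler_pM2r c0); apply: le_trans rn.
    have -> : delta ^+ n = r ^+ n * delta' ^+ n by rewrite -exprMn /r divfK ?gt_eqF.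
    have := ler_wpM2l D0 (lower n 1%g); rewrite mK // => h.
    rewrite [leLHS](_ : _ = r ^+ n * ((d n)%:R * (delta' ^+ n * c))); last by ring.
    by rewrite ler_piMr // exprn_ge0.
  have h1 : M * ((d n)%:R * delta ^+ n) <= M * eta by rewrite ler_wpM2l.
  have h2 : M * eta <= e / 4.
    rewrite /eta [leLHS](_ : _ = (e / 4) * (M / (M + 1))); last by field; rewrite gt_eqF.
    by rewrite ler_piMr ?(ltW e4) // ler_pdivrMr // mul1r lerDl.
  lra.
exists gamma; split => // n n0 f fc; exact: gammaP.
Qed.
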